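(* Let $(X,P)$ be a geometric formal orbifold. The category of vector bundles on $(X,P)$ does not depend on the choice of the étale Galois cover used to define it: if $(Y_1,O)\to (X,P)$ and $(Y_2,O)\to (X,P)$ are connected étale Galois covers with Galois groups $\Gamma_1$ and $\Gamma_2$ respectively, then the category of $\Gamma_1$-bundles on $Y_1$ is equivalent to the category of $\Gamma_2$-bundles on $Y_2$.
   Context: Let $k$ be an algebraically closed field of arbitrary characteristic; all curves are over $k$. A covering of smooth projective curves is a finite generically étale (separable) morphism. For a smooth projective curve $X$ and a closed point $x\in X$, $\mathcal{K}_{X,x}$ denotes the fraction field of $\widehat{\mathcal O}_{X,x}$. A branch data on $X$ is a function $P$ assigning to each closed point $x\in X$ a finite Galois extension $P(x)$ of $\mathcal K_{X,x}$ (in a fixed algebraic closure) such that $\{x: P(x)\ne \mathcal K_{X,x}\}$ is finite; $O$ denotes the trivial branch data, $O(x)=\mathcal K_{X,x}$ for all $x$. A formal orbifold is a pair $(X,P)$ with $X$ a smooth projective curve and $P$ a branch data on $X$. A morphism of formal orbifolds $f:(Y,Q)\to(X,P)$ is a covering $f:Y\to X$ such that for every closed point $y\in Y$ the extension $Q(y)/\mathcal K_{X,f(y)}$ contains $P(f(y))/\mathcal K_{X,f(y)}$; it is étale if $Q(y)=P(f(y))$ for all $y$. Thus a Galois covering $f:Y\to X$ with group $\Gamma$ defines an étale Galois cover $(Y,O)\to(X,P)$ with group $\Gamma$ iff $\mathcal K_{Y,y}=P(f(y))$ for all $y\in Y$. A formal orbifold $(X,P)$ is geometric if there is a connected étale cover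 $(Y,O)\to(X,P)$. Let a finite group $\Gamma$ act on $Y$, with action map $\mu:\Gamma\times Y\to Y$ and second projection $p:\Gamma\times Y\to Y$. A $\Gamma$-bundle on $Y$ is a vector bundle $V$ on $Y$ together with an isomorphism $\lambda:\mu^*V\to p^*V$ such that, writing $\lambda_g=\lambda|_{g\times Y}:g^*V\to V$, one has $\lambda_{gh}=\lambda_h\circ h^*\lambda_g$ for all $g,h\in\Gamma$. Morphisms of $\Gamma$-bundles are the vector bundle morphisms (i.e. $\mathcal O_Y$-linear homomorphisms) commuting with the isomorphisms $\lambda$ ($\Gamma$-equivariant homomorphisms). A vector bundle on a geometric formal orbifold $(X,P)$ is defined, after fixing a connected étale Galois cover $(Y,O)\to(X,P)$ with Galois group $\Gamma$, to be a $\Gamma$-bundle on $Y$, with morphisms the morphisms of $\Gamma$-bundles. *)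

(* Defs.v *)
(* The definitions are meant for k algebraically closed: a variety over k is
   then described by its closed points, a topological space together with the
   sheaf of k-valued regular functions. *)
From HB Require Import structures.
From mathcomp Require Import fingroup all_boot all_algebra all_field.
From mathcomp Require Import ring_quotient fraction.
From mathcomp Require Import all_classical topology.
From mathcomp Require Import mpoly ring.
Set Implicit Arguments.
Unset Strict Implicit.
Unset Printing Implicit Defensive.
Import GRing.Theory.
Local Open Scope classical_set_scope.
Local Open Scope ring_scope.
Local Open Scope quotient_scope.

(* A sheaf of k-valued functions is recorded by its germs: [regular_at x f]
   says that f : X -> k restricts to a section on a neighbourhood of x; the
   values of f away from x are irrelevant. *)
Record fspace (k : fieldType) := FSpace {
  fs_top :> topologicalType;
  regular_at : fs_top -> (fs_top -> k) -> Prop;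
  regular_cst : forall x c, regular_at x (cst c);
  regularB : forall x f g,
    regular_at x f -> regular_at x g -> regular_at x (f - g);
  regularM : forall x f g,
    regular_at x f -> regular_at x g -> regular_at x (f * g);
  regularV : forall x f, f x != 0 ->
    regular_at x f -> regular_at x (fun y => (f y)^-1);
  regular_neq0 : forall x f, f x != 0 ->
    regular_at x f -> \forall y \near x, f y != 0;
  regular_near : forall x f,
    regular_at x f -> \forall y \near x, regular_at y f;
  regular_eq : forall x f g, (\forall y \near x, f y = g y) ->
    regular_at x f -> regular_at x g
}.

Record mor (k : fieldType) (X Y : fspace k) := Mor {
  mor_fun :> X -> Y;
  mor_cts : continuous mor_fun;
  mor_reg : forall x (f : Y -> k),
    regular_at (mor_fun x) f -> regular_at x (f \o mor_fun)
}.

Definition isomorphic (k : fieldType) (X Y : fspace k) : Prop :=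
  exists (f : mor X Y) (g : mor Y X), cancel f g /\ cancel g f.

Section Subspace.
Variables (k : fieldType) (X : fspace k) (A : set X).

Definition sub_regular_at (u : A) (f : A -> k) : Prop :=
  exists2 g : X -> k, regular_at (val u) g & \forall v \near u, f v = g (val v).

Lemma val_near (u : A) (P : set X) :
  (\forall x \near val u, P x) -> \forall v \near u, P (val v).
Proof.
by move=> uP; exact: (@initial_continuous A X set_val u P uP).
Qed.

Fact sub_regular_cst u c : sub_regular_at u (cst c).
Proof. by exists (cst c); [exact: regular_cst | exact: (@nearW _ (nbhs u))]. Qed.

Fact sub_regularB u f g : sub_regular_at u f -> sub_regular_at u g ->
  sub_regular_at u (f - g).
Proof.
move=> [f' rf' ef] [g' rg' eg]; exists (f' - g'); first exact: regularB.
by apply: filterS2 ef eg => v; rewrite !fctE => -> ->.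
Qed.

Fact sub_regularM u f g : sub_regular_at u f -> sub_regular_at u g ->
  sub_regular_at u (f * g).
Proof.
move=> [f' rf' ef] [g' rg' eg]; exists (f' * g'); first exact: regularM.
by apply: filterS2 ef eg => v; rewrite !fctE => -> ->.
Qed.

Fact sub_regularV u f : f u != 0 -> sub_regular_at u f ->
  sub_regular_at u (fun v => (f v)^-1).
Proof.
move=> fu [f' rf' ef]; exists (fun x => (f' x)^-1).
  by apply: regularV rf'; rewrite -(nbhs_singleton ef).
by apply: filterS ef => v ->.
Qed.

Fact sub_regular_neq0 u f : f u != 0 -> sub_regular_at u f ->
  \forall v \near u, f v != 0.
Proof.
move=> fu [f' rf' ef]; have f'u : f' (val u) != 0.
  by rewrite -(nbhs_singleton ef).
by apply: filterS2 ef (val_near (regular_neq0 f'u rf')) => v ->.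
Qed.

Fact sub_regular_near u f : sub_regular_at u f ->
  \forall v \near u, sub_regular_at v f.
Proof.
move=> [f' rf' ef].
apply: filterS2 (val_near (regular_near rf')) (near_join ef) => v rv ev.
by exists f'.
Qed.

Fact sub_regular_eq u f g : (\forall v \near u, f v = g v) ->
  sub_regular_at u f -> sub_regular_at u g.
Proof.
move=> efg [f' rf' ef]; exists f' => //.
by apply: filterS2 efg ef => v <-.
Qed.

Definition subfs : fspace k := FSpace sub_regular_cst sub_regularB
  sub_regularM sub_regularV sub_regular_neq0 sub_regular_near sub_regular_eq.

End Subspace.

Section Restriction.
Variables (k : fieldType) (X Y : fspace k) (f : mor X Y).
Variables (A : set X) (B : set Y) (sAB : A `<=` f @^-1` B).

Fact restr_subproof (u : subfs A) : f (val u) \in B.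
Proof. exact/mem_set/sAB/set_mem/valP. Qed.

Definition restr_fun (u : subfs A) : subfs B := 
  exist (fun x => x \in B) _ (restr_subproof u).

Fact restr_cts : continuous restr_fun.
Proof.
apply/continuous_comp_initial => u.
apply: (@continuous_comp _ _ _ (set_val : subfs A -> X) f); last exact: mor_cts.
exact: initial_continuous.
Qed.

Fact restr_reg u (g : subfs B -> k) :
  regular_at (restr_fun u) g -> regular_at u (g \o restr_fun).
Proof.
move=> [g' rg' eg]; exists (g' \o f); first exact: mor_reg.
exact: restr_cts eg.
Qed.

Definition restr : mor (subfs A) (subfs B) := Mor restr_cts restr_reg.

End Restriction.

Section IdComp.
Variables (k : fieldType) (X : fspace k).
Fact idmor_cts : continuous (@id X). Proof. by move=> x; exact: cvg_id. Qed.
Fact idmor_reg x (f : X -> k) : regular_at x f -> regular_at x (f \o id).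
Proof. by []. Qed.
Definition idmor : mor X X := Mor idmor_cts idmor_reg.
End IdComp.

(* A point of P^n is represented by its unique homogeneous coordinate vector
   whose first nonzero entry is 1. *)
Record projective_space (k : fieldType) (n : nat) := ProjPoint {
  pcoord : 'rV[k]_n.+1;
  _ : [exists i, (pcoord 0 i == 1) &&
        [forall j : 'I_n.+1, (j < i)%N ==> (pcoord 0 j == 0)]]
}.

HB.instance Definition _ k n := [isSub for @pcoord k n].
HB.instance Definition _ k n := [Choice of projective_space k n by <:].

Section Projective.
Variables (k : fieldType) (n : nat).
Implicit Types (F G : {mpoly k[n.+1]}) (p q : projective_space k n).

Definition peval F p : k := F.@[fun i => pcoord p 0 i].

Definition zariski_open (U : set (projective_space k n)) : Prop :=
  exists2 S : set {mpoly k[n.+1]},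
    (forall F, S F -> exists d, F \is d.-homog) &
    U = [set p | exists2 F, S F & peval F p != 0].

Fact zariski_openT : zariski_open setT.
Proof.
exists [set 1]; first by move=> F ->; exists 0%N; exact: dhomog1.
apply/seteqP; split=> // p _; exists 1 => //.
by rewrite /peval meval1 oner_eq0.
Qed.

Fact zariski_openI : setI_closed zariski_open.
Proof.
move=> _ _ [S hS ->] [T hT ->].
exists [set H | exists F G, [/\ S F, T G & H = F * G]].
  move=> _ [F [G [/hS[d hF] /hT[e hG] ->]]]; exists (d + e)%N; exact: dhomogM.
apply/seteqP; split=> p.
  move=> [[F SF Fp] [G TG Gp]]; exists (F * G); first by exists F, G.
  by rewrite /peval mevalM mulf_neq0.
move=> [_ [F [G [SF TG ->]]]]; rewrite /peval mevalM mulf_eq0 negb_or.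
by case/andP=> Fp Gp; split; [exists F|exists G].
Qed.

Fact zariski_open_bigU (I : Type) (U : I -> set (projective_space k n)) :
  (forall i, zariski_open (U i)) -> zariski_open (\bigcup_i U i).
Proof.
move=> oU; exists [set F | (exists d, F \is d.-homog) /\
    forall p, peval F p != 0 -> (\bigcup_i U i) p]; first by move=> F [].
apply/seteqP; split=> p; last by move=> [F [_]]; exact.
move=> [i _]; have [S hS UE] := oU i; rewrite UE => -[F SF Fp].
exists F => //; split; first exact: hS.
by move=> q Fq; exists i => //; rewrite UE; exists F.
Qed.

HB.instance Definition _ := isOpenTopological.Build (projective_space k n)
  zariski_openT zariski_openI zariski_open_bigU.

Definition proj_regular_at p (f : projective_space k n -> k) : Prop :=
  exists d F G, [/\ F \is d.-homog, G \is d.-homog &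
    \forall q \near p, peval G q != 0 /\ f q = peval F q / peval G q].

Lemma peval_near F p d : F \is d.-homog -> peval F p != 0 ->
  \forall q \near p, peval F q != 0.
Proof.
move=> hF Fp; exists [set q | peval F q != 0]; split=> //.
exists [set F]; first by move=> _ ->; exists d.
by apply/seteqP; split=> q /=; [exists F|case=> _ ->].
Qed.

Fact proj_regular_cst p c : proj_regular_at p (cst c).
Proof.
exists 0%N, (c *: 1), 1; split; [exact/dhomogZ/dhomog1|exact: dhomog1|].
by apply: (@nearW _ (nbhs p)) => q; rewrite /peval mevalZ meval1 mulr1 oner_eq0 divr1.
Qed.

Fact proj_regularB p f g : proj_regular_at p f -> proj_regular_at p g ->
  proj_regular_at p (f - g).
Proof.
move=> [d [F [G [hF hG e]]]] [d' [F' [G' [hF' hG' e']]]].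
exists (d + d')%N, (F * G' - F' * G), (G * G'); split.
- by apply: rpredB; [|rewrite addnC]; exact: dhomogM.
- exact: dhomogM.
apply: filterS2 e e' => q [Gq fq] [G'q gq].
have -> : (f - g) q = f q - g q by [].
rewrite fq gq /peval !(mevalM, mevalB).
by split; [exact: mulf_neq0|rewrite -[in LHS]mulNr addf_div // mulNr].
Qed.

Fact proj_regularM p f g : proj_regular_at p f -> proj_regular_at p g ->
  proj_regular_at p (f * g).
Proof.
move=> [d [F [G [hF hG e]]]] [d' [F' [G' [hF' hG' e']]]].
exists (d + d')%N, (F * F'), (G * G'); split; try exact: dhomogM.
apply: filterS2 e e' => q [Gq fq] [G'q gq].
have -> : (f * g) q = f q * g q by [].
rewrite fq gq /peval !mevalM.
by split; [exact: mulf_neq0|rewrite mulf_div].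
Qed.

Fact proj_regularV p f : f p != 0 -> proj_regular_at p f ->
  proj_regular_at p (fun q => (f q)^-1).
Proof.
move=> fp [d [F [G [hF hG e]]]]; exists d, G, F; split=> //.
have Fp : peval F p != 0.
  have [_ fpE] := nbhs_singleton e.
  by move: fp; rewrite fpE mulf_eq0 negb_or => /andP[].
by apply: filterS2 e (peval_near hF Fp) => q [Gq ->] Fq; rewrite invf_div.
Qed.

Fact proj_regular_neq0 p f : f p != 0 -> proj_regular_at p f ->
  \forall q \near p, f q != 0.
Proof.
move=> fp [d [F [G [hF hG e]]]].
have Fp : peval F p != 0.
  have [_ fpE] := nbhs_singleton e.
  by move: fp; rewrite fpE mulf_eq0 negb_or => /andP[].
apply: filterS2 e (peval_near hF Fp) => q [Gq ->] Fq.
by rewrite mulf_neq0 // invr_neq0.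
Qed.

Fact proj_regular_near p f : proj_regular_at p f ->
  \forall q \near p, proj_regular_at q f.
Proof.
move=> [d [F [G [hF hG /near_join e]]]].
by apply: filterS e => q eq; exists d, F, G.
Qed.

Fact proj_regular_eq p f g : (\forall q \near p, f q = g q) ->
  proj_regular_at p f -> proj_regular_at p g.
Proof.
move=> efg [d [F [G [hF hG e]]]]; exists d, F, G; split=> //.
by apply: filterS2 efg e => q <-.
Qed.

Definition projective_fs : fspace k := FSpace proj_regular_cst proj_regularB
  proj_regularM proj_regularV proj_regular_neq0 proj_regular_near
  proj_regular_eq.

End Projective.

Definition projective (k : fieldType) (X : fspace k) : Prop :=
  exists n (Z : set (projective_fs k n)), closed Z /\ isomorphic X (subfs Z).

(* The chart x_0 != 0 of P^n is A^n, so its relatively closed subspaces are the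
   closed subspaces of A^n. *)
Definition affine (k : fieldType) (X : fspace k) : Prop :=
  exists n (Z : set (projective_fs k n)), closed Z /\
    isomorphic X (subfs (Z `&` [set p | pcoord p 0 ord0 != 0])).

Section Sections.
Variables (k : fieldType) (X : fspace k).

Definition is_section : pred (X -> k) := [pred f | `[< forall x, regular_at x f >]].

Fact is_section_subring : subring_closed is_section.
Proof.
split=> [|f g /asboolP rf /asboolP rg|f g /asboolP rf /asboolP rg];
  apply/asboolP => x; [exact: regular_cst|exact: regularB|exact: regularM].
Qed.

Record sections := Section_ { section_fun :> X -> k; _ : section_fun \in is_section }.
HB.instance Definition _ := [isSub for section_fun].
HB.instance Definition _ := [Choice of sections by <:].
HB.instance Definition _ := GRing.SubChoice_isSubComPzRing.Build _ _ sections
  is_section_subring.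

End Sections.

Section Pullback.
Variables (k : fieldType) (X Y : fspace k) (f : mor X Y).
Fact pullback_subproof (s : sections Y) : s \o f \in @is_section k X.
Proof. by have /asboolP rs := valP s; apply/asboolP => x; exact: mor_reg. Qed.
Definition pullback (s : sections Y) : sections X := Section_ (pullback_subproof s).
End Pullback.

Section Stalk.
Variables (k : fieldType) (X : fspace k) (x : X).

Definition near_section : pred (X -> k) := [pred f | `[< regular_at x f >]].

Fact near_section_subring : subring_closed near_section.
Proof.
split=> [|f g /asboolP rf /asboolP rg|f g /asboolP rf /asboolP rg];
  apply/asboolP; [exact: regular_cst|exact: regularB|exact: regularM].
Qed.

Record pregerm := Pregerm { pregerm_fun :> X -> k; _ : pregerm_fun \in near_section }.
HB.instance Definition _ := [isSub for pregerm_fun].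
HB.instance Definition _ := [Choice of pregerm by <:].
HB.instance Definition _ := GRing.SubChoice_isSubComPzRing.Build _ _ pregerm
  near_section_subring.

Fact pregerm_oner_neq0 : (1 : pregerm) != 0.
Proof.
apply/eqP => /(congr1 (fun f : pregerm => f x)) /eqP.
by rewrite [X in X == _](_ : _ = 1 :> k) // oner_eq0.
Qed.
HB.instance Definition _ := GRing.PzSemiRing_isNonZero.Build pregerm
  pregerm_oner_neq0.

Definition null_germ (f : pregerm) : bool := `[< \forall y \near x, f y = 0 >].

Fact null_germ_ideal : idealr_closed null_germ.
Proof.
split.
- by apply/asboolP; exact: (@nearW _ (nbhs x)).
- apply/asboolP => /nbhs_singleton /eqP.
  by rewrite [X in X == _](_ : _ = 1 :> k) // oner_eq0.
move=> a u v /asboolP u0 /asboolP v0; apply/asboolP.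
apply: filterS2 u0 v0 => y uy vy.
rewrite [LHS](_ : _ = (a : pregerm) y * (u : pregerm) y + (v : pregerm) y) //.
by rewrite uy vy mulr0 addr0.
Qed.
Definition null_ideal : idealr pregerm :=
  HB.pack null_germ (isIdealr.Build pregerm null_germ null_germ_ideal).

(* The local ring O_{X,x}: germs at x of regular functions. *)
Definition stalk := {ideal_quot null_ideal}.
HB.instance Definition _ := GRing.ComNzRing.on stalk.

Definition germ (f : pregerm) : stalk := \pi f.

Lemma germ_eqP (f g : pregerm) :
  germ f = germ g <-> \forall y \near x, f y = g y.
Proof.
split=> [/eqP|fg].
  rewrite -Quotient.idealrBE => /asboolP; apply: filterS => y.
  have -> : (f - g) y = f y - g y by [].
  by move/eqP; rewrite subr_eq0 => /eqP.
apply/eqP; rewrite -Quotient.idealrBE; apply/asboolP.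
apply: filterS fg => y fgy.
by have -> : (f - g) y = f y - g y by []; rewrite fgy subrr.
Qed.

Lemma germ_repr (a : stalk) : germ (repr a) = a.
Proof. exact: reprK. Qed.

Lemma germM (f g : pregerm) : germ (f * g) = germ f * germ g.
Proof. exact: (rmorphM \pi_stalk). Qed.

Lemma germB (f g : pregerm) : germ (f - g) = germ f - germ g.
Proof. exact: (rmorphB \pi_stalk). Qed.

Lemma germ1 : germ 1 = 1.
Proof. exact: (rmorph1 \pi_stalk). Qed.

End Stalk.

(* The non-units; this is the maximal ideal when A is a local ring. *)
Definition nonunit (A : comNzRingType) (a : A) : Prop :=
  ~ exists b, a * b = 1.

Section StalkPull.
Variables (k : fieldType) (Y X : fspace k) (f : mor Y X) (y : Y).

Fact pregerm_pull_subproof (g : pregerm (f y)) : g \o f \in near_section y.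
Proof. by have /asboolP rg := valP g; apply/asboolP; exact: mor_reg. Qed.
Definition pregerm_pull (g : pregerm (f y)) : pregerm y :=
  Pregerm (pregerm_pull_subproof g).

(* The local homomorphism O_{X,f(y)} -> O_{Y,y}. *)
Definition stalk_pull (a : stalk (f y)) : stalk y := germ (pregerm_pull (repr a)).

Lemma stalk_pullE (g : pregerm (f y)) :
  stalk_pull (germ g) = germ (pregerm_pull g).
Proof.
apply/germ_eqP.
have /germ_eqP e : germ (repr (germ g)) = germ g by exact: germ_repr.
exact: (@mor_cts _ _ _ f y _ e).
Qed.

Fact stalk_pull_zmod_morphism : zmod_morphism stalk_pull.
Proof.
move=> a b; rewrite -[a]germ_repr -[b]germ_repr.
rewrite -germB !stalk_pullE -germB.
by congr germ; apply: val_inj.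
Qed.

Fact stalk_pull_monoid_morphism : monoid_morphism stalk_pull.
Proof.
split=> [|a b].
  by rewrite -germ1 stalk_pullE -germ1; congr germ; apply: val_inj.
rewrite -[a]germ_repr -[b]germ_repr -germM !stalk_pullE -germM.
by congr germ; apply: val_inj.
Qed.

HB.instance Definition _ := GRing.isZmodMorphism.Build _ _ stalk_pull
  stalk_pull_zmod_morphism.
HB.instance Definition _ := GRing.isMonoidMorphism.Build _ _ stalk_pull
  stalk_pull_monoid_morphism.

Lemma stalk_pull_local (a : stalk (f y)) : nonunit a -> nonunit (stalk_pull a).
Proof.
move=> na [b]; rewrite -[a]germ_repr -[b]germ_repr stalk_pullE -germM.
rewrite -germ1 => /germ_eqP /nbhs_singleton.
set g := repr a; set h := repr b => gh.
have gy : g (f y) != 0.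
  apply/eqP => gy; have : (pregerm_pull g * h) y = g (f y) * h y by [].
  by rewrite gh gy mul0r => /eqP; rewrite oner_eq0.
have /asboolP rg := valP g.
have rgV : (fun x => (g x)^-1) \in near_section (f y).
  by apply/asboolP; exact: regularV.
apply: na; exists (germ (Pregerm rgV)); rewrite -[a]germ_repr -germM.
rewrite -germ1; apply/germ_eqP.
apply: filterS (regular_neq0 gy rg) => x gx.
exact: (mulfV gx).
Qed.

End StalkPull.

(* For a Noetherian local ring, being regular of dimension 1 means that the
   maximal ideal is generated by one element, which is not nilpotent. *)
Definition regular_local_dim1 (A : comNzRingType) : Prop :=
  exists t : A, [/\ nonunit t, forall n, t ^+ n != 0 &
    forall a, nonunit a -> exists b, a = t * b].

(* The power m^n of the maximal ideal m. *)
Fixpoint max_pow (A : comNzRingType) (n : nat) : set A :=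
  if n is n'.+1 then
    [set a | exists r (b c : 'I_r -> A), [/\ forall i, nonunit (b i),
       forall i, max_pow n' (c i) & a = \sum_(i < r) b i * c i]]
  else setT.

Lemma max_pow_morph (A B : comNzRingType) (phi : {rmorphism A -> B}) n a :
  (forall a, nonunit a -> nonunit (phi a)) -> max_pow n a -> max_pow n (phi a).
Proof.
move=> loc; elim: n a => //= n IHn a [r [b [c [nb mc ->]]]].
exists r, (phi \o b), (phi \o c); split=> [i|i|]; first exact/loc.
  exact/IHn.
by rewrite rmorph_sum; apply: eq_bigr => i _; rewrite rmorphM.
Qed.

Section MaxPow.
Variable A : comNzRingType.
Implicit Types (a b : A) (n : nat).

Lemma max_pow0 n : max_pow n (0 : A).
Proof.
case: n => //= n; exists 0%N, (fun=> 0), (fun=> 0); split=> [[]|[]|] //.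
by rewrite big_ord0.
Qed.

Lemma max_powM n a b : max_pow n b -> max_pow n (a * b).
Proof.
elim: n b => //= n IHn _ [r [b [c [nb mc ->]]]].
exists r, b, (fun i => a * c i); split=> // [i|]; first exact: IHn.
by rewrite mulr_sumr; apply: eq_bigr => i _; rewrite mulrCA.
Qed.

Lemma max_powB n a b : max_pow n a -> max_pow n b -> max_pow n (a - b).
Proof.
move=> ma mb; have {mb} : max_pow n (- b) by rewrite -mulN1r; exact: max_powM.
case: n ma => //= n [r [x [y [nx my ->]]]] [r' [x' [y' [nx' my' ->]]]].
pose glue (u : 'I_r -> A) (u' : 'I_r' -> A) i :=
  match fintype.split i with inl j => u j | inr j => u' j end.
exists (r + r')%N, (glue x x'), (glue y y'); split=> [i|i|].
- by rewrite /glue; case: fintype.split.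
- by rewrite /glue; case: fintype.split.
rewrite big_split_ord /=; congr (_ + _); apply: eq_bigr => i _.
  by rewrite /glue -[lshift _ _]/(unsplit (inl _)) unsplitK.
by rewrite /glue -[rshift _ _]/(unsplit (inr _)) unsplitK.
Qed.

(* An element of the inverse limit of the A/m^n is given by representatives
   s n in A of its components, with s (n+1) = s n modulo m^n. *)
Definition coherent : pred (nat -> A) :=
  [pred s | `[< forall n, max_pow n (s n.+1 - s n) >]].

Fact coherent_subring : subring_closed coherent.
Proof.
split=> [|s u /asboolP hs /asboolP hu|s u /asboolP hs /asboolP hu];
    apply/asboolP => n.
- have -> : (1 : nat -> A) n.+1 - (1 : nat -> A) n = 0 by exact: subrr.
  exact: max_pow0.
- have -> : (s - u) n.+1 - (s - u) n = (s n.+1 - s n) - (u n.+1 - u n).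
    by rewrite [LHS](_ : _ = s n.+1 - u n.+1 - (s n - u n)) //; ring.
  exact: max_powB.
have -> : (s * u) n.+1 - (s * u) n =
    s n.+1 * (u n.+1 - u n) - (- u n * (s n.+1 - s n)).
  rewrite [LHS](_ : _ = s n.+1 * u n.+1 - s n * u n) //.
  ring.
by apply: max_powB; exact: max_powM.
Qed.

Record coherent_seq := CoherentSeq {
  coherent_fun :> nat -> A; _ : coherent_fun \in coherent }.
HB.instance Definition _ := [isSub for coherent_fun].
HB.instance Definition _ := [Choice of coherent_seq by <:].
HB.instance Definition _ := GRing.SubChoice_isSubComNzRing.Build _ _ coherent_seq
  coherent_subring.

End MaxPow.

Section Completion.
Variables (A : comNzRingType) (hA : regular_local_dim1 A).

Let t : A := sval (cid hA).
Let nt : nonunit t. Proof. by rewrite /t; case: cid => ? []. Qed.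
Let t_nil n : t ^+ n != 0. Proof. by rewrite /t; case: cid => ? []. Qed.
Let tP a : nonunit a -> exists b, a = t * b.
Proof. by rewrite /t; case: cid => ? [? ? h]; exact: h. Qed.

Let max_powP n a : max_pow n a <-> exists b, a = t ^+ n * b.
Proof.
elim: n a => [|n IHn] a /=; first by split=> // _; exists a; rewrite expr0 mul1r.
split=> [[r [b [c [nb mc ->]]]]|[b ->]].
  have db i := cid (tP (nb i)); have /= dc i := cid ((IHn _).1 (mc i)).
  exists (\sum_(i < r) sval (db i) * sval (dc i)); rewrite mulr_sumr.
  apply: eq_bigr => i _; rewrite exprS mulrACA.
  by rewrite -(svalP (db i)) -(svalP (dc i)).
exists 1%N, (fun=> t), (fun=> t ^+ n * b); split=> // [_|].
  by apply/IHn; exists b.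
by rewrite big_ord1 exprS mulrA.
Qed.

Let max_powW m n (a : A) : (m <= n)%N -> max_pow n a -> max_pow m a.
Proof.
move=> mn /max_powP[b ->]; apply/max_powP; exists (t ^+ (n - m) * b).
by rewrite mulrA -exprD subnKC.
Qed.

Definition null_seq (s : coherent_seq A) : bool := `[< forall n, max_pow n (s n) >].

Let not_max_pow1 : ~ max_pow 1 (1 : A).
Proof. by move=> /max_powP[b]; rewrite expr1 => e; apply: nt; exists b. Qed.

Fact null_seq_ideal : idealr_closed null_seq.
Proof.
split.
- by apply/asboolP => n; exact: max_pow0.
- by apply/asboolP => /(_ 1%N).
move=> a u v /asboolP u0 /asboolP v0; apply/asboolP => n.
have -> : (a * u + v) n = a n * u n - (- v n) by rewrite opprK.
by apply: max_powB; [exact: max_powM|rewrite -mulN1r; exact: max_powM].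
Qed.

Definition null_seq_idealr : idealr (coherent_seq A) :=
  HB.pack null_seq (isIdealr.Build (coherent_seq A) null_seq null_seq_ideal).

(* The completion of A: the inverse limit of the A/m^n. *)
Definition completion := {ideal_quot null_seq_idealr}.
HB.instance Definition _ := GRing.ComNzRing.on completion.

Definition limseq (s : coherent_seq A) : completion := \pi s.

Let val_t n a : ~ max_pow n a -> exists j u v,
  [/\ (j < n)%N, a = t ^+ j * u & u * v = 1].
Proof.
elim: n a => [|n IHn] a; first by case.
move=> na; have [ma|/IHn[j [u [v [jn au uv]]]]] := pselect (max_pow n a);
  last by exists j, u, v; rewrite ltnW.
move/max_powP: ma => [b ab].
have [[c bc]|nb] := pselect (exists c, b * c = 1); first by exists n, b, c.
have [c bc] := tP nb; case: na; apply/max_powP; exists c.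
by rewrite ab bc mulrA exprSr.
Qed.

Let val_lt m n u v : (m < n)%N -> u * v = 1 -> ~ max_pow n (t ^+ m * u).
Proof.
move=> mn uv /max_powP[b e].
have tm : t ^+ m = t ^+ m * (t ^+ (n - m) * (b * v)).
  by rewrite mulrA -exprD subnKC ?(ltnW mn) // mulrA -e -mulrA uv mulr1.
pose w := t ^+ (n - m) * (b * v).
have [[c wc]|nw] := pselect (exists c, (1 - w) * c = 1).
  have : t ^+ m * (1 - w) = 0 by rewrite mulrBr mulr1 -tm subrr.
  move=> /(congr1 ( *%R^~ c)); rewrite mul0r -mulrA wc mulr1 => /eqP.
  exact/negP/t_nil.
have [d wd] := tP nw; apply: nt; exists (d + t ^+ (n - m).-1 * (b * v)).
rewrite mulrDr -wd mulrA -exprS prednK ?subn_gt0 // -/w.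
by rewrite subrK.
Qed.

Let coh_le (s : coherent_seq A) m n : (m <= n)%N -> max_pow m (s n - s m).
Proof.
have /asboolP hs := valP s; elim: n => [|n IHn].
  by rewrite leqn0 => /eqP ->; rewrite subrr; exact: max_pow0.
rewrite leq_eqVlt => /predU1P[->|]; first by rewrite subrr; exact: max_pow0.
rewrite ltnS => mn; have -> : s n.+1 - s m = (s n.+1 - s n) - (s m - s n).
  by rewrite opprB addrA subrK.
apply: max_powB; first exact: max_powW (hs n).
by rewrite -opprB -mulN1r; apply/max_powM/IHn.
Qed.

Let null_seq_prime (a b : completion) : a * b = 0 -> (a == 0) || (b == 0).
Proof.
have limseq0 (s : coherent_seq A) : (limseq s == 0) = null_seq s.
  by rewrite -[0 in LHS](rmorph0 \pi_completion) -Quotient.idealrBE subr0.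
rewrite -[a]reprK -[b]reprK; set u := repr a; set v := repr b.
rewrite -[_ * _](rmorphM \pi_completion) => /eqP.
rewrite [_ == 0]limseq0 => /asboolP uv0.
rewrite ![_ == 0]limseq0; apply: contrapT => /negP; rewrite negb_or.
move=> /andP[/asboolPn /existsNP[i ui] /asboolPn /existsNP[j vj]].
have ndeep (s : coherent_seq A) m n : (m <= n)%N ->
    ~ max_pow m (s m) -> ~ max_pow m (s n).
  move=> mn sm sn; apply: sm; have -> : s m = s n - (s n - s m).
    by rewrite opprB addrC subrK.
  exact/max_powB/coh_le.
have [i' [a1 [a2 [ii uE a12]]]] := val_t (ndeep _ _ (i + j)%N (leq_addr _ _) ui).
have [j' [b1 [b2 [jj vE b12]]]] := val_t (ndeep _ _ (i + j)%N (leq_addl _ _) vj).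
have := uv0 (i + j)%N; have -> : (u * v) (i + j)%N = u (i + j)%N * v (i + j)%N.
  by [].
rewrite uE vE mulrACA -exprD; apply: (@val_lt _ _ _ (a2 * b2)).
  by rewrite -addSn leq_add // ltnW.
by rewrite mulrACA a12 b12 mulr1.
Qed.

Let unit_pred (a : completion) : bool := `[< exists b, b * a = 1 >].
Let inverse (a : completion) : completion :=
  if pselect (exists b, b * a = 1) is left e then sval (cid e) else a.

Let mul_inverse : {in unit_pred, left_inverse 1 inverse *%R}.
Proof.
move=> a /asboolP ua; rewrite /inverse; case: pselect => // e.
by case: cid.
Qed.
Let unit_predP (a b : completion) : b * a = 1 -> unit_pred a.
Proof. by move=> e; apply/asboolP; exists b. Qed.
Let inverse_out : {in [predC unit_pred], inverse =1 id}.
Proof.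
move=> a /negP ua; rewrite /inverse; case: pselect => // e.
by case: ua; apply/asboolP.
Qed.

HB.instance Definition _ := GRing.ComNzRing_hasMulInverse.Build completion
  mul_inverse unit_predP inverse_out.
HB.instance Definition _ := GRing.ComUnitRing_isIntegral.Build completion
  null_seq_prime.

End Completion.

Section CompletionMap.
Variables (A B : comNzRingType).
Variables (hA : regular_local_dim1 A) (hB : regular_local_dim1 B).
Variables (phi : {rmorphism A -> B}).
Hypothesis phi_local : forall a, nonunit a -> nonunit (phi a).

Fact coherent_map_subproof (s : coherent_seq A) : phi \o s \in @coherent B.
Proof.
have /asboolP hs := valP s; apply/asboolP => n /=.
by rewrite -rmorphB; exact: max_pow_morph.
Qed.

Definition completion_map (a : completion hA) : completion hB :=
  limseq hB (CoherentSeq (coherent_map_subproof (repr a))).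

End CompletionMap.
Arguments completion_map {A B} hA hB {phi} phi_local a.

(* Curves are connected by convention; being smooth they are then
   irreducible.  As k is algebraically closed, smooth means regular. *)
Record curve (k : fieldType) := Curve {
  curve_fs :> fspace k;
  curve_projective : projective curve_fs;
  curve_neq0 : [set: curve_fs] !=set0;
  curve_connected : connected [set: curve_fs];
  curve_smooth : forall x : curve_fs, regular_local_dim1 (stalk x)
}.

Section LocalFields.
Variables (k : fieldType) (X : curve k) (x : X).
Definition completed_stalk := completion (curve_smooth x).
HB.instance Definition _ := GRing.IntegralDomain.on completed_stalk.
(* The field K_{X,x}. *)
Definition local_field := {fraction completed_stalk}.
HB.instance Definition _ := GRing.Field.on local_field.
End LocalFields.

Section Coverings.
Variables (k : fieldType) (Y X : curve k) (f : mor Y X).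

Definition finite_mor : Prop :=
  forall x : X, exists V : set X, [/\ open V, V x, affine (subfs V),
    affine (subfs (f @^-1` V)) &
    exists r (e : 'I_r -> sections (subfs (f @^-1` V))), forall s,
      exists c : 'I_r -> sections (subfs V),
        s = \sum_(i < r) pullback (restr (@subset_refl _ (f @^-1` V))) (c i) * e i].

(* The equational criterion for flatness of B over A. *)
Definition flat (A B : comNzRingType) (phi : {rmorphism A -> B}) : Prop :=
  forall r (a : 'I_r -> A) (b : 'I_r -> B), \sum_(i < r) phi (a i) * b i = 0 ->
  exists n (b' : 'I_n -> B) (c : 'I_r -> 'I_n -> A),
    (forall i, b i = \sum_(j < n) phi (c i j) * b' j) /\
    (forall j, \sum_(i < r) a i * c i j = 0).

(* The maximal ideal of A generates the one of B. *)
Definition unramified (A B : comNzRingType) (phi : {rmorphism A -> B}) : Prop :=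
  forall b, nonunit b -> exists r (a : 'I_r -> A) (c : 'I_r -> B),
    (forall i, nonunit (a i)) /\ b = \sum_(i < r) phi (a i) * c i.

(* Flat and unramified; the residue fields are both k. *)
Definition etale_at (y : Y) : Prop :=
  flat (@stalk_pull k Y X f y) /\ unramified (@stalk_pull k Y X f y).

Definition generically (T : topologicalType) (P : set T) : Prop :=
  exists U : set T, [/\ open U, dense U & U `<=` P].

Definition covering : Prop := finite_mor /\ generically etale_at.

Definition completed_pull (y : Y) :
    completed_stalk (f y) -> completed_stalk y :=
  completion_map (curve_smooth (f y)) (curve_smooth y) (@stalk_pull_local k Y X f y).

End Coverings.

Record branch_data (k : fieldType) (X : curve k) := BranchData {
  branch :> forall x : X, splittingFieldType (local_field x);
  branch_galois : forall x, galois 1%VS {:branch x}%VS;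
  branch_finite : finite_set [set x | \dim {:branch x} != 1%N]
}.

Section TrivialBranch.
Variables (k : fieldType) (X : curve k).
Fact trivial_galois (x : X) : galois 1%VS {:(local_field x)^o}%VS.
Proof. by rewrite /galois subvf normalFieldf regular_fullv separable_refl. Qed.
Fact trivial_finite :
  finite_set [set x : X | \dim {:(local_field x)^o} != 1%N].
Proof.
rewrite [X in finite_set X](_ : _ = set0); first exact: finite_set0.
by apply/seteqP; split=> // x /=; rewrite regular_fullv dimv1.
Qed.
Definition trivial_branch : branch_data X :=
  @BranchData k X (fun x => (local_field x)^o) trivial_galois trivial_finite.
End TrivialBranch.

Record formal_orbifold (k : fieldType) := FormalOrbifold {
  orb_curve :> curve k;
  orb_branch : branch_data orb_curve
}.

Definition branch_map (k : fieldType) (X : curve k) (P : branch_data X) (x : X)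
  (a : completed_stalk x) : P x := (FracField.tofrac a)%:A.

Section OrbifoldMorphisms.
Variables (k : fieldType) (YQ XP : formal_orbifold k).
Variable f : mor YQ XP.
Notation Q := (orb_branch YQ).
Notation P := (orb_branch XP).

(* An embedding of P(f(y)) in Q(y) over the fraction field of the completed
   local ring at f(y).  As P(f(y)) is Galois, its image in Q(y) does not depend
   on the embedding, so inclusions inside an algebraic closure become
   embeddings and equalities become isomorphisms. *)
Definition branch_embedding (y : YQ) (h : {rmorphism P (f y) -> Q y}) : Prop :=
  forall a, h (branch_map P a) = branch_map Q (@completed_pull k YQ XP f y a).

Definition orbifold_mor : Prop :=
  covering f /\ forall y, exists h, @branch_embedding y h.

Definition orbifold_etale : Prop :=
  orbifold_mor /\ forall y, exists h, @branch_embedding y h /\ bijective h.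

End OrbifoldMorphisms.

Definition trivial_orbifold (k : fieldType) (Y : curve k) : formal_orbifold k :=
  FormalOrbifold (trivial_branch Y).

Definition geometric (k : fieldType) (XP : formal_orbifold k) : Prop :=
  exists (Y : curve k) (f : mor (trivial_orbifold Y) XP), orbifold_etale f.

Record group_action (k : fieldType) (G : finGroupType) (Y : fspace k) := Action {
  act :> G -> mor Y Y;
  act1 : forall y, act 1%g y = y;
  actM : forall g h y, act (g * h)%g y = act g (act h y)
}.

(* A rational function on X is given by a function X -> k that is regular on
   a dense open set, and is determined by its values on such a set. *)
Definition rational (k : fieldType) (X : fspace k) (f : X -> k) : Prop :=
  generically [set x | regular_at x f].

(* The field extension k(Y)/k(X) is Galois with group G: the group G acts
   faithfully on Y over X and k(X) is the fixed field of G in k(Y). *)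
Definition galois_covering (k : fieldType) (G : finGroupType) (Y X : curve k)
    (a : group_action G Y) (f : mor Y X) : Prop :=
  [/\ covering f,
      forall g y, f (a g y) = f y,
      forall g, (forall y, a g y = y) -> g = 1%g &
      forall s : Y -> k, rational s ->
        (forall g, generically [set y | s (a g y) = s y]) ->
        exists2 r : X -> k, rational r & generically [set y | s y = r (f y)]].

Definition etale_galois_cover (k : fieldType) (G : finGroupType) (Y : curve k)
    (XP : formal_orbifold k) (a : group_action G Y) (f : mor Y XP) : Prop :=
  galois_covering a f /\ @orbifold_etale k (trivial_orbifold Y) XP f.

Record opens (T : topologicalType) := Opens {
  open_set :> set T;
  open_setP : open open_set
}.

Section Modules.
Variables (k : fieldType) (Y : fspace k).

Definition structure_sheaf (U : opens Y) : comPzRingType := sections (subfs U).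

Definition sheaf_res (U W : opens Y) (sUW : U `<=` W) :
    structure_sheaf W -> structure_sheaf U :=
  pullback (@restr k Y Y (idmor Y) U W sUW).

Record module_sheaf := ModuleSheaf {
  sec :> forall U : opens Y, lmodType (structure_sheaf U);
  res : forall U W : opens Y, U `<=` W -> sec W -> sec U;
  resD : forall (U W : opens Y) (sUW : U `<=` W) u v, res sUW (u + v) = res sUW u + res sUW v;
  resZ : forall (U W : opens Y) (sUW : U `<=` W) (s : structure_sheaf W) v,
    res sUW (s *: v) = sheaf_res sUW s *: res sUW v;
  res_id : forall (U : opens Y) (sUU : U `<=` U) v, res sUU v = v;
  res_comp : forall (U W T : opens Y) (sUW : U `<=` W) (sWT : W `<=` T) (sUT : U `<=` T) v,
    res sUW (res sWT v) = res sUT v;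
  sheaf_sep : forall (U : opens Y) (I : Type) (C : I -> opens Y) (sCU : forall i, C i `<=` U),
    U `<=` \bigcup_i C i ->
    forall u v, (forall i, res (sCU i) u = res (sCU i) v) -> u = v;
  sheaf_glue : forall (U : opens Y) (I : Type) (C : I -> opens Y) (sCU : forall i, C i `<=` U),
    U `<=` \bigcup_i C i ->
    forall v : forall i, sec (C i),
    (forall i j (W : opens Y) (si : W `<=` C i) (sj : W `<=` C j),
      res si (v i) = res sj (v j)) ->
    exists u, forall i, res (sCU i) u = v i
}.

Definition locally_free (V : module_sheaf) : Prop :=
  forall y : Y, exists (U : opens Y) (r : nat) (e : 'I_r -> V U),
    open_set U y /\
    forall (W : opens Y) (sWU : W `<=` U) (v : V W),
      exists! c : 'I_r -> structure_sheaf W,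
        v = \sum_(i < r) c i *: res sWU (e i).

Record vector_bundle := VectorBundle {
  vb_sheaf :> module_sheaf;
  vb_free : locally_free vb_sheaf
}.

End Modules.

Record category := Category {
  obj :> Type;
  hom : obj -> obj -> Type;
  idc : forall x, hom x x;
  comp : forall x y z, hom y z -> hom x y -> hom x z;
  comp_idl : forall x y (f : hom x y), comp (idc y) f = f;
  comp_idr : forall x y (f : hom x y), comp f (idc x) = f;
  compA : forall w x y z (f : hom y z) (g : hom x y) (h : hom w x),
    comp f (comp g h) = comp (comp f g) h
}.

Record functor (C D : category) := Functor {
  fobj :> C -> D;
  fmap : forall x y, hom x y -> hom (fobj x) (fobj y);
  fmap_id : forall x, fmap (idc x) = idc (fobj x);
  fmap_comp : forall x y z (f : hom y z) (g : hom x y),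
    fmap (comp f g) = comp (fmap f) (fmap g)
}.

Definition functor_id (C : category) : functor C C :=
  @Functor C C id (fun _ _ f => f) (fun _ => erefl) (fun _ _ _ _ _ => erefl).

Section FunctorComp.
Variables (C D E : category) (F : functor D E) (G : functor C D).

Fact functor_comp_id x : fmap F (fmap G (idc x)) = idc (F (G x)).
Proof. by rewrite !fmap_id. Qed.

Fact functor_comp_comp x y z (f : hom y z) (g : hom x y) :
  fmap F (fmap G (comp f g)) = comp (fmap F (fmap G f)) (fmap F (fmap G g)).
Proof. by rewrite !fmap_comp. Qed.

Definition functor_comp : functor C E :=
  @Functor C E (F \o G) (fun x y f => fmap F (fmap G f))
    functor_comp_id functor_comp_comp.

End FunctorComp.

Definition nat_iso (C D : category) (F G : functor C D) : Prop :=
  exists (u : forall x, hom (F x) (G x)) (v : forall x, hom (G x) (F x)),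
    [/\ forall x, comp (v x) (u x) = idc (F x),
        forall x, comp (u x) (v x) = idc (G x) &
        forall x y (f : hom x y), comp (u y) (fmap F f) = comp (fmap G f) (u x)].

Definition equivalent (C D : category) : Prop :=
  exists (F : functor C D) (G : functor D C),
    nat_iso (functor_comp G F) (functor_id C) /\
    nat_iso (functor_comp F G) (functor_id D).

Section Equivariant.
Variables (k : fieldType) (G : finGroupType) (Y : fspace k) (a : group_action G Y).

Fact translate_open g (U : opens Y) : open (a g^-1%g @^-1` U).
Proof.
by apply: open_comp (open_setP U) => y _; exact: mor_cts.
Qed.

(* The open set g(U), written as the preimage of U under the inverse of g. *)
Definition translate (g : G) (U : opens Y) : opens Y := Opens (translate_open g U).

Fact translate_sub g (U : opens Y) : U `<=` a g @^-1` translate g U.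
Proof. by move=> y Uy; rewrite /= -actM mulVg act1. Qed.

Fact translateS g (U W : opens Y) : U `<=` W -> translate g U `<=` translate g W.
Proof. by move=> sUW y; exact: sUW. Qed.

Fact translateM g h (U : opens Y) :
  translate g (translate h U) `<=` translate (g * h)%g U.
Proof. by move=> y; rewrite /= invMg actM. Qed.

(* Composition with g, from functions on g(U) to functions on U. *)
Definition translate_fun g (U : opens Y) :
    structure_sheaf (translate g U) -> structure_sheaf U :=
  pullback (restr (@translate_sub g U)).

(* Since G is finite and discrete, an isomorphism between the two pullbacks of
   V to G x Y is a family of isomorphisms lambda_g from g^*V to V; as g is an
   automorphism of Y, the sheaf g^*V is U |-> V(g(U)), a module over functions
   on U through translate_fun. *)
Record equivariant_bundle := EquivariantBundle {
  eb_bundle :> vector_bundle Y;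
  lam : forall g (U : opens Y), eb_bundle (translate g U) -> eb_bundle U;
  lamD : forall g U u v, @lam g U (u + v) = @lam g U u + @lam g U v;
  lamZ : forall g U (s : structure_sheaf (translate g U)) v,
    @lam g U (s *: v) = translate_fun s *: @lam g U v;
  lam_res : forall g (U W : opens Y) (sUW : U `<=` W) v,
    @lam g U (res (translateS (g := g) sUW) v) = res sUW (@lam g W v);
  lam_bij : forall g U, bijective (@lam g U);
  lamM : forall g h U (v : eb_bundle (translate (g * h)%g U)),
    @lam (g * h)%g U v =
    @lam h U (@lam g (translate h U) (res (@translateM g h U) v))
}.

Section Homs.
Variables V W : equivariant_bundle.

Record equivariant_hom := EquivariantHom {
  eh_fun :> forall U : opens Y, V U -> W U;
  ehD : forall U u v, @eh_fun U (u + v) = @eh_fun U u + @eh_fun U v;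
  ehZ : forall U (s : structure_sheaf U) v, @eh_fun U (s *: v) = s *: @eh_fun U v;
  eh_res : forall (U T : opens Y) (sUT : U `<=` T) v,
    @eh_fun U (res sUT v) = res sUT (@eh_fun T v);
  eh_lam : forall g U v, @eh_fun U (@lam V g U v) = @lam W g U (@eh_fun _ v)
}.

Lemma equivariant_hom_ext (f g : equivariant_hom) :
  (forall U v, f U v = g U v) -> f = g.
Proof.
case: f g => f f1 f2 f3 f4 [g g1 g2 g3 g4] /= fg.
have e : f = g by apply: functional_extensionality_dep => U; exact/funext/fg.
by case: _ / e g1 g2 g3 g4 => *; congr EquivariantHom; exact: Prop_irrelevance.
Qed.

End Homs.

Definition equivariant_id (V : equivariant_bundle) : equivariant_hom V V.
Proof. by exists (fun U => id). Defined.

Definition equivariant_comp (V1 V2 V3 : equivariant_bundle)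
  (f : equivariant_hom V2 V3) (g : equivariant_hom V1 V2) : equivariant_hom V1 V3.
Proof.
exists (fun U => f U \o g U) => [U u v|U s v|U T sUT v|h U v] /=.
- by rewrite !ehD.
- by rewrite !ehZ.
- by rewrite !eh_res.
- by rewrite !eh_lam.
Defined.

Definition equivariant_bundles : category.
Proof.
by exists equivariant_bundle equivariant_hom equivariant_id equivariant_comp;
  move=> *; exact: equivariant_hom_ext.
Defined.

End Equivariant.

(* Main.v *)
(* Let T be the tensor product of k(Y1) and k(Y2) over k(X), with the actions of
   G1 and G2. If y1 and y2 lie over x, then P(x) is isomorphic to the completed local
   field at each of them, so k(Y1) embeds in the one at y2 over k(X). Interpolation and
   approximation then give an element of T, integral over O_{Y2,y2}, whose conjugates
   under G1 are distinct at every point above y2: the normalised fibre product of Y1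
   and Y2 is etale over both curves. It enters only through T, as dual families
   u_i, w_i of integral elements with sum_i u_i g(w_i) = 1 if g = 1 and 0 otherwise.

   To a G1-bundle V is attached the sheaf on Y2 of the G1-equivariant k(Y1)-linear
   maps from the generic stalk of V to T that are integral: the descent to Y2 of the
   dual of the pullback of V. The dual families show that it is a G2-bundle, generated
   by traces, and that the evaluation map from V to its double dual is an isomorphism.
   The same duality for the pair (Y2, Y2) turns this anti-equivalence into an
   equivalence. *)
Require Import Defs.
From HB Require Import structures.
From mathcomp Require Import fingroup perm all_boot all_algebra all_field.
From mathcomp Require Import ring_quotient fraction.
From mathcomp Require Import all_classical topology.
From mathcomp Require Import mpoly ring.
Set Implicit Arguments.
Unset Strict Implicit.
Unset Printing Implicit Defensive.
Import GRing.Theory.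
Local Open Scope classical_set_scope.
Local Open Scope ring_scope.
Local Open Scope quotient_scope.

(** * Noetherian rings *)

(** The fibre product of the two covers may be disconnected, and normalising it would require
    building a new curve. Forms with values in [T] avoid this: a section of the dual is one form
    subject to invariance and integrality, restriction leaves the form unchanged, and gluing reduces
    to comparing forms. A covariant pullback would instead need tensor products and quotients of
    sheaves. Ramification theory is avoided as well. Once an integral element has conjugates with
    distinct residues, the norm of each difference [b - g b] is a unit at the point, so the
    difference has an integral inverse; products of two-term families then give the dual families.
    Invariants, traces, descent and the universal property of [T] are all computed from the delta
    identity of such families. A rational function is a total function that matters only up to
    generic equality, so these functions do not form a field. Equations between them are therefore
    tested in [T] or in a completed local field, where generically equal functions have the same
    image. *)

Definition in_ideal (A : comNzRingType) (l : seq A) (a : A) : Prop :=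
  exists c : nat -> A, a = \sum_(i < size l) c i * l`_i.

(** Stated for arbitrary subsets, with generators taken inside the subset. This combines finite
    generation of ideals with the choice of generators among given elements, as used below for
    sequences of quotients and for equations of closed sets. *)
Definition noetherian (A : comNzRingType) : Prop :=
  forall S : set A, exists l : seq A,
    (forall a, a \in l -> S a) /\ forall a, S a -> in_ideal l a.

Section Ideals.
Variable A : comNzRingType.
Implicit Types (l m : seq A) (a b : A).

Lemma in_ideal0 l : in_ideal l 0.
Proof. by exists (fun=> 0); rewrite big1 // => i _; rewrite mul0r. Qed.

Lemma in_idealD l a b : in_ideal l a -> in_ideal l b -> in_ideal l (a + b).
Proof.
move=> [c ->] [d ->]; exists (fun i => c i + d i); rewrite -big_split /=.
by apply: eq_bigr => i _; rewrite mulrDl.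
Qed.

Lemma in_idealM l a b : in_ideal l b -> in_ideal l (a * b).
Proof.
move=> [c ->]; exists (fun i => a * c i); rewrite mulr_sumr.
by apply: eq_bigr => i _; rewrite mulrA.
Qed.

Lemma in_ideal_mem l a : a \in l -> in_ideal l a.
Proof.
move=> al; exists (fun i => (i == index a l)%:R).
have il : (index a l < size l)%N by rewrite index_mem.
rewrite (bigD1 (Ordinal il)) //= eqxx mul1r nth_index // big1 ?addr0 // => i.
by rewrite -val_eqE /= => /negPf ->; rewrite mul0r.
Qed.

Lemma in_ideal_ind (P : A -> Prop) l : P 0 -> (forall a b, P a -> P b -> P (a + b)) ->
  (forall a b, b \in l -> P (a * b)) -> forall a, in_ideal l a -> P a.
Proof.
move=> P0 PD Pl _ [c ->]; elim/big_ind: _ => // i _.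
by apply: Pl; exact: mem_nth.
Qed.

Lemma in_ideal_sub l m a : (forall b, b \in l -> in_ideal m b) ->
  in_ideal l a -> in_ideal m a.
Proof.
move=> lm; apply: in_ideal_ind; [exact: in_ideal0|exact: in_idealD|].
by move=> b c cl; apply/in_idealM/lm.
Qed.

End Ideals.

(** Generators are found for the numerators of the elements of [S]. The denominator of the element
    to be expressed is inverted by [w], while those of the generators are absorbed into the
    coefficients. *)
Lemma noetherian_localization (A B : comNzRingType) (phi : {rmorphism A -> B}) :
  (forall b, exists a s w, phi s * w = 1 /\ b * phi s = phi a) ->
  noetherian A -> noetherian B.
Proof.
move=> loc nA S.
pose Q a b s := S b /\ b * phi s = phi a.
have [l [lS hl]] := nA [set a | exists b s, Q a b s].
pose num a := if pselect (exists b s, Q a b s) is left e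
  then (sval (cid e), sval (cid (svalP (cid e)))) else (0, 0).
have numP a : a \in l -> Q a (num a).1 (num a).2.
  move=> /lS al; rewrite /num; case: pselect => // e /=.
  exact: (svalP (cid (svalP (cid e)))).
exists (map (fun a => (num a).1) l); split=> [_ /mapP[a al ->]|b Sb].
  by have [] := numP a al.
have [a [s [w [sw bs]]]] := loc b.
have [|c cE] := hl a; first by exists b, s.
exists (fun i => w * phi (c i) * phi (num l`_i).2).
rewrite -[LHS]mulr1 -sw mulrA bs cE rmorph_sum size_map mulr_suml.
apply: eq_bigr => i _; rewrite (nth_map 0) // rmorphM.
have [_ <-] := numP l`_i (mem_nth _ (ltn_ord i)); ring.
Qed.

Lemma noetherian_surj (A B : comNzRingType) (phi : {rmorphism A -> B}) :
  (forall b, exists a, phi a = b) -> noetherian A -> noetherian B.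
Proof.
move=> surj; apply: (noetherian_localization (phi := phi)) => b.
by have [a <-] := surj b; exists a, 1, 1; rewrite rmorph1 !mulr1.
Qed.

Lemma noetherian_field (k : fieldType) : noetherian k.
Proof.
move=> S; have [[a [Sa a0]]|nS] := pselect (exists a, S a /\ a != 0).
  exists [:: a]; split=> [b /[!inE]/eqP ->//|b _].
  by exists (fun=> b / a); rewrite big_ord1 /= divfK.
exists [::]; split=> // a Sa; suff -> : a = 0 by exact: in_ideal0.
by apply: contrapT => /eqP a0; apply: nS; exists a.
Qed.

(* Hilbert's argument: were there no finite generating set, successive choices
   of minimal degree would have leading coefficients contradicting the
   finiteness condition in A. *)
Lemma noetherian_poly (A : comNzRingType) : noetherian A -> noetherian {poly A}.
Proof.
move=> nA S.
pose I p := exists2 l : seq {poly A}, (forall a, a \in l -> S a) & in_ideal l p.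
have addI p q : I p -> I q -> I (p + q).
  move=> [l lS lp] [m mS mq]; exists (l ++ m).
    by move=> a; rewrite mem_cat => /orP[/lS|/mS].
  by apply: in_idealD; [apply: in_ideal_sub lp|apply: in_ideal_sub mq] => b bl;
    apply: in_ideal_mem; rewrite mem_cat bl ?orbT.
have mulI p q : I q -> I (p * q) by move=> [l lS lq]; exists l => //; exact: in_idealM.
have zeroI : I 0 by exists [::] => //; exact: in_ideal0.
(* It suffices to treat the ideal [I] generated by [S]: each of its finitely many generators is a
   combination of finitely many elements of [S]. *)
suff [l [lI hl]] : exists l : seq {poly A}, (forall a, a \in l -> I a) /\
    forall a, I a -> in_ideal l a.
  have [m mS lm] : exists2 m : seq {poly A}, (forall a, a \in m -> S a) &
      forall b, b \in l -> in_ideal m b.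
    elim: l lI {hl} => [_|b l IHl lI]; first by exists [::].
    have [|m mS lm] := IHl; first by move=> a al; apply: lI; rewrite inE al orbT.
    have [|m' mS' bm'] := lI b; first by rewrite inE eqxx.
    exists (m ++ m'); first by move=> a; rewrite mem_cat => /orP[/mS|/mS'].
    move=> c /[!inE]/orP[/eqP ->|/lm cm];
      by [apply: in_ideal_sub bm' => d dm; apply: in_ideal_mem; rewrite mem_cat dm orbT
         |apply: in_ideal_sub cm => d dm; apply: in_ideal_mem; rewrite mem_cat dm].
  exists m; split=> // a Sa; apply: in_ideal_sub lm _; apply: hl.
  by exists [:: a]; [move=> b /[!inE]/eqP ->|apply: in_ideal_mem; rewrite inE].
apply: contrapT => noI.
have next l : exists p, (forall a, a \in l -> I a) ->
    [/\ I p, ~ in_ideal l p & forall q, I q -> ~ in_ideal l q -> (size p <= size q)%N].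
  have [lI|nlI] := pselect (forall a, a \in l -> I a); last by exists 0.
  have [p Ip np] : exists2 p, I p & ~ in_ideal l p.
    apply: contrapT => h; apply: noI; exists l; split=> // a Ia.
    by apply: contrapT => na; apply: h; exists a.
  pose Q n := `[< exists p, [/\ I p, ~ in_ideal l p & size p = n] >].
  have [|n /asboolP[q [Iq nq <-]] qmin] := @ex_minnP Q.
    by exists (size p); apply/asboolP; exists p.
  exists q => _; split=> // r Ir nr; apply: qmin; apply/asboolP; by exists r.
pose nx l := sval (cid (next l)).
have nxP l : (forall a, a \in l -> I a) -> [/\ I (nx l), ~ in_ideal l (nx l) &
    forall q, I q -> ~ in_ideal l q -> (size (nx l) <= size q)%N].
  exact: (svalP (cid (next l))).
pose fix L n := if n is n'.+1 then rcons (L n') (nx (L n')) else [::].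
have LI n : forall a, a \in L n -> I a.
  elim: n => // n IHn a /=; rewrite mem_rcons inE => /orP[/eqP ->|]; last exact: IHn.
  by have [] := nxP _ IHn.
pose f n := nx (L n).
have fL m n : (m < n)%N -> f m \in L n.
  elim: n => // n IHn; rewrite ltnS leq_eqVlt mem_rcons inE => /orP[/eqP ->|/IHn ->].
    by rewrite eqxx.
  by rewrite orbT.
have fI n : I (f n) by have [] := nxP _ (LI n).
have fN n : ~ in_ideal (L n) (f n) by have [] := nxP _ (LI n).
have LS m n : (m <= n)%N -> forall p, in_ideal (L m) p -> in_ideal (L n) p.
  move=> mn p; apply: in_ideal_sub => b bL; apply: in_ideal_mem.
  elim: n mn => [|n IHn]; first by rewrite leqn0 => /eqP <-.
  rewrite leq_eqVlt => /orP[/eqP <- //|]; rewrite ltnS => /IHn h.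
  by rewrite /= mem_rcons inE h orbT.
have fS m n : (m <= n)%N -> (size (f m) <= size (f n))%N.
  move=> mn; have [_ _] := nxP _ (LI m); apply=> // h; exact: fN (LS _ _ mn _ h).
have [l [lS hl]] := nA [set a | exists n, a = lead_coef (f n)].
have [N lN] : exists N, forall a, a \in l -> exists2 n, (n < N)%N & a = lead_coef (f n).
  elim: l lS {hl} => [_|b l IHl lS]; first by exists 0%N.
  have [|N hN] := IHl; first by move=> a al; apply: lS; rewrite inE al orbT.
  have [|n bn] := lS b; first by rewrite inE eqxx.
  exists (maxn N n.+1) => a /[!inE]/orP[/eqP ->|/hN[m mN ->]].
    by exists n; rewrite ?leq_max ?ltnSn ?orbT.
  by exists m; rewrite // leq_max mN.
have [|c cE] := hl (lead_coef (f N)); first by exists N.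
pose d (i : 'I_(size l)) := if pselect (exists2 n, (n < N)%N & l`_i = lead_coef (f n)) is left e
  then sval (cid2 e) else 0%N.
have dP i : (d i < N)%N /\ l`_i = lead_coef (f (d i)).
  rewrite /d; case: pselect => [e|[]]; first by case: cid2.
  by apply: lN; exact: mem_nth.
have fN0 : f N != 0.
  apply/eqP => h; apply: (fN N); rewrite h; exact: in_ideal0.
have fd0 i : (0 < size (f (d i)))%N.
  rewrite size_poly_gt0; apply/eqP => h; apply: (fN (d i)); rewrite h; exact: in_ideal0.
(* The leading coefficient of [f N] is a combination of earlier ones. Shifting the earlier
   polynomials to the degree of [f N] gives [g] in the ideal of [L N], and [f N - g] contradicts the
   minimality of the degree of [f N]. *)
pose g : {poly A} := \sum_(i < size l) (c i)%:P * 'X^(size (f N) - size (f (d i))) * f (d i).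
have gL : in_ideal (L N) g.
  rewrite /g; elim/big_ind: _ => [||i _]; [exact: in_ideal0|exact: in_idealD|].
  by apply/in_idealM/in_ideal_mem/fL; case: (dP i).
have gsize : (size g <= size (f N))%N.
  apply: leq_trans (size_sum _ _ _) _; apply/bigmax_leqP => i _.
  rewrite -mulrA mul_polyC; apply: leq_trans (size_scale_leq _ _) _.
  apply: leq_trans (size_polyMleq _ _) _; rewrite size_polyXn addSn /= subnK //.
  by apply: fS; apply: ltnW; case: (dP i).
have gcoef : g`_(size (f N)).-1 = lead_coef (f N).
  rewrite cE coef_sum; apply: eq_bigr => i _.
  have [dN ->] := dP i; rewrite -mulrA coefCM coefXnM lead_coefE.
  have le := fS _ _ (ltnW dN).
  have := fd0 i; case: (size (f (d i))) le => // s le _ /=.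
  case: (size (f N)) le => // s' le /=; rewrite subSS.
  by rewrite ltnNge leq_subr /= subKn.
have [_ _] := nxP _ (LI N) => /(_ (f N - g)).
have nfg : ~ in_ideal (L N) (f N - g).
  by move=> h; apply: (fN N); rewrite -[f N](subrK g); exact: in_idealD.
have Ig : I (f N - g).
  apply: (addI); first exact: fI.
  rewrite -mulN1r; apply: (mulI); rewrite /g.
  by apply: (@big_rec _ I) => // i p _ Ip; apply: (addI) => //; exact/mulI/fI.
move=> /(_ Ig nfg); rewrite leqNgt -/(f N) => /negP; apply.
have sN : (0 < size (f N))%N by rewrite size_poly_gt0.
rewrite -(prednK sN) ltnS; apply/leq_sizeP => j.
rewrite leq_eqVlt => /orP[/eqP <-|jN].
  by rewrite coefB gcoef lead_coefE subrr.
have jN' : (size (f N) <= j)%N by rewrite -(prednK sN).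
rewrite coefB !nth_default ?subrr //; exact: leq_trans jN'.
Qed.

Lemma noetherian_mpoly (k : fieldType) n : noetherian {mpoly k[n]}.
Proof.
elim: n => [|n IHn].
  apply: (@noetherian_surj _ _ (mpolyC 0 (R := k))); last exact: noetherian_field.
  move=> p; exists (p@_0%MM); apply/mpolyP => m.
  by rewrite mcoeffC (_ : m = 0%MM) ?eqxx ?mulr1 //; apply/mnmP => -[].
pose phi : {rmorphism {poly {mpoly k[n]}} -> {mpoly k[n.+1]}} :=
  horner_eval ('X_ord_max : {mpoly k[n.+1]}) \o map_poly (@mwiden n k).
apply: (@noetherian_surj _ _ phi); last exact: noetherian_poly.
have phiC c : exists a, phi a = c%:MP.
  exists (c%:MP)%:P; rewrite /phi /= /horner_eval map_polyC hornerC; exact: mwidenC.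
have phiX i : exists a, phi a = 'X_i.
  have [j ->|->] := unliftP ord_max i; last first.
    by exists 'X; rewrite /phi /= /horner_eval map_polyX hornerX.
  exists ('X_j)%:P; rewrite /phi /= /horner_eval map_polyC hornerC /= mwidenX.
  by rewrite mnmwiden1; congr 'X_(_); apply: val_inj; rewrite /= /bump leqNgt ltn_ord.
move=> p; elim/mpolyind: p => [|c m p _ _ [a <-]]; first by exists 0; rewrite rmorph0.
have [b bE] : exists b, phi b = 'X_[m].
  rewrite mpolyXE_id; elim/big_ind: _ => [|_ _ [u <-] [v <-]|i _].
  - by exists 1; rewrite rmorph1.
  - by exists (u * v); rewrite rmorphM.
  - by have [u <-] := phiX i; exists (u ^+ m i); rewrite rmorphXn.
have [d dE] := phiC c.
by exists (d * b + a); rewrite rmorphD rmorphM bE dE mul_mpolyC.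
Qed.

(** * Discrete valuation rings and their completions *)

Section Uniformizer.
Variables (A : comNzRingType) (t : A).
Hypotheses (nt : nonunit t) (t_nil : forall n, t ^+ n != 0).
Hypothesis tP : forall a : A, nonunit a -> exists b, a = t * b.

Lemma nonunitP (a : A) : nonunit a <-> exists b, a = t * b.
Proof.
split=> [/tP//|[b ->] [c bc]]; apply: nt; exists (b * c); by rewrite mulrA.
Qed.

Lemma unit_sub1 (a : A) : exists v, (1 - t * a) * v = 1.
Proof.
apply: contrapT => /tP[b e]; apply: nt; exists (a + b).
by rewrite mulrDr -e addrC subrK.
Qed.

Lemma max_powE n a : max_pow n a <-> exists b, a = t ^+ n * b.
Proof.
elim: n a => [|n IHn] a /=; first by split=> // _; exists a; rewrite expr0 mul1r.
split=> [[r [b [c [nb mc ->]]]]|[b ->]].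
  have db i := cid (tP (nb i)); have /= dc i := cid ((IHn _).1 (mc i)).
  exists (\sum_(i < r) sval (db i) * sval (dc i)); rewrite mulr_sumr.
  apply: eq_bigr => i _; rewrite exprS mulrACA.
  by rewrite -(svalP (db i)) -(svalP (dc i)).
exists 1%N, (fun=> t), (fun=> t ^+ n * b); split=> // [_|].
  by apply/IHn; exists b.
by rewrite big_ord1 exprS mulrA.
Qed.

Hypothesis nA : noetherian A.

(** An element without such a factorisation is divisible by [t] with a quotient of the same kind, so
    the division never stops. Noetherianity applied to the successive quotients yields
    [s N = t * d * s N], which forces [s N = 0]. *)
Lemma dvr_factor (a : A) : a != 0 -> exists n u v, a = t ^+ n * u /\ u * v = 1.
Proof.
move=> a0; apply: contrapT => Pa.
pose P a := ~ exists n u v, a = t ^+ n * u /\ u * v = 1.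
have next (b : {b | P b}) : exists c : {b | P b}, sval b = t * sval c.
  case: b => b Pb /=; have [|c bc] := tP (a := b).
    by move=> [v bv]; apply: Pb; exists 0%N, b, v; rewrite expr0 mul1r.
  suff Pc : P c by exists (exist _ c Pc).
  move=> [n [u [v [cu uv]]]]; apply: Pb; exists n.+1, u, v; split=> //.
  by rewrite bc cu exprS mulrA.
pose nx b := sval (cid (next b)).
have nxP b : sval b = t * sval (nx b) by exact: (svalP (cid (next b))).
pose s n := sval (iter n nx (exist _ a Pa)).
have sE m n : (m <= n)%N -> s m = t ^+ (n - m) * s n.
  elim: n => [|n IHn]; first by rewrite leqn0 => /eqP ->; rewrite expr0 mul1r.
  rewrite leq_eqVlt => /orP[/eqP ->|]; first by rewrite subnn expr0 mul1r.
  rewrite ltnS => mn; rewrite IHn // subSn // exprSr -mulrA; congr (_ * _).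
  exact: nxP.
have [l [lS hl]] := nA (range s).
have [N lN] : exists N, forall a, a \in l -> exists2 n, (n < N)%N & a = s n.
  elim: l lS {hl} => [_|b l IHl lS]; first by exists 0%N.
  have [|N hN] := IHl; first by move=> c cl; apply: (lS c); rewrite inE cl orbT.
  have [|n _ bn] := lS b; first by rewrite inE eqxx.
  exists (maxn N n.+1) => c /[!inE]/orP[/eqP ->|/hN[m mN ->]].
    by exists n; rewrite ?leq_max ?ltnSn ?orbT.
  by exists m; rewrite // leq_max mN.
have [d dE] : exists d, s N = t * d * s N.
  apply: (in_ideal_ind (P := fun b => exists d, b = t * d * s N)) (hl _ _); last 1 first.
  - by exists N.
  - by exists 0; rewrite mulr0 mul0r.
  - by move=> _ _ [d ->] [d' ->]; exists (d + d'); rewrite mulrDr mulrDl.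
  move=> c b /lN[n nN ->]; exists (c * t ^+ (N - n).-1).
  by rewrite (sE n N (ltnW nN)) -{1}(prednK (_ : 0 < N - n)%N) ?subn_gt0 // exprS; ring.
have [v tv] := unit_sub1 d.
have sN0 : s N = 0.
  have : (1 - t * d) * s N = 0 by rewrite mulrBl mul1r -dE subrr.
  by move=> /(congr1 ( *%R v)); rewrite mulr0 mulrA [v * _]mulrC tv mul1r.
have : s 0%N = 0 by rewrite (sE 0%N N) // sN0 mulr0.
by move/eqP; rewrite (negPf a0 : (s 0%N == 0) = false).
Qed.

Lemma dvr_domain (a b : A) : a * b = 0 -> a = 0 \/ b = 0.
Proof.
move=> ab; have [->|/eqP/dvr_factor[n [u [v [aE uv]]]]] := pselect (a = 0); first by left.
have [->|/eqP/dvr_factor[m [u' [v' [bE uv']]]]] := pselect (b = 0); first by right.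
case/eqP: (t_nil (n + m)).
have : t ^+ (n + m) * (u * v) * (u' * v') = a * b * (v * v') by rewrite aE bE exprD; ring.
by rewrite uv uv' ab mul0r !mulr1.
Qed.

Lemma dvr_cancel (a b c : A) : a != 0 -> a * b = a * c -> b = c.
Proof.
move=> a0 e; have /dvr_domain[a0'|] : a * (b - c) = 0 by rewrite mulrBr e subrr.
  by rewrite a0' eqxx in a0.
by move/eqP; rewrite subr_eq0 => /eqP.
Qed.

Lemma dvr_separated (a : A) : (forall n, exists b, a = t ^+ n * b) -> a = 0.
Proof.
move=> ha; apply: contrapT => /eqP/dvr_factor[n [u [v [aE uv]]]].
have [b] := ha n.+1; rewrite aE exprSr -mulrA => /(dvr_cancel (t_nil n)) ub.
by apply: nt; exists (b * v); rewrite mulrA -ub.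
Qed.

Variable hA : regular_local_dim1 A.

Lemma limseq_eqP (s s' : coherent_seq A) :
  limseq hA s = limseq hA s' <-> forall n, max_pow n (s n - s' n).
Proof.
split=> [/eqP|h].
  by rewrite -Quotient.idealrBE => /asboolP.
by apply/eqP; rewrite -Quotient.idealrBE; apply/asboolP.
Qed.

Lemma limseq_repr (p : completion hA) : limseq hA (repr p) = p.
Proof. exact: reprK. Qed.

Lemma limseqM s s' : limseq hA (s * s') = limseq hA s * limseq hA s'.
Proof. exact: (rmorphM \pi_(completion hA)). Qed.

Lemma limseqB s s' : limseq hA (s - s') = limseq hA s - limseq hA s'.
Proof. exact: (rmorphB \pi_(completion hA)). Qed.

Lemma limseqD s s' : limseq hA (s + s') = limseq hA s + limseq hA s'.
Proof. exact: (rmorphD \pi_(completion hA)). Qed.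

Lemma limseq1 : limseq hA 1 = 1.
Proof. exact: (rmorph1 \pi_(completion hA)). Qed.

End Uniformizer.

Section ToCompletion.
Variables (A : comNzRingType) (hA : regular_local_dim1 A).

Fact const_coherent (a : A) : (fun=> a) \in @coherent A.
Proof. by apply/asboolP => n; rewrite subrr; exact: max_pow0. Qed.
Definition to_completion (a : A) : completion hA :=
  limseq hA (CoherentSeq (const_coherent a)).

Fact to_completion_zmod : zmod_morphism to_completion.
Proof. by move=> a b; rewrite -limseqB; congr limseq; exact: val_inj. Qed.
Fact to_completion_monoid : monoid_morphism to_completion.
Proof.
split=> [|a b]; first by rewrite -limseq1; congr limseq; exact: val_inj.
by rewrite -limseqM; congr limseq; exact: val_inj.
Qed.
HB.instance Definition _ := GRing.isZmodMorphism.Build _ _ to_completion to_completion_zmod.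
HB.instance Definition _ := GRing.isMonoidMorphism.Build _ _ to_completion to_completion_monoid.

End ToCompletion.

Lemma completion_mapE (A B : comNzRingType) (hA : regular_local_dim1 A)
    (hB : regular_local_dim1 B) (phi : {rmorphism A -> B})
    (loc : forall a, nonunit a -> nonunit (phi a)) a :
  completion_map hA hB loc (to_completion hA a) = to_completion hB (phi a).
Proof.
apply/limseq_eqP => n /=.
have /limseq_eqP/(_ n) := limseq_repr (to_completion hA a).
by rewrite -rmorphB; exact: max_pow_morph.
Qed.

Lemma frac_div (R : idomainType) (z : {fraction R}) :
  exists p q, q != 0 /\ z = FracField.tofrac p / FracField.tofrac q.
Proof.
elim/quotW: z => x; exists (frac x).1, (frac x).2; have d0 := denom_ratioP x.
split=> //; apply: (canRL (mulfK _)); first by rewrite tofrac_eq0.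
unlock FracField.tofrac; rewrite -[LHS]FracField.pi_mul.
apply/eqmodP; rewrite /= FracField.equivfE.
by rewrite !numden_Ratio ?(oner_eq0, mulf_neq0) // !mulr1 mulrC.
Qed.

Lemma div_sub_div (F : fieldType) (p q a b c : F) : q != 0 -> b != 0 ->
  p * b - a * q = c * (q * b) -> p / q - a / b = c.
Proof.
move=> q0 b0 e; apply: (mulIf (mulf_neq0 q0 b0)); rewrite -e.
field; by rewrite ?q0 ?b0.
Qed.

Lemma frac_sub (R : idomainType) (p q a b c : R) : q != 0 -> b != 0 ->
  p * b - a * q = c * (q * b) ->
  FracField.tofrac p / FracField.tofrac q - FracField.tofrac a / FracField.tofrac b =
    FracField.tofrac c.
Proof.
move=> q0 b0 e; apply: div_sub_div; [by rewrite tofrac_eq0..|].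
by rewrite -!rmorphM -rmorphB e.
Qed.

(** * Approximation in the completion and in its fraction field *)

Section CompletionTheory.
Variables (A : comNzRingType) (hA : regular_local_dim1 A) (t : A).
Hypotheses (nt : nonunit t) (t_nil : forall n, t ^+ n != 0).
Hypothesis tP : forall a : A, nonunit a -> exists b, a = t * b.
Hypothesis nA : noetherian A.
Local Notation "a ^~" := (to_completion hA a) (at level 2, format "a ^~").

Lemma to_completion_inj a : a^~ = 0 -> a = 0.
Proof.
move=> a0; apply: (dvr_separated nt t_nil tP nA) => n.
apply/(max_powE nt tP); have : a^~ = 0^~ by rewrite rmorph0.
by move=> /limseq_eqP/(_ n); rewrite /= subr0.
Qed.

Lemma coherent_le (s : coherent_seq A) m n : (m <= n)%N -> max_pow m (s n - s m).
Proof.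
have /asboolP hs := valP s; elim: n => [|n IHn].
  by rewrite leqn0 => /eqP ->; rewrite subrr; exact: max_pow0.
rewrite leq_eqVlt => /predU1P[->|]; first by rewrite subrr; exact: max_pow0.
rewrite ltnS => mn; have -> : s n.+1 - s m = (s n.+1 - s n) - (s m - s n).
  by rewrite opprB addrA subrK.
apply: max_powB; last by rewrite -opprB -mulN1r; apply/max_powM/IHn.
have /(max_powE nt tP)[b ->] := hs n.
by apply/(max_powE nt tP); exists (t ^+ (n - m) * b); rewrite mulrA -exprD subnKC.
Qed.

(** The remainder is represented by the quotients of [s (n + N) - s N] by [t ^+ N]. The shift of the
    index makes up for the precision lost in the division, and coherence follows by cancelling
    [t ^+ N]. *)
Lemma completion_diff (p : completion hA) N :
  exists r, p = ((repr p : coherent_seq A) N)^~ + (t ^+ N)^~ * r.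
Proof.
set s := repr p; have div n : exists b, s (n + N)%N - s N = t ^+ N * b.
  by apply/(max_powE nt tP)/coherent_le; rewrite leq_addl.
pose q n := sval (cid (div n)).
have qE n : s (n + N)%N - s N = t ^+ N * q n by exact: (svalP (cid (div n))).
have qc : q \in @coherent A.
  apply/asboolP => n; apply/(max_powE nt tP).
  have /asboolP/(_ (n + N)%N)/(max_powE nt tP)[b bE] := valP s.
  exists b; apply: (dvr_cancel nt t_nil tP nA (t_nil N)).
  by rewrite mulrBr -!qE mulrA -exprD [(N + n)%N]addnC -bE addSn opprB addrA subrK.
exists (limseq hA (CoherentSeq qc)).
rewrite -[LHS]limseq_repr -/s -limseqM -limseqD; apply/limseq_eqP => n /=.
rewrite [X in max_pow _ (_ - X)](_ : _ = s (n + N)%N); last first.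
  by rewrite -[LHS]/(s N + t ^+ N * q n) -qE addrC subrK.
rewrite -opprB -mulN1r; apply/max_powM/coherent_le; exact: leq_addr.
Qed.

Lemma completion_approx (p : completion hA) N :
  exists a r, p = a^~ + (t ^+ N)^~ * r.
Proof. by have [r e] := completion_diff p N; exists ((repr p : coherent_seq A) N), r. Qed.

(** A representative can be chosen all of whose terms are units of [A], being a unit plus multiples
    of [t]; the termwise inverses are again coherent. *)
Lemma completion_unit (u v : A) r : u * v = 1 -> exists q, (u^~ + t^~ * r) * q = 1.
Proof.
move=> uv; set p := _ + _; have [s ps] : exists s : coherent_seq A, p = limseq hA s /\
    forall n, exists w, s n * w = 1.
  pose s := CoherentSeq (const_coherent u) +
    CoherentSeq (const_coherent t) * (repr r : coherent_seq A).
  exists s; split=> [|n]; first by rewrite /s limseqD limseqM limseq_repr.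
  have [w hw] := unit_sub1 nt tP (- v * (repr r : coherent_seq A) n).
  exists (v * w); rewrite -[s n]/(u + t * (repr r : coherent_seq A) n) -hw.
  rewrite mulrA; congr (_ * _); rewrite mulrDl uv; ring.
case: ps => ps su; pose w n := sval (cid (su n)).
have sw n : s n * w n = 1 by exact: (svalP (cid (su n))).
have wc : w \in @coherent A.
  apply/asboolP => n; have /asboolP/(_ n) h := valP s.
  have -> : w n.+1 - w n = - (w n.+1 * w n) * (s n.+1 - s n).
    have e : - (w n.+1 * w n) * (s n.+1 - s n) =
        w n.+1 * (s n * w n) - w n * (s n.+1 * w n.+1) by ring.
    by rewrite e !sw !mulr1.
  exact: max_powM.
exists (limseq hA (CoherentSeq wc)); rewrite ps -limseqM -limseq1.
apply/limseq_eqP => n.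
rewrite [X in max_pow _ (X - _)](_ : _ = s n * w n) // sw.
by rewrite [X in max_pow _ X](_ : _ = 0) ?subrr //; exact: max_pow0.
Qed.

Lemma completion_residue u r : u^~ = t^~ * r -> nonunit u.
Proof.
rewrite -(limseq_repr r) -limseqM => /limseq_eqP/(_ 1%N)/(max_powE nt tP)[b].
rewrite [X in _ - X](_ : _ = t * (repr r : coherent_seq A) 1%N) // expr1 => /eqP.
by rewrite subr_eq -mulrDr => /eqP /= ->; apply/(nonunitP nt tP); eexists.
Qed.

Lemma completion_factor q : q != 0 ->
  exists j u v r, u * v = 1 /\ q = (t ^+ j)^~ * (u^~ + t^~ * r).
Proof.
move=> q0; set s := repr q.
have [n sn] : exists n, ~ max_pow n (s n).
  apply: contrapT => h; case/eqP: q0; rewrite -[LHS]limseq_repr -[0](rmorph0 (to_completion hA)).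
  apply/limseq_eqP => n /=; rewrite subr0; apply: contrapT => hn; apply: h; by exists n.
have /(dvr_factor nt tP nA)[j [u [v [sE uv]]]] : s n != 0.
  by apply: contra_notN sn => /eqP ->; exact: max_pow0.
have jn : (j < n)%N.
  rewrite ltnNge; apply: contra_notN sn => nj; apply/(max_powE nt tP).
  by exists (t ^+ (j - n) * u); rewrite sE mulrA -exprD subnKC.
have div m : exists b, s (m + n)%N - s n = t ^+ n * b.
  by apply/(max_powE nt tP)/coherent_le; rewrite leq_addl.
have [r qE] := completion_diff q n.
exists j, u, v, ((t ^+ (n - j.+1))^~ * r); split=> //.
rewrite qE -/s sE rmorphM /= mulrDr; congr (_ + _).
by rewrite !mulrA -!rmorphM -exprSr -exprD subnKC.
Qed.

Fact frac_approx_num (R : comNzRingType) (a b m r1 r2 : R) :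
  (a + m * r2) * b - a * (b + m * r1) = m * (r2 * b - a * r1).
Proof. ring. Qed.

Fact frac_approx_den (R : comNzRingType) (x1 x2 w1 w2 m n d u : R) :
  m * (w1 * w2 * d * u) * (n * x1 * (n * x2)) =
  m * n * n * u * d * (x1 * w1) * (x2 * w2).
Proof. ring. Qed.

Lemma frac_approx (z : {fraction completion hA}) N :
  exists a b r, b != 0 /\ z - FracField.tofrac a^~ / FracField.tofrac b^~ = FracField.tofrac ((t ^+ N)^~ * r).
Proof.
have [p [q [q0 ->]]] := frac_div z.
have [j [u [v [r [uv qE]]]]] := completion_factor q0.
have [w1 w1E] := completion_unit r uv.
(* With [j] the valuation of the denominator [q], dividing by [q * b] costs [2 j]. The additional 1
   ensures that [b] agrees with [q] modulo [t ^+ j.+1] in all cases, so that [b] has valuation [j]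
   too. *)
have [a [r2 pE]] := completion_approx p (N + j + j.+1).
have [b [r1 qE']] := completion_approx q (N + j + j.+1).
have bE : b^~ = (t ^+ j)^~ * (u^~ + t^~ * (r - (t ^+ (N + j))^~ * r1)).
  apply: (addIr ((t ^+ (N + j + j.+1))^~ * r1)); rewrite -qE' qE.
  rewrite (exprD t (N + j) j.+1) exprS !rmorphM /=; ring.
have [w2 w2E] := completion_unit (r - (t ^+ (N + j))^~ * r1) uv.
have b0 : b^~ != 0.
  rewrite bE mulf_neq0 //; last first.
    by apply: contra_eq_neq w2E => ->; rewrite mul0r eq_sym oner_eq0.
  by apply/eqP => /to_completion_inj/eqP; exact/negP/t_nil.
have b0' : b != 0 by apply: contraNneq b0 => ->; rewrite rmorph0.
exists a, b, (w1 * w2 * (r2 * b^~ - a^~ * r1) * t^~); split=> //.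
apply: frac_sub => //.
transitivity ((t ^+ (N + j + j.+1))^~ * (r2 * b^~ - a^~ * r1)).
  by rewrite pE qE' frac_approx_num.
rewrite [in RHS]qE [X in _ = _ * (_ * X)]bE.
rewrite frac_approx_den w1E w2E !mulr1 -!rmorphM -!exprD -exprSr.
by rewrite addnS.
Qed.

End CompletionTheory.

(** * Curves in projective space *)

Section Coordinates.
Variables (k : fieldType) (X : fspace k) (n : nat) (i : X -> projective_space k n).

(* An identification of X with a locally closed subspace of projective space. *)
Record coordinates : Prop := Coordinates {
  coord_inj : injective i;
  coord_open : forall d F x, F \is d.-homog -> peval F (i x) != 0 ->
    \forall y \near x, peval F (i y) != 0;
  coord_nbhs : forall (x : X) U, nbhs x U -> exists d F,
    [/\ F \is d.-homog, peval F (i x) != 0 & forall y, peval F (i y) != 0 -> U y];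
  coord_regular : forall (x : X) f, regular_at x f <-> exists d F G,
    [/\ F \is d.-homog, G \is d.-homog &
      \forall y \near x, peval G (i y) != 0 /\ f y = peval F (i y) / peval G (i y)]
}.

End Coordinates.

Lemma isomorphic_coordinates (k : fieldType) (X : fspace k) n
    (Z : set (projective_fs k n)) : isomorphic X (subfs Z) ->
  exists2 i : X -> projective_space k n, coordinates i & range i = Z.
Proof.
move=> [f [g [fK gK]]]; exists (fun x => val (f x)); last first.
  apply/seteqP; split=> [_ [x _ <-]|p Zp]; first exact/set_mem/valP.
  by exists (g (exist _ p (mem_set Zp))) => //; rewrite gK.
have fnear (x : X) (P : set (projective_fs k n)) :
    (\forall p \near (val (f x) : projective_fs k n), P p) -> \forall y \near x, P (val (f y)).
  by move=> h; exact: (@mor_cts _ _ _ f x _ (val_near h)).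
split.
- by move=> x y /val_inj/(congr1 g); rewrite !fK.
- by move=> d F x hF Fx; exact: (fnear x (fun p => peval F p != 0) (peval_near hF Fx)).
- move=> x U xU; have : nbhs (f x) (g @^-1` U).
    have gU : nbhs (g (f x)) U by rewrite fK.
    exact: (@mor_cts _ _ _ g (f x) _ gU).
  case=> _ [[V oV <-] /= Vx VU].
  case: oV Vx VU => S hS -> [F SF Fx] VU; have [d hF] := hS _ SF.
  exists d, F; split=> // y Fy; rewrite -(fK y); apply: VU.
  by exists F.
- move=> x h; split.
    move=> rh; have : regular_at (f x) (h \o g) by apply: mor_reg; rewrite fK.
    move=> [h' [d [F [G [hF hG hFG]]]] e].
    exists d, F, G; split=> //; have h1 := fnear x _ hFG.
    have h2 : \forall y \near x, h (g (f y)) = h' (val (f y)) := @mor_cts _ _ _ f x _ e.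
    by apply: filterS2 h1 h2 => y [Gy hy] e2; split=> //; rewrite -hy -e2 fK.
  move=> [d [F [G [hF hG hFG]]]].
  have rq : regular_at (f x) (fun u : subfs Z => peval F (val u) / peval G (val u)).
    exists (fun p => peval F p / peval G p); last exact: (@nearW _ (nbhs (f x))).
    exists d, F, G; split=> //; have [Gx _] := nbhs_singleton hFG.
    by apply: filterS (peval_near hG Gx).
  apply: regular_eq (mor_reg rq); apply: filterS hFG => y [_ ->] //.
Qed.

(** Proportional vectors have the same zeros, hence the same first nonzero entry; this entry is 1 in
    both, so the factor is 1. *)
Lemma pcoord_eq (k : fieldType) n (p q : projective_space k n) (j : 'I_n.+1) :
  pcoord q 0 j != 0 ->
  (forall l, pcoord p 0 l * pcoord q 0 j = pcoord q 0 l * pcoord p 0 j) -> p = q.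
Proof.
move=> qj0 pq; have pj0 : pcoord p 0 j != 0.
  have /existsP[m /andP[/eqP pm _]] := valP p.
  apply: contraTneq qj0 => pj; have := pq m; rewrite [pcoord p 0 m]pm mul1r pj mulr0 => ->.
  by rewrite negbK.
apply: val_inj; apply/rowP => l /=.
have nz m : (pcoord p 0 m == 0) = (pcoord q 0 m == 0).
  by apply/idP/idP => /eqP e; have /eqP := pq m; rewrite e mul0r;
    rewrite ?[0 == _]eq_sym mulf_eq0 ?(negPf pj0) ?(negPf qj0) orbF.
have /existsP[m /andP[/eqP pm /forallP pm0]] := valP p.
have /existsP[m' /andP[/eqP qm /forallP qm0]] := valP q.
rewrite -/(pcoord p) -/(pcoord q) in pm pm0 qm qm0 *.
have mm : m = m'.
  apply: val_inj => /=; case: (ltngtP m m') => // lt.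
    by have := qm0 m; rewrite lt /= -nz pm oner_eq0.
  by have := pm0 m'; rewrite lt /= nz qm oner_eq0.
subst m'; have := pq m; rewrite pm qm !mul1r => e.
by have := pq l; rewrite e; apply: mulIf.
Qed.

Lemma dhomog_mevalM (k : fieldType) n d (F : {mpoly k[n]}) (c : k) (v : 'I_n -> k) :
  F \is d.-homog -> F.@[fun l => c * v l] = c ^+ d * F.@[v].
Proof.
move=> /dhomogP hF; rewrite !mevalE mulr_sumr; apply: eq_big_seq => m mF.
rewrite mulrCA; congr (_ * _).
have <- : mdeg m = d by exact: hF.
rewrite mdegE -prodrXr -big_split /=.
by apply: eq_bigr => l _; rewrite exprMn.
Qed.

Lemma dhomogXU (k : fieldType) n (j : 'I_n) : ('X_j : {mpoly k[n]}) \is 1.-homog.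
Proof. by rewrite dhomogX; apply/eqP; exact: mdeg1. Qed.

Lemma regular_prod (k : fieldType) (X : fspace k) (x : X) (I : Type) (r : seq I)
    (f : I -> X -> k) : (forall l, regular_at x (f l)) ->
  regular_at x (fun y => \prod_(l <- r) f l y).
Proof.
move=> rf; elim: r => [|l r IHr].
  by rewrite (_ : (fun y => _) = cst 1); [exact: regular_cst|apply/funext => y; rewrite big_nil].
rewrite (_ : (fun y => _) = f l * (fun y => \prod_(l <- r) f l y)); first exact: regularM.
by apply/funext => y; rewrite big_cons.
Qed.

Section Chart.
Variables (k : fieldType) (X : fspace k) (n : nat) (i : X -> projective_space k n).
Hypothesis hi : coordinates i.
Variable j : 'I_n.+1.

(** All [n + 1] ratios are kept, including the one equal to 1, so that homogeneous polynomials can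
    be evaluated without dehomogenising them. *)
Definition chart (y : X) (l : 'I_n.+1) : k := pcoord (i y) 0 l / pcoord (i y) 0 j.

Lemma coord_near (x : X) : pcoord (i x) 0 j != 0 ->
  \forall y \near x, pcoord (i y) 0 j != 0.
Proof.
move=> xj; have hX := dhomogXU k j.
have := coord_open hi hX (x := x); rewrite /peval mevalXU => /(_ xj).
by apply: filterS => y; rewrite mevalXU.
Qed.

Lemma chart_peval d F y : F \is d.-homog -> pcoord (i y) 0 j != 0 ->
  peval F (i y) = pcoord (i y) 0 j ^+ d * F.@[chart y].
Proof.
move=> hF yj; rewrite -dhomog_mevalM //; apply: meval_eq => l.
by rewrite /chart mulrC divfK.
Qed.

Lemma chart_regular P (x : X) : pcoord (i x) 0 j != 0 ->
  regular_at x (fun y => P.@[chart y]).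
Proof.
move=> xj; elim/mpolyind: P => [|c m P _ _ rP].
  by apply: regular_eq (regular_cst x 0); apply: nearW => y; rewrite /= meval0.
have rX l : regular_at x (fun y => chart y l).
  apply/(coord_regular hi); exists 1%N, 'X_l, 'X_j; split; [exact: dhomogXU|exact: dhomogXU|].
  by apply: filterS (coord_near xj) => y yj; rewrite /peval !mevalXU.
have rm : regular_at x (fun y => ('X_[m] : {mpoly k[n.+1]}).@[chart y]).
  have -> : (fun y => ('X_[m] : {mpoly k[n.+1]}).@[chart y]) =
      (fun y => \prod_l chart y l ^+ m l) by apply/funext => y; exact: mevalX.
  apply: regular_prod => l.
  pose h e := (fun y => chart y l ^+ e).
  have rh e : regular_at x (h e).
    elim: e => [|e IHe]; first exact: (regular_cst x 1).
    have -> : h e.+1 = (fun y => chart y l) * h e by apply/funext => y; exact: exprS.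
    exact: regularM.
  exact: rh.
have -> : (fun y => (c *: 'X_[m] + P).@[chart y]) =
    cst c * (fun y => ('X_[m] : {mpoly k[n.+1]}).@[chart y]) - (cst 0 - (fun y => P.@[chart y])).
  by apply/funext => y; rewrite mevalD mevalZ !fctE sub0r opprK.
apply: regularB; first by apply: regularM => //; exact: regular_cst.
by apply: regularB => //; exact: regular_cst.
Qed.

Lemma chart_fraction (x : X) f : pcoord (i x) 0 j != 0 -> regular_at x f ->
  exists P Q : {mpoly k[n.+1]}, Q.@[chart x] != 0 /\
    \forall y \near x, f y * Q.@[chart y] = P.@[chart y].
Proof.
move=> xj /(coord_regular hi)[d [F [G [hF hG e]]]]; exists F, G.
have [Gx _] := nbhs_singleton e; split.
  by apply: contraNneq Gx => Gx0; rewrite (chart_peval hG) // Gx0 mulr0.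
apply: filterS2 e (coord_near xj) => y [Gy ->] yj.
have G0 : G.@[chart y] != 0.
  by apply: contraNneq Gy => Gy0; rewrite (chart_peval hG) // Gy0 mulr0.
rewrite (chart_peval hF) // (chart_peval hG) //.
by field; rewrite G0 expf_neq0.
Qed.

End Chart.

Section StalkGerms.
Variables (k : fieldType) (X : fspace k) (x : X).

Lemma regular_stalk f : regular_at x f -> exists a : pregerm x, pregerm_fun a = f.
Proof. by move=> rf; exists (Pregerm (asboolT rf : f \in near_section x)). Qed.

Lemma pregerm_regular (a : pregerm x) : regular_at x a.
Proof. by have /asboolP := valP a. Qed.

Lemma germ0P (a : pregerm x) : germ a = 0 <-> \forall y \near x, a y = 0.
Proof. by rewrite -[0](rmorph0 \pi_(stalk x)); exact: germ_eqP. Qed.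

Lemma nonunit_stalkP (a : pregerm x) : nonunit (germ a) <-> a x = 0.
Proof.
split=> [na|ax0 [b]]; last first.
  rewrite -[b]germ_repr -germM -germ1 => /germ_eqP/nbhs_singleton.
  rewrite [LHS](_ : _ = a x * repr b x) // ax0 mul0r => /eqP.
  by rewrite eq_sym (_ : (1 : pregerm x) x = 1) // oner_eq0.
apply: contrapT => /eqP ax0; apply: na.
have [b bE] := regular_stalk (regularV ax0 (pregerm_regular a)).
exists (germ b); rewrite -germM -germ1; apply/germ_eqP.
apply: filterS (regular_neq0 ax0 (pregerm_regular a)) => y ay.
by rewrite [LHS](_ : _ = a y * b y) // bE mulfV.
Qed.

End StalkGerms.

(** By [chart_fraction] every germ is a fraction of polynomials in the chart coordinates, so the
    stalk is handled as a localisation of a polynomial ring. *)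
Lemma stalk_noetherian (k : fieldType) (X : fspace k) n (i : X -> projective_space k n)
  (hi : coordinates i) (x : X) : noetherian (stalk x).
Proof.
have [j xj] : exists j, pcoord (i x) 0 j != 0.
  by have /existsP[j /andP[/eqP e _]] := valP (i x); exists j; rewrite [pcoord _ _ _]e oner_eq0.
pose th (P : {mpoly k[n.+1]}) : pregerm x :=
  Pregerm (asboolT (chart_regular hi P xj) : (fun y => P.@[chart i j y]) \in near_section x).
have th_zmod : zmod_morphism (@germ _ _ x \o th).
  move=> P Q /=; rewrite -germB; congr germ; apply: val_inj; apply/funext => y /=.
  exact: mevalB.
have th_monoid : monoid_morphism (@germ _ _ x \o th).
  split=> [|P Q] /=.
    by rewrite -germ1; congr germ; apply: val_inj; apply/funext => y /=; exact: meval1.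
  by rewrite -germM; congr germ; apply: val_inj; apply/funext => y /=; exact: mevalM.
pose phi : {rmorphism {mpoly k[n.+1]} -> stalk x} :=
  HB.pack (@germ _ _ x \o th) (GRing.isZmodMorphism.Build _ _ _ th_zmod)
    (GRing.isMonoidMorphism.Build _ _ _ th_monoid).
apply: (noetherian_localization (phi := phi)); last exact: noetherian_mpoly.
move=> b; rewrite -[b]germ_repr; have := pregerm_regular (repr b).
move=> /(chart_fraction hi xj)[P [Q [Qx e]]]; exists P, Q.
have [w hw] : exists w, phi Q * w = 1.
  apply: contrapT => nQ; have /nonunit_stalkP/eqP : nonunit (germ (th Q)) by [].
  exact/negP.
exists w; split=> //; rewrite /= -germM; apply/germ_eqP; apply: filterS e => y h; exact: h.
Qed.

Lemma curve_coordinates (k : fieldType) (Y : curve k) :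
  exists n (i : Y -> projective_space k n), coordinates i.
Proof.
have [n [Z [_ /isomorphic_coordinates[i hi _]]]] := curve_projective Y.
by exists n, i.
Qed.

Lemma germX (k : fieldType) (X : fspace k) (x : X) (a : pregerm x) n :
  exists2 b : pregerm x, germ a ^+ n = germ b & forall y, b y = a y ^+ n.
Proof.
elim: n => [|n [b bE b_]]; first by exists 1; rewrite ?germ1.
by exists (a * b) => [|y]; rewrite exprS ?germM ?bE // -b_.
Qed.

Section Curve.
Variables (k : closedFieldType) (Y : curve k).
Implicit Types (y : Y) (f g : Y -> k).

Definition uniformizer y (t : pregerm y) : Prop :=
  [/\ nonunit (germ t), forall n, germ t ^+ n != 0 &
      forall a, nonunit a -> exists b, a = germ t * b].

Lemma uniformizer_ex y : exists t : pregerm y, uniformizer t.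
Proof.
have [t [nt t_nil tP]] := curve_smooth y.
by exists (repr t); rewrite /uniformizer germ_repr.
Qed.

Lemma curve_noetherian y : noetherian (stalk y).
Proof. by have [n [i hi]] := curve_coordinates Y; exact: stalk_noetherian hi y. Qed.

Lemma uniformizer0 y (t : pregerm y) : uniformizer t -> t y = 0.
Proof. by case=> /nonunit_stalkP. Qed.

Lemma uniformizer_factor y (t : pregerm y) f : uniformizer t -> regular_at y f ->
  (\forall z \near y, f z = 0) \/
  exists n u, [/\ regular_at y u, u y != 0 & \forall z \near y, f z = t z ^+ n * u z].
Proof.
move=> [nt t_nil tP] /regular_stalk[a <-].
have [/germ0P|/eqP a0] := pselect (germ a = 0); first by left.
have [n [u [v [aE uv]]]] := dvr_factor nt tP (@curve_noetherian y) a0.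
right; exists n, (repr u); split; first exact: pregerm_regular.
  apply/eqP => /nonunit_stalkP; rewrite germ_repr; apply; by exists v.
have [b bE b_] := germX t n.
move: aE; rewrite bE -{1}[u]germ_repr -germM => /germ_eqP.
by apply: filterS => z e; rewrite -b_; exact: e.
Qed.

(** Each chart coordinate minus its value at [y] lies in the maximal ideal and is a multiple of [t]
    near [y]. A zero of [t] near [y] therefore has the coordinates of [y]. *)
Lemma uniformizer_neq0 y (t : pregerm y) : uniformizer t ->
  \forall z \near y, z <> y -> t z != 0.
Proof.
move=> ut; have [n [i hi]] := curve_coordinates Y.
have [j yj] : exists j, pcoord (i y) 0 j != 0.
  by have /existsP[j /andP[/eqP e _]] := valP (i y); exists j; rewrite [pcoord _ _ _]e oner_eq0.
have zero_coord l : \forall z \near y, t z = 0 ->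
    (chart i j z l) = (chart i j y l).
  have rl : regular_at y ((fun z => ('X_l : {mpoly k[n.+1]}).@[chart i j z]) - cst (chart i j y l)).
    by apply: regularB; [exact: chart_regular|exact: regular_cst].
  have [a aE] := regular_stalk rl.
  have [_ _ /(_ (germ a))[|b bE]] := ut.
    by apply/nonunit_stalkP; rewrite aE !fctE mevalXU subrr.
  move: bE; rewrite -[b]germ_repr -germM => /germ_eqP.
  apply: filterS => z; rewrite aE !fctE mevalXU => e tz0; apply/eqP.
  by rewrite -subr_eq0 e [X in X == _](_ : _ = t z * repr b z) // tz0 mul0r.
have all_coord : \forall z \near y, forall l, t z = 0 -> chart i j z l = chart i j y l.
  exact: filter_forall.
apply: filterS2 (coord_near hi yj) all_coord => z zj h zy.
apply: contra_notN zy => /eqP tz; apply: (coord_inj hi); apply: (pcoord_eq yj) => l.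
have := h l tz; rewrite /chart => /(congr1 (fun c => c * pcoord (i z) 0 j * pcoord (i y) 0 j)).
by rewrite divfK // mulrAC divfK // mulrAC => ->; rewrite mulrC.
Qed.

(** At an isolated point a uniformizer would have zero germ. *)
Lemma curve_not_isolated y U : nbhs y U -> exists2 z, z <> y & U z.
Proof.
move=> yU; apply: contrapT => h; have [t ut] := uniformizer_ex y.
have [_ /(_ 1%N)/eqP t0 _] := ut; apply: t0; rewrite expr1; apply/germ0P.
apply: filterS yU => z Uz; have [->|zy] := pselect (z = y); first exact: uniformizer0.
by case: h; exists z.
Qed.

Lemma curve_separated y z : z <> y -> \forall w \near z, w <> y.
Proof.
move=> zy; have [n [i hi]] := curve_coordinates Y.
have [j yj] : exists j, pcoord (i y) 0 j != 0.
  by have /existsP[j /andP[/eqP e _]] := valP (i y); exists j; rewrite [pcoord _ _ _]e oner_eq0.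
pose F l : {mpoly k[n.+1]} := pcoord (i y) 0 j *: 'X_l - pcoord (i y) 0 l *: 'X_j.
have hF l : F l \is 1.-homog by apply: rpredB; apply/dhomogZ/dhomogXU.
have FE l p : peval (F l) p = pcoord p 0 l * pcoord (i y) 0 j - pcoord (i y) 0 l * pcoord p 0 j.
  by rewrite /peval mevalB !mevalZ !mevalXU mulrC.
have [l Fl] : exists l, peval (F l) (i z) != 0.
  apply: contrapT => h; apply: zy; apply: (coord_inj hi); apply: (pcoord_eq yj) => l.
  apply/eqP; rewrite -subr_eq0 -FE; apply: contrapT => /negP hl; apply: h; by exists l.
apply: filterS (coord_open hi (hF l) Fl) => w; apply: contraNnot => ->.
by rewrite FE mulrC subrr.
Qed.

(* The zero germs of the finitely many equations of the complement of U
   define an open and closed subset of Y, hence an empty one. *)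
Lemma open_punctured (U : set Y) : open U -> U !=set0 ->
  forall y, \forall z \near y, z <> y -> U z.
Proof.
move=> oU U0; have [n [i hi]] := curve_coordinates Y.
pose S := [set F : {mpoly k[n.+1]} | (exists d, F \is d.-homog) /\
  forall z, peval F (i z) != 0 -> U z].
have [l [lS hl]] := noetherian_mpoly S.
have lU z : U z -> exists2 F, F \in l & peval F (i z) != 0.
  move=> Uz; have [d [F [hF Fz FU]]] := coord_nbhs hi (open_nbhs_nbhs (conj oU Uz)).
  have [|c FE] := hl F; first by split=> //; exists d.
  apply: contrapT => h; move/eqP: Fz; apply; rewrite FE /peval (raddf_sum (meval _)) /= big1 // => m _.
  rewrite mevalM; apply/eqP; rewrite mulf_eq0; apply/orP; right; apply: contrapT => /negP hm.
  by apply: h; exists l`_m => //; exact: mem_nth.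
pose B := interior (~` U).
have dich y : (\forall z \near y, z <> y -> U z) \/ B y.
  have [[F Fl nF]|allF] := pselect (exists2 F, F \in l & ~ \forall z \near y, peval F (i z) = 0).
    left; have [[d hF] FU] := lS F Fl.
    have [j yj] : exists j, pcoord (i y) 0 j != 0.
      by have /existsP[j /andP[/eqP e _]] := valP (i y); exists j;
        rewrite [pcoord _ _ _]e oner_eq0.
    have [t ut] := uniformizer_ex y.
    have [h|[m [u [ru uy e]]]] := uniformizer_factor ut (chart_regular hi F yj).
      case: nF; apply: filterS2 h (coord_near hi yj) => z Fz zj.
      by rewrite (chart_peval (j := j) hF) // Fz mulr0.
    near=> z => zy; apply: FU; rewrite (chart_peval (j := j) hF); last by near: z; exact: coord_near.
    rewrite mulf_neq0 ?expf_neq0 //; first by near: z; exact: coord_near.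
    have -> : F.@[chart i j z] = t z ^+ m * u z by near: z.
    rewrite mulf_neq0 ?expf_neq0 //; last by near: z; exact: regular_neq0 ru.
    by move: zy; near: z; exact: uniformizer_neq0.
  right; have : \forall z \near y, forall F, F \in l -> peval F (i z) = 0.
    elim: l {lS hl lU} allF => [|F l IHl] allF; first by apply: nearW.
    have [|F0] := pselect (\forall z \near y, peval F (i z) = 0); last first.
      by case: allF; exists F => //; rewrite inE eqxx.
    have /IHl : ~ exists2 F0, F0 \in l & ~ \forall z \near y, peval F0 (i z) = 0.
      by move=> [G Gl nG]; apply: allF; exists G => //; rewrite inE Gl orbT.
    by apply: filterS2 => z hz Fz G /[!inE]/orP[/eqP -> //|/hz].
  by apply: filterS => z hz /lU[F /hz ->]; rewrite eqxx.
have BU y : B y -> ~ U y by move=> /interior_subset.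
have oB : open B by exact: open_interior.
suff B0 : B = set0 by move=> y; case: (dich y) => //; rewrite B0.
have [z0 Uz0] := U0; have compE : ~` B = [set y | \forall z \near y, z <> y -> U z].
  apply/seteqP; split=> y /=; first by move=> nBy; case: (dich y).
  move=> hy By.
  have [z zy [hz Bz]] := curve_not_isolated (filterI hy (open_nbhs_nbhs (conj oB By))).
  exact: BU Bz (hz zy).
apply: contrapT => /eqP/set0P B0; suff BT : B = setT by apply: (BU z0) => //; rewrite BT.
apply: (@curve_connected k Y) => //; exists B; rewrite ?setTI //.
rewrite -openC compE openE => y /= hy.
have h2 : \forall w \near y, w <> y -> \forall z \near w, z <> w -> U z.
  apply: filterS hy => w hw wy.
  by have [//|Bw] := dich w; case: (BU w Bw (hw wy)).
by apply: filterS h2 => w h2; have [->|] := pselect (w = y).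
Unshelve. all: by end_near.
Qed.

End Curve.

(** * Rational functions *)

Section Generic.
Variables (k : closedFieldType) (Y : curve k).
Implicit Types (y z : Y) (f g : Y -> k) (P Q : set Y).

(** Density holds because by [open_punctured] a nonempty open set contains a punctured neighbourhood
    of every point of the curve. *)
Lemma generically_open (U : set Y) : open U -> U !=set0 -> generically U.
Proof.
move=> oU U0; exists U; split=> // V [y Vy] oV.
have [z zy [Vz Uz]] := curve_not_isolated
  (filterI (open_nbhs_nbhs (conj oV Vy)) (open_punctured oU U0 y)).
by exists z; split=> //; exact: Uz.
Qed.

Global Instance generically_filter : Filter (@generically Y).
Proof.
split.
- by exists setT; split; [exact: openT|move=> V [y Vy] _; exists y|].
- move=> P Q [U [oU dU UP]] [V [oV dV VQ]]; exists (U `&` V); split.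
  + exact: openI.
  + move=> W W0 oW; rewrite setIA; apply: dV => //; first exact: dU.
    exact: openI.
  + by move=> z [/UP Pz /VQ].
- by move=> P Q PQ [U [oU dU UP]]; exists U; split=> // z /UP/PQ.
Qed.

Lemma generically_punctured P y : generically P -> \forall z \near y, z <> y -> P z.
Proof.
move=> [U [oU dU UP]]; have [|z [_ Uz]] := dU setT _ openT; first exact: curve_neq0.
have U0 : U !=set0 by exists z.
by apply: filterS (open_punctured oU U0 y) => w h /h/UP.
Qed.

Lemma generically_and P Q : generically P -> generically Q ->
  generically [set z | P z /\ Q z].
Proof. exact: filterI. Qed.

Lemma generically_near P : generically P -> generically [set z | \forall w \near z, P w].
Proof.
move=> [U [oU dU UP]]; exists U; split=> // z Uz.
exact: filterS UP (open_nbhs_nbhs (conj oU Uz)).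
Qed.

Lemma near_generically P y : (\forall z \near y, P z) -> generically P.
Proof.
move=> yP; have : nbhs y P := yP; rewrite nbhsE => -[U [oU Uy] UP]; apply: filterS UP _.
by apply: generically_open => //; exists y.
Qed.

Lemma punctured_generically P y : (\forall z \near y, z <> y -> P z) -> generically P.
Proof.
move=> yP; have : nbhs y [set z | z <> y -> P z] := yP.
rewrite nbhsE => -[U [oU Uy] UP]; apply: (@filterS _ _ _ (U `&` [set z | z <> y])); first by move=> z [/UP].
apply: generically_open; last first.
  have [z zy Uz] := curve_not_isolated (open_nbhs_nbhs (conj oU Uy)).
  by exists z.
apply: openI => //; rewrite openE => z zy; exact: curve_separated.
Qed.

Lemma generically_ex P y U : generically P -> nbhs y U -> exists z, [/\ z <> y, U z & P z].
Proof.
move=> gP yU; have [z zy [Uz Pz]] := curve_not_isolated (filterI yU (generically_punctured y gP)).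
by exists z; split=> //; exact: Pz.
Qed.

Lemma generically_ex0 P : generically P -> P !=set0.
Proof.
move=> gP; have [y _] := curve_neq0 Y.
by have [z [_ _ Pz]] := generically_ex gP (@filterT _ (nbhs y) _); exists z.
Qed.

(** The identity theorem: a nonzero germ is a power of [t] times a unit, hence nonzero on a
    punctured neighbourhood, which meets every generic set. *)
Lemma regular_generic0 y f : regular_at y f -> generically [set z | f z = 0] ->
  \forall z \near y, f z = 0.
Proof.
move=> rf f0; have [t ut] := uniformizer_ex y.
have [//|[n [u [ru uy e]]]] := uniformizer_factor ut rf.
have tn := punctured_generically (uniformizer_neq0 ut).
have h1 := generically_and (near_generically (regular_neq0 uy ru)) (near_generically e).
have [z /= [[uz fz] [fz0 tz]]] := generically_ex0 (generically_and h1 (generically_and f0 tn)).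
move: fz0; rewrite fz => /eqP; rewrite mulf_eq0 (negPf uz) orbF expf_eq0.
by rewrite (negPf tz) andbF.
Qed.

Lemma regular_generic_eq y f g : regular_at y f -> regular_at y g ->
  generically [set z | f z = g z] -> \forall z \near y, f z = g z.
Proof.
move=> rf rg fg; have := regular_generic0 (regularB rf rg) => h.
have /h : generically [set z | (f - g) z = 0].
  by apply: filterS fg => z /= e; rewrite !fctE e subrr.
by apply: filterS => z /eqP; rewrite !fctE subr_eq0 => /eqP.
Qed.

Lemma rational_ext f g : generically [set z | f z = g z] -> rational f -> rational g.
Proof.
move=> /generically_near fg rf; apply: filterS2 fg rf => z /=; exact: regular_eq.
Qed.

Lemma rational_cst c : rational (cst c : Y -> k).
Proof. by apply: (@filterS _ _ _ setT); [move=> z _; exact: regular_cst|exact: filterT]. Qed.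

Lemma rationalB f g : rational f -> rational g -> rational (f - g).
Proof. by apply: filterS2 => z; exact: regularB. Qed.

Lemma rationalM f g : rational f -> rational g -> rational (f * g).
Proof. by apply: filterS2 => z; exact: regularM. Qed.

Lemma regular_rational y f : regular_at y f -> rational f.
Proof. by move=> rf; apply: near_generically (regular_near rf). Qed.

Lemma rational_neq0 f : rational f -> ~ generically [set z | f z = 0] ->
  generically [set z | f z != 0].
Proof.
move=> rf nf; apply: contrapT => h; apply: nf; apply: filterS rf => z rz /=.
apply: contrapT => /eqP fz; apply: h; exact: near_generically (regular_neq0 fz rz).
Qed.

Lemma rationalV f : rational f -> rational (fun z => (f z)^-1).
Proof.
move=> rf; have [f0|/(rational_neq0 rf) f0] := pselect (generically [set z | f z = 0]).
  apply: rational_ext (rational_cst 0); apply: filterS f0 => z /= ->.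
  by rewrite invr0.
by apply: filterS2 rf f0 => z; move=> /[swap]; exact: regularV.
Qed.

(** A presentation by two forms of equal degree near one point [q] is valid generically; the same
    two forms, read in a chart at [y], are regular at [y]. *)
Lemma rational_frac y f : rational f -> exists a b, [/\ regular_at y a, regular_at y b &
  generically [set z | b z != 0 /\ f z * b z = a z]].
Proof.
move=> rf; have [n [i hi]] := curve_coordinates Y.
have [q rq] := generically_ex0 rf.
have [d [F [G [hF hG e]]]] := (coord_regular hi q f).1 rq.
have [j yj] : exists j, pcoord (i y) 0 j != 0.
  by have /existsP[j /andP[/eqP h _]] := valP (i y); exists j; rewrite [pcoord _ _ _]h oner_eq0.
exists (fun z => F.@[chart i j z]), (fun z => G.@[chart i j z]).
split; [exact: chart_regular|exact: chart_regular|].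
apply: filterS2 (near_generically e) (near_generically (coord_near hi yj)).
move=> z /= [Gz fz] zj; move: Gz; rewrite fz (chart_peval (j := j) hG) // (chart_peval (j := j) hF) //.
rewrite mulf_eq0 negb_or => /andP[zd Gz]; split=> //.
by field; rewrite Gz.
Qed.

(** Membership in the local ring at [y] for a function that matters only generically: [f] may have
    wrong values at [y] or at other single points. *)
Definition rint y f : Prop :=
  exists2 g, regular_at y g & generically [set z | f z = g z].

Lemma rint_ext y f g : generically [set z | f z = g z] -> rint y f -> rint y g.
Proof.
move=> fg [h rh fh]; exists h => //.
by apply: filterS2 fg fh => z /= <-.
Qed.

Lemma rint_regular y f : regular_at y f -> rint y f.
Proof. by move=> rf; exists f => //; apply: filterS (@filterT _ _ generically_filter). Qed.

Lemma rint_cst y c : rint y (cst c).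
Proof. exact/rint_regular/regular_cst. Qed.

Lemma rintB y f g : rint y f -> rint y g -> rint y (f - g).
Proof.
move=> [f' rf ef] [g' rg eg]; exists (f' - g'); first exact: regularB.
by apply: filterS2 ef eg => z /= ef eg; rewrite !fctE ef eg.
Qed.

Lemma rintM y f g : rint y f -> rint y g -> rint y (f * g).
Proof.
move=> [f' rf ef] [g' rg eg]; exists (f' * g'); first exact: regularM.
by apply: filterS2 ef eg => z /= ef eg; rewrite !fctE ef eg.
Qed.

(** The local ring is a valuation ring: numerator and denominator are powers of [t] times units, and
    the two cases compare the exponents. *)
Lemma rint_or y f : rational f -> rint y f \/
  exists g, [/\ regular_at y g, g y = 0 & generically [set z | f z * g z = 1]].
Proof.
move=> rf; have [t ut] := uniformizer_ex y.
have [t0 [rt tn]] := (uniformizer0 ut, (pregerm_regular t, punctured_generically (uniformizer_neq0 ut))).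
have rX n : regular_at y (fun z => t z ^+ n).
  by have [b _ bE] := germX t n; apply: regular_eq (pregerm_regular b); exact: nearW.
have [a [b [ra rb e]]] := rational_frac y rf.
have [a0|[m [u [ru uy ae]]]] := uniformizer_factor ut ra.
  left; exists (cst 0); first exact: regular_cst.
  apply: filterS2 e (near_generically a0) => z [bz fb] az; apply/eqP.
  by have /eqP := fb; rewrite az mulf_eq0 (negPf bz) orbF.
have [b0|[n [v [rv vy be]]]] := uniformizer_factor ut rb.
  have [z [/= [bz _] bz0]] := generically_ex0 (filterI e (near_generically b0)).
  by rewrite bz0 eqxx in bz.
have fE : generically [set z | [/\ t z != 0, u z != 0, v z != 0 & f z = t z ^+ m * u z / (t z ^+ n * v z)]].
  have h1 := generically_and (generically_and (near_generically ae) (near_generically be)) e.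
  have h2 := generically_and (near_generically (regular_neq0 uy ru))
    (near_generically (regular_neq0 vy rv)).
  apply: filterS3 h1 tn h2 => z /= [[az bz] [bn fb]] tz [uz vz]; split=> //.
  by rewrite -az -bz -fb mulfK.
have rVt w : regular_at y w -> w y != 0 -> regular_at y (fun z => (w z)^-1).
  by move=> rw wy; exact: regularV.
have [nm|mn] := leqP n m.
  left; exists ((fun z => t z ^+ (m - n)) * (u * (fun z => (v z)^-1))).
    by apply: regularM => //; apply: regularM => //; exact: rVt.
  apply: filterS fE => z [tz uz vz fz]; rewrite /= fz !fctE -{1}(subnK nm) exprD.
  by field; rewrite vz expf_neq0.
right; exists ((fun z => t z ^+ (n - m)) * (v * (fun z => (u z)^-1))); split.
- by apply: regularM => //; apply: regularM => //; exact: rVt.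
- by rewrite fctE t0 expr0n subn_eq0 leqNgt mn mul0r.
apply: filterS fE => z [tz uz vz fz]; rewrite /= fz !fctE -{1}(subnK (ltnW mn)) exprD.
by field; rewrite vz uz !expf_neq0.
Qed.

(** The local ring is integrally closed. Otherwise [f] has an inverse [g] vanishing at [y], and the
    equation multiplied by the [n]-th power of [g] says that 1 plus a multiple of [g] is zero. *)
Lemma rint_integral y f n (c : nat -> Y -> k) : rational f -> (forall i, rint y (c i)) ->
  generically [set z | f z ^+ n + \sum_(i < n) c i z * f z ^+ i = 0] -> rint y f.
Proof.
move=> rf rc fE; have [//|[g [rg gy fg]]] := rint_or y rf.
have : rint y (\sum_(i < n) c i * (fun z => g z ^+ (n - i).-1)).
  apply: big_ind; [exact: rint_cst| |].
    move=> a b ra rb; have -> : a + b = a - (cst 0 - b) by rewrite sub0r opprK.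
    by apply: rintB => //; apply: rintB => //; exact: rint_cst.
  move=> i _; apply: rintM => //; apply: rint_regular.
  elim: (n - i).-1 => [|m IHm]; first exact: (regular_cst y 1).
  have -> : (fun z => g z ^+ m.+1) = g * (fun z => g z ^+ m) by apply/funext => z; exact: exprS.
  exact: regularM.
move=> [h rh he]; have /nbhs_singleton : \forall z \near y, (cst 1 - (cst 0 - g * h)) z = 0.
  apply: regular_generic0.
    apply: regularB; first exact: regular_cst.
    by apply: regularB; [exact: regular_cst|exact: regularM].
  apply: filterS3 fE fg he => z /= e fg1 hz.
  rewrite !fctE sub0r opprK -hz; have := congr1 ( *%R (g z ^+ n)) e; rewrite mulr0 => <-.
  rewrite mulrDr -exprMn [g z * f z]mulrC fg1 expr1n; congr (_ + _).
  rewrite fct_sumE !mulr_sumr; apply: eq_bigr => i _; rewrite !fctE.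
  rewrite (_ : g z ^+ n = g z * g z ^+ (n - i).-1 * g z ^+ i); last first.
    by rewrite -exprS prednK ?subn_gt0 // -exprD subnK // ltnW.
  rewrite [RHS](_ : _ = c i z * (g z * g z ^+ (n - i).-1) * (f z * g z) ^+ i).
    by rewrite fg1 expr1n; ring.
  by rewrite exprMn; ring.
by rewrite !fctE gy mul0r subrr subr0 => /eqP; rewrite oner_eq0.
Qed.

Definition is_rational : pred (Y -> k) := [pred f | `[< rational f >]].

Fact is_rational_subring : subring_closed is_rational.
Proof.
split=> [|f g /asboolP rf /asboolP rg|f g /asboolP rf /asboolP rg];
  apply/asboolP; [exact: rational_cst|exact: rationalB|exact: rationalM].
Qed.

(** There is no quotient by generic equality, so a nonzero element may vanish generically and have
    no inverse. The maps out of this ring that are used below identify generically equal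
    functions. *)
Record ratfun := Ratfun { ratfun_fun :> Y -> k; _ : ratfun_fun \in is_rational }.
HB.instance Definition _ := [isSub for ratfun_fun].
HB.instance Definition _ := [Choice of ratfun by <:].
HB.instance Definition _ := GRing.SubChoice_isSubComPzRing.Build _ _ ratfun
  is_rational_subring.

Fact ratfun_oner_neq0 : (1 : ratfun) != 0.
Proof.
have [y _] := curve_neq0 Y; apply/eqP => /(congr1 (fun f : ratfun => f y)) /eqP.
by rewrite [X in X == _](_ : _ = 1 :> k) // oner_eq0.
Qed.
HB.instance Definition _ := GRing.PzSemiRing_isNonZero.Build ratfun ratfun_oner_neq0.

Lemma ratfun_rational (a : ratfun) : rational a.
Proof. by have /asboolP := valP a. Qed.

Lemma rational_ratfun f : rational f -> exists a : ratfun, a = f :> (Y -> k).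
Proof. by move=> rf; exists (Ratfun (asboolT rf : f \in is_rational)). Qed.

End Generic.

(** * Finite morphisms *)

Section OpenSubspace.
Variables (k : fieldType) (X : fspace k) (U : set X).
Hypothesis oU : open U.

Definition ext0 (s : subfs U -> k) (x : X) : k :=
  if pselect (x \in U) is left h then s (exist _ x h) else 0.

Lemma ext0_val (s : subfs U -> k) (u : subfs U) : ext0 s (val u) = s u.
Proof.
rewrite /ext0; case: pselect => [h|[]]; last exact: (valP u).
by congr s; apply: val_inj.
Qed.

Lemma ext0_out (s : subfs U -> k) x : ~ U x -> ext0 s x = 0.
Proof. by move=> nUx; rewrite /ext0; case: pselect => [h|//]; case: nUx; exact: set_mem h. Qed.

Lemma subset_val (u : subfs U) : U (val u).
Proof. exact: set_mem (valP u). Qed.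

Definition inU x (Ux : U x) : subfs U := exist _ x (mem_set Ux).

Lemma ext0_in (s : subfs U -> k) x (Ux : U x) : ext0 s x = s (inU Ux).
Proof. exact: (ext0_val s (inU Ux)). Qed.

Lemma near_subspace (u : subfs U) (P : set (subfs U)) :
  (\forall v \near u, P v) -> \forall x \near (val u : X), forall v : subfs U, val v = x -> P v.
Proof.
case=> _ [[V oV <-] /= Vu VP].
by apply: filterS (open_nbhs_nbhs (conj oV Vu)) => x Vx v vx; apply: VP; move: Vx; rewrite -vx.
Qed.

Lemma near_open x : U x -> \forall y \near x, U y.
Proof. by move=> Ux; exact: open_nbhs_nbhs. Qed.

Lemma ext0_regular (s : subfs U -> k) x (Ux : U x) :
  regular_at (inU Ux) s -> regular_at x (ext0 s).
Proof.
move=> [g rg /near_subspace e]; apply: regular_eq rg.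
apply: filterS2 (near_open Ux) e => y Uy /(_ (inU Uy) erefl) e.
by rewrite (ext0_in s Uy) e.
Qed.

Lemma sub_regular (g : X -> k) (u : subfs U) :
  regular_at (val u) g -> regular_at u (fun v : subfs U => g (val v)).
Proof. by move=> rg; exists g => //; exact: (@nearW _ (nbhs u)). Qed.

Lemma section_regular (s : sections (subfs U)) x : U x -> regular_at x (ext0 s).
Proof. by move=> Ux; apply: (ext0_regular (Ux := Ux)); have /asboolP := valP s. Qed.

Lemma regular_section (g : X -> k) : (forall x, U x -> regular_at x g) ->
  exists s : sections (subfs U), forall u, s u = g (val u).
Proof.
move=> rg; have h : (fun v : subfs U => g (val v)) \in @is_section k (subfs U).
  by apply/asboolP => u; apply/sub_regular/rg/subset_val.
by exists (Section_ h).
Qed.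

(** Affine space is the chart of vectors with first entry 1. The field [ac_closed] expresses that
    the image of [U] is Zariski closed there: a vector at which all polynomials vanishing on [U]
    vanish is a point of [U]. This is how points are produced. *)
Record affine_coords n (c : X -> 'I_n.+1 -> k) : Prop := AffineCoords {
  ac_reg : forall P x, U x -> regular_at x (fun y => P.@[c y]);
  ac0 : forall x, U x -> c x ord0 = 1;
  ac_inj : forall x y, U x -> U y -> c x =1 c y -> x = y;
  ac_nbhs : forall x N, U x -> nbhs x N -> exists H : {mpoly k[n.+1]}, H.@[c x] != 0 /\
    forall y, U y -> H.@[c y] != 0 -> N y;
  ac_frac : forall x s, U x -> regular_at x s -> exists P Q : {mpoly k[n.+1]}, Q.@[c x] != 0 /\
    \forall y \near x, s y * Q.@[c y] = P.@[c y];
  ac_closed : forall v : 'I_n.+1 -> k, v ord0 = 1 ->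
    (forall P : {mpoly k[n.+1]}, (forall x, U x -> P.@[c x] = 0) -> P.@[v] = 0) ->
    exists2 x, U x & c x =1 v
}.

Lemma pcoord0_eq1 n (p : projective_space k n) : pcoord p 0 ord0 != 0 -> pcoord p 0 ord0 = 1.
Proof.
have /existsP[j /andP[/eqP pj /forallP h]] := valP p.
rewrite -/(pcoord p) in pj h; have := h ord0; have [j0|_ /= /eqP ->] := posnP j; last by rewrite eqxx.
by move=> _ _; rewrite -pj; congr (pcoord p 0 _); exact: val_inj.
Qed.

Lemma affine_affine_coords : affine (subfs U) -> exists n (c : X -> 'I_n.+1 -> k), affine_coords c.
Proof.
move=> [n [Z [cZ /isomorphic_coordinates[i hi iZ]]]]; exists n.
have ine u : pcoord (i u) 0 ord0 != 0.
  have : range i (i u) by exists u.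
  by rewrite iZ => -[].
pose c x l := ext0 (fun u => chart i ord0 u l) x; exists c.
have cE (u : subfs U) : c (val u) =1 chart i ord0 u by move=> l; rewrite /c ext0_val.
have cE' x (Ux : U x) : c x =1 chart i ord0 (inU Ux) by exact: (cE (inU Ux)).
have iE u l : chart i ord0 u l = pcoord (i u) 0 l.
  by rewrite /chart (pcoord0_eq1 (ine u)) divr1.
have pE (u : subfs U) d F : F \is d.-homog -> peval F (i u) = F.@[c (val u)].
  move=> hF; rewrite (chart_peval (j := ord0) hF) // (pcoord0_eq1 (ine u)) expr1n mul1r.
  by apply: meval_eq => l; rewrite cE.
split.
- move=> P x Ux; have := chart_regular hi P (ine (inU Ux)) => /ext0_regular.
  apply: regular_eq; apply: filterS (near_open Ux) => y Uy.
  rewrite (ext0_in _ Uy); apply: meval_eq => l; by rewrite cE'.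
- by move=> x Ux; rewrite (cE' _ Ux) /chart mulfV.
- move=> x y Ux Uy e; suff : inU Ux = inU Uy by move/(congr1 val).
  apply: (coord_inj hi); apply: val_inj; apply/rowP => l.
  by have := e l; rewrite (cE' _ Ux) (cE' _ Uy) !iE.
- move=> x N Ux xN; have : nbhs (inU Ux) [set v : subfs U | N (val v)].
    exact: (@val_near k X U (inU Ux) N xN).
  move=> /(coord_nbhs hi)[d [H [hH Hx HN]]]; exists H; rewrite -(pE (inU Ux) d) //; split=> // y Uy.
  by rewrite -[y]/(val (inU Uy)) -(pE _ d) //; exact: HN.
- move=> x s Ux rs; have := @sub_regular s (inU Ux) rs.
  move=> /(chart_fraction hi (ine (inU Ux)))[P [Q [Qx /near_subspace e]]].
  exists P, Q; split.
    by rewrite (meval_eq (v2 := chart i ord0 (inU Ux))) // => l; rewrite cE'.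
  apply: filterS2 (near_open Ux) e => y Uy /(_ (inU Uy) erefl) /= e.
  rewrite (meval_eq (v2 := chart i ord0 (inU Uy))); last by move=> l; rewrite cE'.
  rewrite e; apply: meval_eq => l; by rewrite cE'.
move=> v v0 hv.
have pv : [exists j, ((\row_l v l) 0 j == 1) &&
    [forall l : 'I_n.+1, (l < j)%N ==> ((\row_l v l) 0 l == 0)]].
  by apply/existsP; exists ord0; rewrite mxE v0 eqxx; apply/forallP.
pose p : projective_fs k n := ProjPoint pv.
have pvE l : pcoord p 0 l = v l by rewrite /= mxE.
have Zp : (Z `&` [set p | pcoord p 0 ord0 != 0]) p.
  split; last by rewrite /= pvE v0 oner_eq0.
  have [S hS ZE] := closed_openC cZ.
  apply: contrapT => nZp; have : (~` Z) p by [].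
  rewrite ZE => -[F SF]; have [d hF] := hS F SF.
  have -> : peval F p = F.@[v] by apply: meval_eq => l; exact: pvE.
  rewrite hv ?eqxx // => x Ux; rewrite -[x]/(val (inU Ux)) -(pE _ d) //; apply/eqP.
  apply: contrapT => /negP Fx; have : range i (i (inU Ux)) by exists (inU Ux).
  by rewrite iZ => -[Zi _]; have : (~` Z) (i (inU Ux)) by rewrite ZE; exists F => //=.
move: Zp; rewrite -iZ => -[u _ up]; exists (val u); first exact: subset_val.
by move=> l; rewrite cE iE up pvE.
Qed.

End OpenSubspace.

(** * Common eigenvectors of commuting matrices *)

Lemma rowspace_of (k : fieldType) r (P : 'rV[k]_r -> Prop) : P 0 ->
    (forall a u v, P u -> P v -> P (a *: u + v)) ->
  exists M : 'M[k]_r, forall u, P u <-> (u <= M)%MS.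
Proof.
move=> P0 PD.
pose Q n := `[< exists M : 'M[k]_r, \rank M = n /\ forall u, (u <= M)%MS -> P u >].
have Q0 : exists n, Q n.
  by exists 0%N; apply/asboolP; exists 0; rewrite mxrank0; split=> // u /[!submx0]/eqP ->.
have Qr n : Q n -> (n <= r)%N by move=> /asboolP[M [<- _]]; exact: rank_leq_row.
have [n /asboolP[M [Mn MP]] nmax] := ex_maxnP Q0 Qr.
exists M => u; split=> [Pu|/MP//]; apply: contrapT => /negP uM.
have : Q (\rank (M + u)%MS).
  apply/asboolP; exists (M + u)%MS; split=> // v /sub_addsmxP[[w c] ->].
  rewrite addrC /= [c]mx11_scalar mul_scalar_mx; apply: PD => //; apply: MP; exact: submxMl.
move/nmax; rewrite -Mn leqNgt => /negP; apply; apply: rank_ltmx.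
by rewrite ltmxE addsmxSl /= addsmx_sub submx_refl /=.
Qed.

Lemma eigenvector_in (k : closedFieldType) r (K A : 'M[k]_r) :
  K != 0 -> (K *m A <= K)%MS ->
  exists a (v : 'rV_r), [/\ v != 0, (v <= K)%MS & v *m A = a *: v].
Proof.
move=> K0 KA; have r0 : (0 < \rank K)%N by rewrite lt0n mxrank_eq0.
pose R := row_base K; pose A' := R *m A *m pinvmx R.
have RA : A' *m R = R *m A.
  apply: mulmxKpV; rewrite /R eq_row_base; apply: submx_trans KA.
  by rewrite submxMr // eq_row_base.
have /closed_rootP[a] : size (char_poly A') != 1%N by rewrite size_char_poly; case: (\rank K) r0.
rewrite -eigenvalue_root_char => /eigenvalueP[w wA w0].
exists a, (w *m R); split.
- by rewrite mulmx_free_eq0 ?row_base_free.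
- by rewrite (submx_trans (submxMl _ _)) // eq_row_base.
- by rewrite -mulmxA -RA mulmxA wA scalemxAl.
Qed.

(** Commutation is assumed on [K] only, since in the application the matrices commute modulo
    relations. The induction replaces [K] by its intersection with an eigenspace of the first
    matrix, which the others preserve. *)
Lemma common_eigenvector_in (k : closedFieldType) r (As : seq 'M[k]_r) (K : 'M[k]_r) :
  K != 0 -> (forall A, A \in As -> (K *m A <= K)%MS) ->
  (forall A B, A \in As -> B \in As -> K *m (A *m B) = K *m (B *m A)) ->
  exists v : 'rV_r, [/\ v != 0, (v <= K)%MS & forall A, A \in As -> exists a, v *m A = a *: v].
Proof.
elim: As K => [|A As IHA] K K0 KA Kc.
  have [i Ki] : exists i, row i K != 0.
    apply: contrapT => h; case/eqP: K0; apply/row_matrixP => i; rewrite row0.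
    by apply: contrapT => /eqP Ki; apply: h; exists i.
  by exists (row i K); rewrite row_sub.
have [a [v [v0 vK vA]]] := eigenvector_in K0 (KA A (mem_head _ _)).
pose E := (K :&: eigenspace A a)%MS.
have EK : (E <= K)%MS by exact: capmxSl.
have EA : E *m A = a *: E by apply/eigenspaceP; exact: capmxSr.
have KE B C : B \in A :: As -> C \in A :: As -> E *m (B *m C) = E *m (C *m B).
  by move=> hB hC; have [W ->] := submxP EK; rewrite -!(mulmxA W) Kc.
have [|B hB|B C hB hC|w [w0 wE wA]] := IHA E.
- apply: contraNneq v0 => E0; rewrite -submx0 -E0 sub_capmx vK /=; exact/eigenspaceP.
- rewrite sub_capmx (submx_trans (submxMr _ EK)) ?KA ?inE ?hB ?orbT //=.
  apply/eigenspaceP; rewrite -mulmxA KE ?inE ?eqxx ?hB ?orbT //.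
  by rewrite mulmxA EA scalemxAl.
- by rewrite KE ?inE ?hB ?hC ?orbT.
exists w; split=> //; first exact: submx_trans wE EK.
move=> B /[!inE]/orP[/eqP ->|/wA//]; exists a.
by apply/eigenspaceP; apply: submx_trans wE _; exact: capmxSr.
Qed.

Lemma regular_sum (k : fieldType) (X : fspace k) (x : X) (I : Type) (r : seq I)
    (f : I -> X -> k) : (forall l, regular_at x (f l)) ->
  regular_at x (fun y => \sum_(l <- r) f l y).
Proof.
move=> rf; elim: r => [|l r IHr].
  by rewrite (_ : (fun y => _) = cst 0); [exact: regular_cst|apply/funext => y; rewrite big_nil].
rewrite (_ : (fun y => _) = f l - (cst 0 - (fun y => \sum_(l <- r) f l y))).
  by apply: regularB => //; apply: regularB => //; exact: regular_cst.
by apply/funext => y; rewrite big_cons !fctE sub0r opprK.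
Qed.

(** * Closedness of finite morphisms *)

Record local_finite (k : fieldType) (Y X : fspace k) (f : Y -> X) (V : set X) : Prop := LocalFinite {
  lf_open : open V;
  lf_base : exists n (c : X -> 'I_n.+1 -> k), affine_coords V c;
  lf_total : exists n (c : Y -> 'I_n.+1 -> k), affine_coords (f @^-1` V) c;
  lf_gen : exists r (e : 'I_r -> Y -> k), (forall j y, V (f y) -> regular_at y (e j)) /\
    forall s, (forall y, V (f y) -> regular_at y s) -> exists c : 'I_r -> X -> k,
      (forall j x, V x -> regular_at x (c j)) /\
      forall y, V (f y) -> s y = \sum_j c j (f y) * e j y
}.

Lemma finite_mor_local (k : fieldType) (Y X : curve k) (f : mor Y X) x :
  finite_mor f -> exists2 V, V x & local_finite f V.
Proof.
move=> /(_ x)[V [oV Vx aV aW [r [e gen]]]]; exists V => //.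
have oW : open (f @^-1` V) by apply: open_comp oV => y _; exact: mor_cts.
split=> //; [exact: affine_affine_coords|exact: affine_affine_coords|].
exists r, (fun j => ext0 (e j)); split=> [j y Vy|s rs]; first exact: section_regular.
have [s' sE] := regular_section (U := f @^-1` V) rs.
have [c cE] := gen s'; exists (fun j => ext0 (c j)); split=> [j z Vz|y Vy].
  exact: section_regular.
rewrite -[LHS](sE (inU (Vy : (f @^-1` V) y))) cE.
pose ev (t : sections (subfs (f @^-1` V))) := t (inU (Vy : (f @^-1` V) y)).
have evD : {morph ev : a b / a + b} by [].
have ev0 : ev 0 = 0 by [].
rewrite -[LHS]/(ev _) (big_morph ev evD ev0); apply: eq_bigr => j _.
rewrite (ext0_in (U := V) _ Vy) (ext0_in (U := f @^-1` V) _ (Vy : (f @^-1` V) y)).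
rewrite [LHS](_ : _ = c j (restr_fun (@subset_refl _ (f @^-1` V)) (inU (Vy : (f @^-1` V) y))) * e j (inU (Vy : (f @^-1` V) y))) //.
by congr (c j _ * _); apply: val_inj.
Qed.

Section LyingOver.
Variables (k : closedFieldType) (Y X : fspace k) (f : mor Y X) (V : set X).
Hypothesis fV : local_finite f V.
Variables (D : set Y) (x : X).
Hypotheses (cD : closed D) (Vx : V x) (xD : forall y, f y = x -> ~ D y).

(* Were x in the closure of f(D), the fibre at x of the module of functions
   on D would be nonzero, and a common eigenvector of the coordinate functions
   on its dual would be a point of D over x. *)
Lemma lying_over : \forall x' \near x, forall y, f y = x' -> ~ D y.
Proof.
have oV := lf_open fV.
have [nX [cX aX]] := lf_base fV; have [n [cY aY]] := lf_total fV.
have [r [e [re gen]]] := lf_gen fV.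
pose W y := V (f y).
(* [R] collects the values at [x] of the relations that hold on [D] between the generators; the
   quotient of the space of row vectors by [R] is the fibre at [x] of the module of functions on
   [D]. *)
pose R (u : 'rV[k]_r) := exists c : 'I_r -> X -> k,
  [/\ forall j x, V x -> regular_at x (c j), forall j, c j x = u 0 j &
      forall y, W y -> D y -> \sum_j c j (f y) * e j y = 0].
have [|a u v [c [rc cu ce]] [d [rd dv de]]|M RM] := @rowspace_of k r R.
- exists (fun _ => cst 0); split=> [j z _|j|y _ _]; [exact: regular_cst|by rewrite mxE|].
  by rewrite big1 // => j _; rewrite mul0r.
- exists (fun j => cst a * c j - (cst 0 - d j)); split=> [j z Vz|j|y Wy Dy].
  + apply: regularB; first by apply: regularM; [exact: regular_cst|exact: rc].
    by apply: regularB; [exact: regular_cst|exact: rd].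
  + by rewrite !fctE cu dv !mxE sub0r opprK.
  + rewrite (eq_bigr (fun j => a * (c j (f y) * e j y) + d j (f y) * e j y)).
      by rewrite big_split /= -mulr_sumr ce // de // mulr0 addr0.
    by move=> j _; rewrite !fctE sub0r opprK mulrDl mulrA.
(* If the relations fill the fibre, [r] of them have an invertible coefficient matrix near [x].
   There they kill every [e j] on [D], and with them the constant 1. *)
have [full|nfull] := boolP (row_full M).
  have rows i : R (delta_mx 0 i) by apply/RM; exact: submx_full.
  pose c i := sval (cid (rows i)).
  have cP i : [/\ forall j x, V x -> regular_at x (c i j),
      forall j, c i j x = (delta_mx 0 i : 'rV[k]_r) 0 j &
      forall y, W y -> D y -> \sum_j c i j (f y) * e j y = 0] by exact: (svalP (cid (rows i))).
  pose N z : 'M[k]_r := \matrix_(i, j) c i j z.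
  have rdet : regular_at x (fun z => \det (N z)).
    apply: regular_sum => s; have rp : regular_at x (fun z => \prod_i N z i (s i)).
      apply: regular_prod => i; have [/(_ (s i) x Vx) h _ _] := cP i.
      by apply: regular_eq h; apply: nearW => z; rewrite mxE.
    have := regularM (regular_cst x ((-1) ^+ s : k)) rp.
    by apply: regular_eq; apply: nearW => z.
  have det0 : \det (N x) != 0.
    rewrite (_ : N x = 1%:M) ?det1 ?oner_eq0 //; apply/matrixP => i j; rewrite !mxE.
    by have [_ -> _] := cP i; rewrite mxE eqxx /= eq_sym.
  have [|c1 [rc1 c1E]] := gen (cst 1); first by move=> y _; exact: regular_cst.
  apply: filterS2 (regular_neq0 det0 rdet) (near_open oV Vx) => z dz Vz y fy Dy.
  subst z; have Nu : N (f y) \in unitmx by rewrite unitmxE unitfE.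
  have Ne : N (f y) *m (\col_j e j y) = 0.
    apply/colP => i; rewrite !mxE; have [_ _ /(_ y Vz Dy) h] := cP i.
    by rewrite -[RHS]h; apply: eq_bigr => j _; rewrite !mxE.
  have ey j : e j y = 0.
    have := congr1 (mulmx (invmx (N (f y)))) Ne; rewrite mulKmx // mulmx0 => /colP/(_ j).
    by rewrite !mxE.
  have := c1E y Vz; rewrite big1 /= => [/eqP|j _]; first by rewrite oner_eq0.
  by rewrite ey mulr0.
pose X_ l y : k := cY y l.
have rX l y : W y -> regular_at y (X_ l).
  move=> Wy; apply: regular_eq (ac_reg aY 'X_l Wy); apply: nearW => z; exact: mevalXU.
have cmat l i : exists c : 'I_r -> X -> k, (forall j x, V x -> regular_at x (c j)) /\
    forall y, W y -> X_ l y * e i y = \sum_j c j (f y) * e j y.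
  apply: (gen (X_ l * e i)) => y Wy; apply: regularM; [exact: rX|exact: re].
pose c l i := sval (cid (cmat l i)).
have rc l i j z : V z -> regular_at z (c l i j).
  by have [h _] := svalP (cid (cmat l i)); exact: h.
have cE l i y : W y -> X_ l y * e i y = \sum_j c l i j (f y) * e j y.
  by have [_ h] := svalP (cid (cmat l i)); exact: h.
pose C l : 'M[k]_r := \matrix_(i, j) c l i j x.
have MC l : (M *m C l <= M)%MS.
  apply/row_subP => i; apply/RM; rewrite row_mul.
  have /RM[a [ra ax ae]] := row_sub i M.
  exists (fun j z => \sum_h a h z * c l h j z); split=> [j z Vz|j|y Wy Dy].
  - apply: regular_sum => h; apply: (@regularM _ _ z (a h) (c l h j)); [exact: ra|exact: rc].
  - by rewrite mxE; apply: eq_bigr => h _; rewrite ax !mxE.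
  - under eq_bigr do rewrite mulr_suml.
    rewrite exchange_big /=.
    rewrite (eq_bigr (fun h => X_ l y * (a h (f y) * e h y))).
      by rewrite -mulr_sumr ae // mulr0.
    move=> h _; rewrite mulrCA cE // mulr_sumr; apply: eq_bigr => j _; by rewrite mulrA.
have Ccomm l m : (C l *m C m - C m *m C l <= M)%MS.
  apply/row_subP => i; apply/RM.
  pose a l m j z := \sum_h c l i h z * c m h j z.
  have aE l' m' y : W y -> \sum_j a l' m' j (f y) * e j y = X_ l' y * X_ m' y * e i y.
    move=> Wy; rewrite -mulrA mulrCA cE // mulr_sumr.
    under eq_bigr do rewrite mulr_suml.
    rewrite exchange_big /=; apply: eq_bigr => h _; rewrite mulrCA cE // mulr_sumr.
    by apply: eq_bigr => j _; rewrite mulrA.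
  have ra l' m' j z : V z -> regular_at z (a l' m' j).
    move=> Vz; apply: regular_sum => h; apply: (@regularM _ _ z (c l' i h) (c m' h j)); exact: rc.
  exists (fun j => a l m j - a m l j); split=> [j z Vz|j|y Wy Dy].
  - by apply: regularB; exact: ra.
  - by rewrite fctE !mxE; congr (_ - _); apply: eq_bigr => h _; rewrite !mxE.
  - under eq_bigr do rewrite fctE mulrBl.
    by rewrite sumrB !aE // [X_ m y * _]mulrC subrr.
(* [K] consists of the functionals that kill the relations, the dual of the fibre. The transposed
   multiplication matrices commute on it because the commutators have their rows in [M]. *)
pose K := kermx M^T.
have KM (v : 'rV_r) : (v <= K)%MS -> M *m v^T = 0.
  by move=> /sub_kermxP h; apply: trmx_inj; rewrite trmx_mul trmxK h trmx0.
have MK B : (B <= M)%MS -> K *m B^T = 0.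
  by move=> /submxP[E ->]; rewrite trmx_mul mulmxA mulmx_ker mul0mx.
have K0 : K != 0.
  rewrite kermx_eq0 -row_leq_rank mxrank_tr -ltnNge ltn_neqAle rank_leq_row andbT.
  by rewrite /row_full in nfull.
have [|B /mapP[l _ ->]|A B /mapP[l _ ->] /mapP[m _ ->]|v [v0 vK vC]] :=
    @common_eigenvector_in k r [seq (C l)^T | l <- enum 'I_n.+1] K => //.
- by apply/sub_kermxP; rewrite -mulmxA -trmx_mul; apply: MK.
- apply/eqP; rewrite -subr_eq0 -mulmxBr -!trmx_mul -raddfB /=; apply/eqP/MK; exact: Ccomm.
have lamex l : exists a, v *m (C l)^T = a *: v by apply/vC/map_f; rewrite mem_enum.
pose lam l := sval (cid (lamex l)).
have lamE l i : \sum_j C l i j * v 0 j = lam l * v 0 i.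
  have := svalP (cid (lamex l)); rewrite -/(lam l) => /rowP/(_ i); rewrite !mxE => <-.
  by apply: eq_bigr => j _; rewrite !mxE mulrC.
(* [L] is the graph of the functional on functions on [D] given by the eigenvector [v]. Multiplying
   a function by the coordinate [X_ l] multiplies its value by [lam l], so polynomials act through
   their value at [lam]. *)
pose L (s : Y -> k) (b : k) := exists c : 'I_r -> X -> k,
  [/\ forall j x, V x -> regular_at x (c j), b = \sum_j c j x * v 0 j &
    forall y, W y -> D y -> s y = \sum_j c j (f y) * e j y].
have Lfun s b b' : L s b -> L s b' -> b = b'.
  move=> [d [rd -> de]] [d' [rd' -> de']]; apply/eqP; rewrite -subr_eq0 -sumrB; apply/eqP.
  have /RM/submxP[E EE] : R (\row_j (d j x - d' j x)).
    exists (fun j => d j - d' j); split=> [j z Vz|j|y Wy Dy].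
    - by apply: regularB; [exact: rd|exact: rd'].
    - by rewrite mxE.
    - by under eq_bigr do rewrite fctE mulrBl; rewrite sumrB -de // -de' // subrr.
  have : (\row_j (d j x - d' j x)) *m v^T = 0 by rewrite EE -mulmxA KM // mulmx0.
  move=> /matrixP/(_ 0 0); rewrite [LHS]mxE [RHS]mxE => h; rewrite -[RHS]h.
  by apply: eq_bigr => j _; rewrite [X in _ = X * _]mxE [X in _ = _ * X]mxE mulrBl.
have Lext s s' b : (forall y, W y -> D y -> s y = s' y) -> L s b -> L s' b.
  by move=> ss [d [rd bE de]]; exists d; split=> // y Wy Dy; rewrite -ss // de.
have L0 : L (cst 0) 0.
  exists (fun=> cst 0); split=> [j z _||y _ _]; first exact: regular_cst;
  by rewrite big1 // => j _; rewrite mul0r.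
have LD s s' b b' : L s b -> L s' b' -> L (s + s') (b + b').
  move=> [d [rd -> de]] [d' [rd' -> de']].
  exists (fun j => d j - (cst 0 - d' j)); split=> [j z Vz||y Wy Dy].
  - by apply: regularB; [exact: rd|apply: regularB; [exact: regular_cst|exact: rd']].
  - by rewrite -big_split /=; apply: eq_bigr => j _; rewrite !fctE sub0r opprK mulrDl.
  - rewrite fctE de // de' // -big_split /=; apply: eq_bigr => j _.
    by rewrite !fctE sub0r opprK mulrDl.
have LM a s b : (forall z, V z -> regular_at z a) -> L s b -> L ((a \o f) * s) (a x * b).
  move=> ra [d [rd -> de]]; exists (fun j => a * d j); split=> [j z Vz||y Wy Dy].
  - by apply: regularM; [exact: ra|exact: rd].
  - by rewrite mulr_sumr; apply: eq_bigr => j _; rewrite mulrA.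
  - by rewrite fctE de // mulr_sumr; apply: eq_bigr => j _; rewrite mulrA.
have LX l s b : L s b -> L (X_ l * s) (lam l * b).
  move=> [d [rd -> de]]; exists (fun j z => \sum_i d i z * c l i j z); split=> [j z Vz||y Wy Dy].
  - apply: regular_sum => h; apply: (@regularM _ _ z (d h) (c l h j)); [exact: rd|exact: rc].
  - rewrite mulr_sumr; under [RHS]eq_bigr do rewrite mulr_suml.
    rewrite exchange_big /=; apply: eq_bigr => i _.
    rewrite mulrCA -lamE mulr_sumr; apply: eq_bigr => j _; by rewrite mxE mulrA.
  - rewrite fctE de // mulr_sumr; under [RHS]eq_bigr do rewrite mulr_suml.
    rewrite exchange_big /=; apply: eq_bigr => i _.
    by rewrite mulrCA cE // mulr_sumr; apply: eq_bigr => j _; rewrite mulrA.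
have LP (P : {mpoly k[n.+1]}) s b : L s b -> L ((fun y => P.@[cY y]) * s) (P.@[lam] * b).
  move=> Ls; elim/mpolyind: P => [|a m P _ _ IHP].
    rewrite meval0 mul0r; apply: Lext L0 => y _ _; by rewrite !fctE /= meval0 mul0r.
  have Lm : L ((fun y => ('X_[m] : {mpoly k[n.+1]}).@[cY y]) * s) (('X_[m] : {mpoly k[n.+1]}).@[lam] * b).
    have -> : (fun y => ('X_[m] : {mpoly k[n.+1]}).@[cY y]) = (fun y => \prod_l X_ l y ^+ m l).
      by apply/funext => y; exact: mevalX.
    rewrite mevalX; elim: (index_enum _) => [|l ls IHl].
      rewrite big_nil mul1r; apply: Lext Ls => y _ _; by rewrite !fctE /= big_nil mul1r.
    have Lp q : L ((fun y => X_ l y ^+ q * \prod_(l0 <- ls) X_ l0 y ^+ m l0) * s)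
        (lam l ^+ q * \prod_(l0 <- ls) lam l0 ^+ m l0 * b).
      elim: q => [|q IHq].
        by rewrite mul1r; apply: Lext IHl => y _ _; rewrite !fctE mul1r.
      rewrite exprS -!mulrA [_ * (_ * b)]mulrA; apply: Lext (LX l _ _ IHq) => y _ _.
      by rewrite !fctE exprS !mulrA.
    rewrite big_cons; apply: Lext (Lp (m l)) => y _ _; by rewrite !fctE big_cons.
  rewrite mevalD mevalZ mulrDl -mulrA; apply: Lext (LD _ _ _ _ (LM (cst a) _ _ _ Lm) IHP).
    move=> y _ _; by rewrite !fctE /= mevalD mevalZ mulrDl mulrA.
  by move=> z _; exact: regular_cst.
have Le m : L (e m) (v 0 m).
  exists (fun j => cst (j == m)%:R); split=> [j z _||y _ _]; first exact: regular_cst.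
    by rewrite (bigD1 m) //= eqxx mul1r big1 ?addr0 // => j /negPf ->; rewrite mul0r.
  by rewrite (bigD1 m) //= eqxx mul1r big1 ?addr0 // => j /negPf ->; rewrite mul0r.
have [m vm] : exists m, v 0 m != 0.
  apply: contrapT => h; case/eqP: v0; apply/rowP => j; rewrite mxE.
  by apply: contrapT => /eqP hj; apply: h; exists j.
have vanish P : (forall y, W y -> D y -> P.@[cY y] = 0) -> P.@[lam] = 0.
  move=> hP; have h : L (cst 0) (P.@[lam] * v 0 m).
    apply: Lext (LP P _ _ (Le m)) => y Wy Dy; by rewrite !fctE /= hP // mul0r.
  by have /eqP := Lfun _ _ _ h L0; rewrite mulf_eq0 (negPf vm) orbF => /eqP.
have lam0 : lam ord0 = 1.
  have := vanish ('X_ord0 - 1); rewrite mevalB mevalXU meval1 => h.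
  apply/eqP; rewrite -subr_eq0; apply/eqP/h => y Wy _.
  by rewrite mevalB mevalXU meval1 (ac0 aY) // subrr.
have [y Wy yl] : exists2 y, W y & cY y =1 lam.
  by apply: (ac_closed aY) => // P hP; apply: vanish => y Wy _; exact: hP.
have Dy : D y.
  apply: contrapT => nDy; have [H [Hy HD]] := ac_nbhs aY Wy
    (open_nbhs_nbhs (conj (closed_openC cD) nDy)).
  case/eqP: Hy; rewrite (meval_eq (v2 := lam)) //; apply: vanish => z Wz Dz.
  by apply: contrapT => /eqP/(HD z Wz).
case: (xD (y := y)) => //; apply: (ac_inj aX) => // l.
pose a z := cX z l.
have ra z : V z -> regular_at z a.
  move=> Vz; apply: regular_eq (ac_reg aX 'X_l Vz); apply: nearW => w; exact: mevalXU.
have rs : regular_at y ((a \o f) - cst (a x)).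
  by apply: regularB; [exact/mor_reg/ra|exact: regular_cst].
(* The function [a \o f] minus [a x] is a fraction of polynomials only near [y]. The factor [H]
   makes the identity hold on all of [W]; applying [L] to it gives that [P] vanishes at [y]. *)
have [P [Q [Qy PQ]]] := ac_frac aY Wy rs.
have [H [Hy HPQ]] := ac_nbhs aY Wy PQ.
have L1 : L (((a - cst (a x)) \o f) * e m) ((a - cst (a x)) x * v 0 m).
  by apply: LM => // z Vz; apply: regularB; [exact: ra|exact: regular_cst].
have L2 := LP (H * Q) _ _ L1; have L3 := LP (H * P) _ _ (Le m).
have L23 : L ((fun y => (H * P).@[cY y]) * e m) ((H * Q).@[lam] * ((a - cst (a x)) x * v 0 m)).
  apply: Lext L2 => z Wz Dz; rewrite !fctE !mevalM /=.
  have [->|/(HPQ z Wz)] := eqVneq (H.@[cY z]) 0; first by rewrite !mul0r.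
  by rewrite !fctE /= => <-; ring.
have := Lfun _ _ _ L23 L3; rewrite !fctE subrr mul0r mulr0 => /esym/eqP.
have lE (P0 : {mpoly k[n.+1]}) : P0.@[lam] = P0.@[cY y] by apply: meval_eq => j; rewrite yl.
rewrite mevalM !mulf_eq0 (negPf vm) orbF !lE (negPf Hy) /= => /eqP Py.
have := nbhs_singleton PQ; rewrite Py !fctE /= => /eqP; rewrite mulf_eq0 (negPf Qy) orbF.
by rewrite subr_eq0 => /eqP.
Qed.

End LyingOver.

(** * Galois coverings *)

Section Cover.
Variables (k : closedFieldType) (Y X : curve k) (f : mor Y X).
Hypothesis hf : covering f.

Lemma mor_near y (P : set X) : (\forall x \near f y, P x) -> \forall z \near y, P (f z).
Proof. by move=> h; exact: (@mor_cts _ _ _ f y _ h). Qed.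

(** Flatness at an étale point [y] prevents a uniformizer at [f y] from pulling back to zero:
    otherwise 1 would be a combination of images of elements killed by the uniformizer, and these
    are zero. So [f] generically avoids the point [f y], and near that point [P] can fail only
    there. *)
Lemma cover_dominant (P : set X) : generically P -> generically [set y | P (f y)].
Proof.
move=> gP; have [_ /generically_ex0[y [fl _]]] := hf.
have [t ut] := uniformizer_ex (f y); have [nt t_nil tP] := ut.
have tf : ~ \forall z \near y, t (f z) = 0.
  move=> t0; have [|n [b' [c [bE cE]]]] := fl 1%N (fun=> germ t) (fun=> 1).
    rewrite big_ord1 mulr1 /= stalk_pullE; exact/germ0P.
  have c0 j : c ord0 j = 0.
    have := cE j; rewrite big_ord1 => /(dvr_domain nt t_nil tP (@curve_noetherian _ _ (f y))).
    by case=> // /eqP; rewrite -[germ t]expr1; move: (t_nil 1%N) => /negPf ->.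
  have /eqP := bE ord0; rewrite big1 ?oner_eq0 // => j _.
  by rewrite c0 rmorph0 mul0r.
have rt : regular_at y (t \o f) by apply: mor_reg; exact: pregerm_regular.
have tn := rational_neq0 (regular_rational rt) (fun h => tf (regular_generic0 rt h)).
have nP := mor_near (generically_punctured (f y) gP).
apply: filterS2 tn (near_generically nP) => z /= tz h; apply: h => e.
by case/eqP: tz; rewrite e uniformizer0.
Qed.

(** By [lying_over] for the whole of [Y], an empty fibre has only empty fibres nearby, which
    contradicts dominance. *)
Lemma cover_surjective x : exists y, f y = x.
Proof.
apply: contrapT => h; have [V Vx fV] := finite_mor_local x hf.1.
have := lying_over fV (@closedT Y) Vx (fun y fy => False_ind _ (h (ex_intro _ y fy))).
move=> /near_generically/cover_dominant/generically_ex0[y /= /(_ y erefl)]; exact.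
Qed.

Lemma cover_closed x (N : set Y) : (forall y, f y = x -> nbhs y N) ->
  \forall x' \near x, forall y, f y = x' -> N y.
Proof.
move=> hN; have [V Vx fV] := finite_mor_local x hf.1.
have cD : closed (~` N°) by apply: open_closedC; exact: open_interior.
have xD y : f y = x -> ~ (~` N°) y by move=> /hN h; apply.
apply: filterS (lying_over fV cD Vx xD) => x' h y /h; rewrite /setC /= => /contrapT.
exact: interior_subset.
Qed.

Lemma cover_generic (P : set Y) : generically P ->
  generically [set x | forall y, f y = x -> P y].
Proof.
move=> gP; have [x0 _] := curve_neq0 X.
have := @cover_closed x0 [set z | f z <> x0 -> P z] => h.
apply: (@punctured_generically _ _ _ x0); apply: filterS (h _) => [x hx xx0 y fy|y fy].
  by apply: hx => //; rewrite fy.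
by apply: filterS (generically_punctured y gP) => z hz fz; apply: hz => e; apply: fz; rewrite e.
Qed.

Lemma affine_separators (U : set Y) n (c : Y -> 'I_n.+1 -> k) m (p : 'I_m -> Y) :
  affine_coords U c -> injective p -> (forall i, U (p i)) ->
  exists P : 'I_m -> {mpoly k[n.+1]}, forall i j, (P i).@[c (p j)] = (i == j)%:R.
Proof.
move=> aU pI Up.
have sep i j : exists Q : {mpoly k[n.+1]}, Q.@[c (p i)] = 1 /\ (i != j -> Q.@[c (p j)] = 0).
  have [->|ij] := eqVneq i j; first by exists 1; rewrite meval1.
  have [l hl] : exists l, c (p i) l != c (p j) l.
    apply: contrapT => h; case/eqP: ij; apply: pI; apply: (ac_inj aU) => // l.
    by apply: contrapT => /eqP hl; apply: h; exists l.
  exists ((c (p i) l - c (p j) l)^-1 *: ('X_l - (c (p j) l)%:MP)).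
  by rewrite !mevalZ !mevalB !mevalXU !mevalC mulVf ?subr_eq0 // subrr mulr0.
pose Q i j := sval (cid (sep i j)).
exists (fun i => \prod_j Q i j) => i j; rewrite rmorph_prod /=.
have [<-|ij] := eqVneq i j.
  by apply: big1 => l _; have [] := svalP (cid (sep i l)).
by rewrite (bigD1 j) //=; have [_ ->] := svalP (cid (sep i j)); rewrite ?mul0r.
Qed.

(** Functions separating [m] points of the fibre are combinations of [r] generators with
    coefficients constant on the fibre, so the identity matrix of size [m] factors through a space
    of dimension [r]. *)
Lemma cover_fibre_bound x : exists r, forall m (p : 'I_m -> Y), injective p ->
  (forall i, f (p i) = x) -> (m <= r)%N.
Proof.
have [V Vx fV] := finite_mor_local x hf.1.
have [n [c aY]] := lf_total fV; have [r [e [re gen]]] := lf_gen fV.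
exists r => m p pI px; have Vp i : V (f (p i)) by rewrite px.
have [P PE] := affine_separators aY pI Vp.
have rep i := gen (fun y => (P i).@[c y]) (fun y Vy => ac_reg aY (P i) Vy).
pose d i := sval (cid (rep i)).
have dE i y : V (f y) -> (P i).@[c y] = \sum_j d i j (f y) * e j y.
  by have [_] := svalP (cid (rep i)); exact.
have : (\matrix_(i < m, j < r) d i j x) *m (\matrix_(j < r, i < m) e j (p i)) = 1%:M.
  apply/matrixP => i j; rewrite !mxE -[RHS](PE i j) dE //.
  by apply: eq_bigr => l _; rewrite !mxE px.
move=> /(congr1 mxrank); rewrite mxrank1 => <-.
exact: leq_trans (mxrankM_maxl _ _) (rank_leq_col _).
Qed.

Lemma cover_separators x : exists m (p : 'I_m -> Y) (s : 'I_m -> Y -> k),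
  [/\ forall y, f y = x <-> exists i, y = p i,
      forall i j, regular_at (p j) (s i) & forall i j, s i (p j) = (i == j)%:R].
Proof.
have [r hr] := cover_fibre_bound x.
pose Q m := `[< exists p : 'I_m -> Y, injective p /\ forall i, f (p i) = x >].
have Q0 : exists m, Q m.
  by exists 0%N; apply/asboolP; unshelve eexists; [case|split=> -[]].
have Qr m : Q m -> (m <= r)%N by move=> /asboolP[p [pI px]]; exact: hr pI px.
have [m /asboolP[p [pI px]] mmax] := ex_maxnP Q0 Qr.
have [V Vx fV] := finite_mor_local x hf.1.
have [n [c aY]] := lf_total fV.
have Vp i : V (f (p i)) by rewrite px.
have [P PE] := affine_separators aY pI Vp.
exists m, p, (fun i y => (P i).@[c y]); split=> // [y|i j]; last exact: (ac_reg aY).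
split=> [fy|[i ->]//]; apply: contrapT => h.
pose q (i : 'I_m.+1) := if unlift ord0 i is Some j then p j else y.
have : Q m.+1.
  apply/asboolP; exists q; split=> [i j|i]; last by rewrite /q; case: unliftP.
  rewrite /q; case: unliftP => [i' ->|->]; case: unliftP => [j' ->|->] //.
  - by move=> /pI ->.
  - by move=> e; case: h; exists i'.
  - by move=> e; case: h; exists j'.
by move/mmax; rewrite ltnn.
Qed.

Lemma rational_pull r : rational r -> rational (r \o f).
Proof. by move=> /cover_dominant; apply: filterS => y; exact: mor_reg. Qed.

Lemma rint_pull y r : rint (f y) r -> rint y (r \o f).
Proof.
move=> [g rg /cover_dominant e]; exists (g \o f); first exact: mor_reg.
by apply: filterS e.
Qed.

(** Otherwise [r] has an inverse vanishing at [f y], whose pullback vanishes at [y] although its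
    product with a function regular at [y] is 1. *)
Lemma rint_descend y r : rational r -> rint y (r \o f) -> rint (f y) r.
Proof.
move=> rr [h rh e]; have [//|[g [rg g0 /cover_dominant ge]]] := rint_or (f y) rr.
have : \forall z \near y, (h * (g \o f)) z = (cst 1 : Y -> k) z.
  apply: regular_generic_eq; [|exact: regular_cst|].
    by apply: regularM => //; exact: mor_reg.
  apply: filterS2 e ge => z e1 e2; rewrite -e2; congr (_ * _); exact: esym e1.
by move=> /nbhs_singleton; rewrite !fctE /= g0 mulr0 => /eqP; rewrite eq_sym oner_eq0.
Qed.

End Cover.

Section GaloisAction.
Variables (k : closedFieldType) (G : finGroupType) (Y X : curve k).
Variables (a : group_action G Y) (f : mor Y X).
Hypothesis gal : galois_covering a f.

Lemma action_cover : covering f. Proof. by case: gal. Qed.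
Lemma action_over g y : f (a g y) = f y. Proof. by case: gal. Qed.

Lemma actVK g : cancel (a g^-1%g) (a g).
Proof. by move=> y; rewrite -actM mulgV act1. Qed.

Lemma act_generic g (P : set Y) : generically P -> generically [set y | P (a g y)].
Proof.
move=> /generically_near gP; have [y Py] := generically_ex0 gP.
rewrite -(actVK g y) in Py; apply: (@near_generically _ _ _ (a g^-1%g y)).
exact: (@mor_cts _ _ _ (a g) _ _ Py).
Qed.

Lemma rational_act g s : rational s -> rational (s \o a g).
Proof. by move=> /(act_generic g); apply: filterS => y; exact: mor_reg. Qed.

Lemma rint_act g y s : rint (a g y) s -> rint y (s \o a g).
Proof.
move=> [h rh e]; exists (h \o a g); first exact: mor_reg.
exact: act_generic e.
Qed.

Lemma galois_descend s : rational s ->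
  (forall g, generically [set y | s (a g y) = s y]) ->
  exists2 r : X -> k, rational r & generically [set y | s y = r (f y)].
Proof. by case: gal => _ _ _; exact. Qed.

(** Some point is moved by [g] within its fibre. A function separating that point from its image
    differs from its conjugate there, hence generically. *)
Lemma galois_faithful g : g != 1%g ->
  exists2 s : Y -> k, rational s & generically [set y | s (a g y) != s y].
Proof.
move=> g1; have [y gy] : exists y, a g y <> y.
  apply: contrapT => h; case/eqP: g1; case: gal => _ _ + _; apply=> y.
  by apply: contrapT => hy; apply: h; exists y.
have [m [p [s [ps rs sE]]]] := cover_separators action_cover (f y).
have [i yi] := (ps y).1 erefl; have [j yj] := (ps (a g y)).1 (action_over g y).
have rsy : rational (s i) := regular_rational (rs i i).
exists (s i) => //; pose d := (s i \o a g) - s i.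
have rd : regular_at y d.
  by apply: regularB; [apply: mor_reg; rewrite yj; exact: rs|rewrite {1}yi; exact: rs].
have : ~ generically [set z | d z = 0].
  move=> /(regular_generic0 rd)/nbhs_singleton/eqP.
  have -> : d y = s i (a g y) - s i y by [].
  have -> : s i y = 1 by rewrite yi sE eqxx.
  rewrite yj sE; have [ij|] := eqVneq i j; first by case: gy; rewrite yj -ij -yi.
  by rewrite sub0r oppr_eq0 oner_eq0.
move=> /(rational_neq0 (regular_rational rd)); apply: filterS => z.
by rewrite /= /d fctE subr_eq0.
Qed.

End GaloisAction.

(** * Completed local fields *)

Section FractionMap.
Variables (k : closedFieldType) (Y : curve k) (y : Y).
Variables (F : fieldType) (phi : {rmorphism pregerm y -> F}).
Hypothesis phi0 : forall a, phi a = 0 <-> \forall z \near y, a z = 0.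

Definition fraction_of (f : Y -> k) (a b : pregerm y) : Prop :=
  generically [set z | b z != 0 /\ f z * b z = a z].

Lemma fraction_of_den f a b : fraction_of f a b -> phi b != 0.
Proof.
move=> fab; apply/eqP => /phi0 b0.
have [z /= [[bz _] bz0]] := generically_ex0 (generically_and fab (near_generically b0)).
by rewrite bz0 eqxx in bz.
Qed.

Lemma fraction_of_ex f : rational f -> exists ab, fraction_of f ab.1 ab.2.
Proof.
move=> /(rational_frac y)[a [b [/regular_stalk[a' <-] /regular_stalk[b' <-] h]]].
by exists (a', b').
Qed.

Lemma fraction_of_eq f g a b c d :
  generically [set z | f z = g z] -> fraction_of f a b -> fraction_of g c d ->
  phi a / phi b = phi c / phi d.
Proof.
move=> fg fab gcd; have b0 := fraction_of_den fab; have d0 := fraction_of_den gcd.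
apply/eqP; rewrite eqr_div // -!rmorphM -subr_eq0 -rmorphB; apply/eqP/phi0.
apply: regular_generic0; first exact: pregerm_regular.
apply: filterS3 fg fab gcd => z /= e [bz fb] [dz gd].
rewrite [LHS](_ : _ = a z * d z - c z * b z) // -fb -gd e; ring.
Qed.

Definition fraction_map (f : ratfun Y) : F :=
  let ab := sval (cid (fraction_of_ex (ratfun_rational f))) in
  phi ab.1 / phi ab.2.

Lemma fraction_mapE (f : ratfun Y) a b : fraction_of f a b ->
  fraction_map f = phi a / phi b.
Proof.
move=> fab; have h := svalP (cid (fraction_of_ex (ratfun_rational f))).
by apply: fraction_of_eq h fab; apply: filterS (@filterT _ _ (generically_filter Y)).
Qed.

Lemma fraction_map_ext (f g : ratfun Y) : generically [set z | f z = g z] ->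
  fraction_map f = fraction_map g.
Proof.
move=> fg; apply: fraction_of_eq fg _ _;
  [exact: (svalP (cid (fraction_of_ex (ratfun_rational f))))
  |exact: (svalP (cid (fraction_of_ex (ratfun_rational g))))].
Qed.

Lemma fraction_map_regular (f : ratfun Y) (a : pregerm y) : generically [set z | f z = a z] ->
  fraction_map f = phi a.
Proof.
move=> fa; rewrite (fraction_mapE (a := a) (b := 1)) ?rmorph1 ?divr1 //.
apply: filterS fa => z fz; split; first exact: oner_neq0.
rewrite [f z]fz; exact: mulr1.
Qed.

Fact fraction_map_zmod : zmod_morphism fraction_map.
Proof.
move=> f g; have [[a b] fab] := fraction_of_ex (ratfun_rational f).
have [[c d] gcd] := fraction_of_ex (ratfun_rational g).
rewrite (fraction_mapE fab) (fraction_mapE gcd) (fraction_mapE (a := a * d - c * b) (b := b * d)).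
  have b0 := fraction_of_den fab; have d0 := fraction_of_den gcd.
  by rewrite rmorphB !rmorphM /=; field; rewrite /= b0 d0.
apply: filterS2 fab gcd => z [bz fb] [dz gd]; split; first exact: mulf_neq0.
change ((f z - g z) * (b z * d z) = a z * d z - c z * b z); rewrite -fb -gd; ring.
Qed.

Fact fraction_map_monoid : monoid_morphism fraction_map.
Proof.
split.
  rewrite (fraction_map_regular (a := 1)) ?rmorph1 //.
  by apply: filterS (@filterT _ _ (generically_filter Y)).
move=> f g; have [[a b] fab] := fraction_of_ex (ratfun_rational f).
have [[c d] gcd] := fraction_of_ex (ratfun_rational g).
rewrite (fraction_mapE fab) (fraction_mapE gcd) (fraction_mapE (a := a * c) (b := b * d)).
  have b0 := fraction_of_den fab; have d0 := fraction_of_den gcd.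
  by rewrite !rmorphM /=; field; rewrite /= b0 d0.
apply: filterS2 fab gcd => z [bz fb] [dz gd]; split; first exact: mulf_neq0.
change (f z * g z * (b z * d z) = a z * c z); rewrite -fb -gd; ring.
Qed.

Lemma fraction_map_eq0 (f : ratfun Y) : fraction_map f = 0 <-> generically [set z | f z = 0].
Proof.
split=> [|f0]; last first.
  have [e _] := fraction_map_monoid; rewrite -(subrr (fraction_map 1)) -fraction_map_zmod subrr; apply: fraction_map_ext.
  by apply: filterS f0 => z fz; exact: fz.
have [[a b] fab] := fraction_of_ex (ratfun_rational f).
rewrite (fraction_mapE fab) => /eqP; rewrite mulf_eq0 invr_eq0 (negPf (fraction_of_den fab)) orbF.
move=> /eqP/phi0/near_generically a0.
apply: filterS2 fab a0 => z /= [bz fb] az; apply/eqP.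
by have /eqP := fb; rewrite az mulf_eq0 (negPf bz) orbF.
Qed.

End FractionMap.

Section LocalEmbedding.
Variables (k : closedFieldType) (Y : curve k) (y : Y).
Local Notation F := (local_field y).

Definition germ_completion (a : pregerm y) : completed_stalk y :=
  to_completion (curve_smooth y) (germ a).

Fact germ_completion_zmod : zmod_morphism germ_completion.
Proof. by move=> a b; rewrite /germ_completion germB rmorphB. Qed.
Fact germ_completion_monoid : monoid_morphism germ_completion.
Proof.
split=> [|a b]; first by rewrite /germ_completion germ1 rmorph1.
by rewrite /germ_completion germM rmorphM.
Qed.
HB.instance Definition _ := GRing.isZmodMorphism.Build _ _ germ_completion germ_completion_zmod.
HB.instance Definition _ := GRing.isMonoidMorphism.Build _ _ germ_completion germ_completion_monoid.

Lemma germ_completion_eq0 a : germ_completion a = 0 <-> \forall z \near y, a z = 0.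
Proof.
split=> [|/germ0P a0]; last by rewrite /germ_completion a0 rmorph0.
have [t [nt t_nil tP]] := curve_smooth y.
move=> /(to_completion_inj nt t_nil tP (@curve_noetherian _ _ y)) h; exact/germ0P.
Qed.

Definition germ_field (a : pregerm y) : F := FracField.tofrac (germ_completion a).

Fact germ_field_zmod : zmod_morphism germ_field.
Proof. by move=> a b; rewrite /germ_field !rmorphB. Qed.
Fact germ_field_monoid : monoid_morphism germ_field.
Proof.
by split=> [|a b]; rewrite /germ_field ?rmorph1 // !rmorphM.
Qed.
HB.instance Definition _ := GRing.isZmodMorphism.Build _ _ germ_field germ_field_zmod.
HB.instance Definition _ := GRing.isMonoidMorphism.Build _ _ germ_field germ_field_monoid.

Lemma germ_field_eq0 a : germ_field a = 0 <-> \forall z \near y, a z = 0.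
Proof.
rewrite -germ_completion_eq0; split=> [/eqP|h]; last by rewrite /germ_field h rmorph0.
by rewrite /germ_field tofrac_eq0 => /eqP.
Qed.

Definition local_map : ratfun Y -> F := fraction_map germ_field.
HB.instance Definition _ := GRing.isZmodMorphism.Build _ _ local_map
  (fraction_map_zmod germ_field_eq0).
HB.instance Definition _ := GRing.isMonoidMorphism.Build _ _ local_map
  (fraction_map_monoid germ_field_eq0).

Lemma local_mapE (f : ratfun Y) a b : fraction_of f a b ->
  local_map f = germ_field a / germ_field b.
Proof. exact: (fraction_mapE germ_field_eq0). Qed.

Lemma local_map_ext (f g : ratfun Y) : generically [set z | f z = g z] ->
  local_map f = local_map g.
Proof. exact: (fraction_map_ext germ_field_eq0). Qed.

Lemma local_map_regular (f : ratfun Y) (a : pregerm y) : generically [set z | f z = a z] ->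
  local_map f = germ_field a.
Proof. exact: (fraction_map_regular germ_field_eq0). Qed.

Lemma local_map_eq0 (f : ratfun Y) : local_map f = 0 <-> generically [set z | f z = 0].
Proof. exact: (fraction_map_eq0 germ_field_eq0). Qed.

(** Otherwise the inverse of [f] vanishes at [y] and is a multiple of the uniformizer, so that [c]
    times such a multiple would be 1 in the completion. *)
Lemma local_map_integral (f : ratfun Y) (c : completed_stalk y) :
  local_map f = FracField.tofrac c -> rint y f.
Proof.
move=> fc; have [//|[g [rg g0 fg]]] := rint_or y (ratfun_rational f).
have [a aE] := regular_stalk rg; have [t [nt t_nil tP]] := curve_smooth y.
have /tP[b ab] : nonunit (germ a) by apply/nonunit_stalkP; rewrite aE.
have [r rE] := rational_ratfun (regular_rational (pregerm_regular a)).
have ra : local_map r = germ_field a.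
  by apply: local_map_regular; rewrite rE; apply: filterS (@filterT _ _ (generically_filter Y)).
have fr1 : local_map (f * r) = local_map 1.
  apply: local_map_ext; apply: filterS fg => z e; change (f z * r z = 1).
  by rewrite -[RHS]e rE aE.
have : c * germ_completion a = 1.
  have e1 : local_map (f * r) = local_map f * local_map r := rmorphM local_map f r.
  have e2 : local_map 1 = 1 := rmorph1 local_map.
  move: fr1; rewrite e1 e2 ra fc.
  rewrite -[X in X = _](rmorphM (@FracField.tofrac (completed_stalk y))).
  rewrite -[X in _ = X](rmorph1 (@FracField.tofrac (completed_stalk y))) => /eqP.
  by rewrite tofrac_eq => /eqP.
rewrite /germ_completion ab rmorphM mulrCA => e.
have : nonunit (1 : stalk y).
  apply: (completion_residue nt tP (r := c * to_completion (curve_smooth y) b)).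
  by rewrite rmorph1 -e.
by case; exists 1; rewrite mul1r.
Qed.

Definition const_germ (c : k) : pregerm y :=
  Pregerm (asboolT (regular_cst y c) : cst c \in near_section y).

Lemma local_map_value (f : ratfun Y) g (c : k) (t : pregerm y) r : uniformizer t ->
  regular_at y g -> generically [set z | f z = g z] ->
  local_map f = FracField.tofrac (germ_completion (const_germ c) + germ_completion t * r) ->
  g y = c.
Proof.
move=> [nt _ tP] /regular_stalk[a <-] fa.
rewrite (local_map_regular fa) => /eqP; rewrite tofrac_eq addrC -subr_eq => /eqP.
rewrite -rmorphB => /(completion_residue nt tP)/nonunit_stalkP/eqP.
rewrite [X in X == _](_ : _ = a y - c) //; by rewrite subr_eq0 => /eqP.
Qed.

Lemma local_map_dense (z : F) (t : pregerm y) n : uniformizer t ->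
  exists (f : ratfun Y) r, z - local_map f = FracField.tofrac (germ_completion t ^+ n * r).
Proof.
move=> [nt t_nil tP].
have [a [b [r [b0 e]]]] := frac_approx nt t_nil tP (@curve_noetherian _ _ y) z n.
move: b0 e; rewrite -[a]germ_repr -[b]germ_repr; set a' := repr a; set b' := repr b => b0 e.
have b'n : generically [set w | b' w != 0].
  apply: rational_neq0; first exact: regular_rational (pregerm_regular b').
  move=> /(regular_generic0 (pregerm_regular b'))/germ0P; exact/eqP.
have [f fE] := rational_ratfun (rationalM (regular_rational (pregerm_regular a'))
  (rationalV (regular_rational (pregerm_regular b')))).
exists f, r; rewrite (local_mapE (a := a') (b := b')).
  have <- : to_completion (curve_smooth y) (germ t ^+ n) = germ_completion t ^+ n.
    by rewrite rmorphXn.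
  exact: e.
by apply: filterS b'n => w bw; rewrite /= fE !fctE divfK.
Qed.

End LocalEmbedding.

Section PullRatfun.
Variables (k : closedFieldType) (Y X : curve k) (f : mor Y X).
Hypothesis hf : covering f.

Lemma ratfun_pull_subproof (r : ratfun X) : r \o f \in @is_rational k Y.
Proof. by apply/asboolP/rational_pull/ratfun_rational. Qed.
Definition ratfun_pull (r : ratfun X) : ratfun Y := Ratfun (ratfun_pull_subproof r).

Fact ratfun_pull_zmod : zmod_morphism ratfun_pull.
Proof. by move=> r s; apply: val_inj. Qed.
Fact ratfun_pull_monoid : monoid_morphism ratfun_pull.
Proof. by split=> [|r s]; apply: val_inj. Qed.
HB.instance Definition _ := GRing.isZmodMorphism.Build _ _ ratfun_pull ratfun_pull_zmod.
HB.instance Definition _ := GRing.isMonoidMorphism.Build _ _ ratfun_pull ratfun_pull_monoid.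

End PullRatfun.

Section BranchIso.
Variables (k : closedFieldType) (XP : formal_orbifold k).

Lemma alg_fmorph_div (K F : fieldType) (L : fieldExtType K) (h : {rmorphism L -> F}) (u v : K) :
  h ((u / v)%:A) = h u%:A / h v%:A.
Proof. exact: (fmorph_div (h \o GRing.in_alg L) u v). Qed.

(** For the trivial branch data the extension at [y] is the completed local field over itself, so
    the étale condition identifies it with [P(x)]. Its scalar multiplication is the product, whence
    the factor 1 removed in the proof. *)
Lemma branch_iso (Y : curve k) (f : mor Y XP) (hf : covering f) (x : XP) (y : Y) :
  @orbifold_etale k (trivial_orbifold Y) XP f -> f y = x ->
  exists h : {rmorphism orb_branch XP x -> local_field y}, bijective h /\
    forall r : ratfun XP, h ((local_map x r)%:A) = local_map y (ratfun_pull hf r).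
Proof.
move=> [_ et] <-; have [h [hE hb]] := et y; exists h; split=> // r.
have hg (a : pregerm (f y)) : h ((germ_field a)%:A) = germ_field (pregerm_pull a).
  rewrite -[LHS]/(h (branch_map (orb_branch XP) (germ_completion a))) hE.
  rewrite -[LHS]/(FracField.tofrac (@completed_pull k Y XP f y (germ_completion a)) * 1).
  by rewrite mulr1 /germ_field /completed_pull completion_mapE /= stalk_pullE.
have [[a b] rab] := @fraction_of_ex _ _ (f y) _ (ratfun_rational r).
rewrite (local_mapE rab) (local_mapE (a := pregerm_pull a) (b := pregerm_pull b)).
  by rewrite alg_fmorph_div !hg.
by have := cover_dominant hf rab.
Qed.

(** Here the branch data enter: for any [y1] over the same point as [y2], both completed local
    fields are isomorphic to the extension prescribed at that point, compatibly with [k(X)]. *)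
Lemma etale_embedding (Y1 Y2 : curve k) (f1 : mor Y1 XP) (f2 : mor Y2 XP)
    (h1 : covering f1) (h2 : covering f2) :
  @orbifold_etale k (trivial_orbifold Y1) XP f1 ->
  @orbifold_etale k (trivial_orbifold Y2) XP f2 ->
  forall y2 : Y2, exists th : {rmorphism ratfun Y1 -> local_field y2},
    (forall a, th a = 0 <-> generically [set z | a z = 0]) /\
    forall r, th (ratfun_pull h1 r) = local_map y2 (ratfun_pull h2 r).
Proof.
move=> e1 e2 y2; have [y1 y12] := cover_surjective h1 (f2 y2).
have [s1 [[t1 s1K t1K] s1E]] := branch_iso h1 e1 y12.
have [s2 [[t2 s2K t2K] s2E]] := branch_iso h2 e2 (erefl (f2 y2)).
have tz : zmod_morphism t1 by apply: can2_zmod_morphism s1K t1K.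
have tm : monoid_morphism t1 by apply: can2_monoid_morphism s1K t1K.
pose t : {rmorphism local_field y1 -> orb_branch XP (f2 y2)} :=
  HB.pack t1 (GRing.isZmodMorphism.Build _ _ _ tz) (GRing.isMonoidMorphism.Build _ _ _ tm).
exists (s2 \o (t \o @local_map k Y1 y1)); split=> [a|r] /=.
  rewrite -(@local_map_eq0 _ _ y1); split=> e.
    have t0 : t (local_map y1 a) = 0.
      by apply: (can_inj s2K); rewrite (rmorph0 s2); exact: e.
    by apply: (can_inj t1K); rewrite (rmorph0 t : t1 0 = 0); exact: t0.
  by rewrite e (rmorph0 t : t1 0 = 0) rmorph0.
by rewrite -s1E s1K s2E.
Qed.

End BranchIso.

(** * The tensor product of the function fields *)

Section ActRatfun.
Variables (k : closedFieldType) (G : finGroupType) (Y : curve k).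
Variable a : group_action G Y.

Fact ratfun_act_subproof g (s : ratfun Y) : s \o a g \in @is_rational k Y.
Proof. apply/asboolP; exact: rational_act (ratfun_rational s). Qed.
Definition ratfun_act g (s : ratfun Y) : ratfun Y := Ratfun (ratfun_act_subproof g s).

End ActRatfun.

Section Tensor.
Variables (k : closedFieldType) (X Y1 Y2 : curve k) (G1 G2 : finGroupType).
Variables (a1 : group_action G1 Y1) (f1 : mor Y1 X) (gal1 : galois_covering a1 f1).
Variables (a2 : group_action G2 Y2) (f2 : mor Y2 X) (gal2 : galois_covering a2 f2).

(* A ring with the properties of k(Y1) (x) k(Y2) over k(X), together with the
   actions of G1 and G2 on the two factors. *)
Record tensor := Tensor {
  tensor_ring :> comNzRingType;
  tl : {rmorphism ratfun Y1 -> tensor_ring};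
  tr : {rmorphism ratfun Y2 -> tensor_ring};
  gl : G1 -> {rmorphism tensor_ring -> tensor_ring};
  gr : G2 -> {rmorphism tensor_ring -> tensor_ring};
  tl_eq0 : forall a, tl a = 0 <-> generically [set y | a y = 0];
  tr_eq0 : forall a, tr a = 0 <-> generically [set y | a y = 0];
  tlr : forall c, tl (ratfun_pull (action_cover gal1) c) = tr (ratfun_pull (action_cover gal2) c);
  tensor_span : forall u, exists s : seq (ratfun Y1 * ratfun Y2),
    u = \sum_(c <- s) tl c.1 * tr c.2;
  gl_tl : forall g a, gl g (tl a) = tl (ratfun_act a1 g a);
  gl_tr : forall g a, gl g (tr a) = tr a;
  gr_tl : forall g a, gr g (tl a) = tl a;
  gr_tr : forall g a, gr g (tr a) = tr (ratfun_act a2 g a)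
}.

End Tensor.

Definition tensor_swap (k : closedFieldType) (X Y1 Y2 : curve k) (G1 G2 : finGroupType)
    (a1 : group_action G1 Y1) (f1 : mor Y1 X) (gal1 : galois_covering a1 f1)
    (a2 : group_action G2 Y2) (f2 : mor Y2 X) (gal2 : galois_covering a2 f2)
    (T : tensor gal1 gal2) : tensor gal2 gal1.
Proof.
apply: (@Tensor _ _ _ _ _ _ _ _ gal2 _ _ gal1 T (tr T) (tl T) (gr T) (gl T)).
- exact: tr_eq0.
- exact: tl_eq0.
- by move=> c; rewrite tlr.
- move=> u; have [s ->] := tensor_span u; exists [seq (c.2, c.1) | c <- s].
  by rewrite big_map; apply: eq_bigr => c _; rewrite mulrC.
- exact: gr_tr.
- exact: gr_tl.
- exact: gl_tr.
- exact: gl_tl.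
Defined.

(** * A model of the tensor product: generic functions on the fibre product of point sets *)

Section FibreProduct.
Variables (k : closedFieldType) (X Y1 Y2 : curve k) (G1 G2 : finGroupType).
Variables (a1 : group_action G1 Y1) (f1 : mor Y1 X) (gal1 : galois_covering a1 f1).
Variables (a2 : group_action G2 Y2) (f2 : mor Y2 X) (gal2 : galois_covering a2 f2).

Definition fibre_product := {p : Y1 * Y2 | f1 p.1 = f2 p.2}.
Local Notation S := fibre_product.
Implicit Types (p : S) (t : S -> k).

Definition fp_base p : X := f1 (sval p).1.

Lemma fp_base2 p : fp_base p = f2 (sval p).2. Proof. exact: (svalP p). Qed.

(** The fibre product carries no topology here, so genericity is borrowed from [X]. Surjectivity of
    the covers, which completes a point of one factor to a pair, recovers from it the genericity on
    either factor. *)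
Definition fp_generic (P : set S) : Prop :=
  generically [set x | forall p, fp_base p = x -> P p].

Local Instance fp_generic_filter : Filter fp_generic.
Proof.
split.
- by apply: (@filterS _ (@generically X) _ setT) (@filterT _ (@generically X) _).
- move=> P Q; apply: (@filterS2 _ (@generically X) _) => x hP hQ p px.
  by split; [exact: hP|exact: hQ].
- by move=> P Q PQ; apply: (@filterS _ (@generically X) _) => x h p /h/PQ.
Qed.

Lemma fp_genericS (P Q : set S) : (forall p, P p -> Q p) -> fp_generic P -> fp_generic Q.
Proof. exact: filterS. Qed.

Lemma fp_generic_and (P Q : set S) : fp_generic P -> fp_generic Q ->
  fp_generic [set p | P p /\ Q p].
Proof. exact: filterI. Qed.

Lemma fp_genericT (P : set S) : (forall p, P p) -> fp_generic P.
Proof. by move=> hP; apply: filterS (@filterT _ _ fp_generic_filter). Qed.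

Lemma fp_generic_map (m : S -> S) (P : set S) : (forall p, fp_base (m p) = fp_base p) ->
  fp_generic P -> fp_generic [set p | P (m p)].
Proof.
by move=> mb; apply: (@filterS _ (@generically X) _) => x h p px; apply: h; rewrite mb.
Qed.

Lemma fp_generic_ex (P : set S) : fp_generic P -> exists p, P p.
Proof.
move=> /generically_ex0[x h].
have [y1 y1x] := cover_surjective (action_cover gal1) x.
have [y2 y2x] := cover_surjective (action_cover gal2) x.
have e : f1 (y1, y2).1 = f2 (y1, y2).2 by rewrite /= y1x.
by exists (exist _ (y1, y2) e); apply: h.
Qed.

Lemma fp_generic1 (P : set Y1) : fp_generic [set p | P (sval p).1] <-> generically P.
Proof.
split=> [h|/(cover_generic (action_cover gal1))]; last first.
  by apply: (@filterS _ (@generically X) _) => x h p; exact: h.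
have := cover_dominant (action_cover gal1) h; apply: filterS => y1 /= hy.
have [y2 y2x] := cover_surjective (action_cover gal2) (f1 y1).
have e : f1 (y1, y2).1 = f2 (y1, y2).2 by rewrite /= y2x.
exact: (hy (exist _ (y1, y2) e)).
Qed.

Lemma fp_generic2 (P : set Y2) : fp_generic [set p | P (sval p).2] <-> generically P.
Proof.
split=> [h|/(cover_generic (action_cover gal2))]; last first.
  by apply: (@filterS _ (@generically X) _) => x h p; rewrite fp_base2; exact: h.
have := cover_dominant (action_cover gal2) h; apply: filterS => y2 /= hy.
have [y1 y1x] := cover_surjective (action_cover gal1) (f2 y2).
have e : f1 (y1, y2).1 = f2 (y1, y2).2 by [].
exact: (hy (exist _ (y1, y2) e)).
Qed.

Definition fp_sum (s : seq (ratfun Y1 * ratfun Y2)) p : k :=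
  \sum_(c <- s) c.1 (sval p).1 * c.2 (sval p).2.

Definition is_tensor : pred (S -> k) :=
  [pred t | `[< exists s, fp_generic [set p | t p = fp_sum s p] >]].

Fact is_tensor_subring : subring_closed is_tensor.
Proof.
split=> [|t u /asboolP[s ts] /asboolP[r ur]|t u /asboolP[s ts] /asboolP[r ur]]; apply/asboolP.
- exists [:: (1, 1)]; apply: fp_genericT => p /=.
  by rewrite /fp_sum big_seq1 /= [RHS](_ : _ = 1 * 1) // mulr1.
- exists (s ++ [seq (- c.1, c.2) | c <- r]).
  apply: fp_genericS (fp_generic_and ts ur) => p /= [tp up].
  rewrite !fctE tp up /fp_sum big_cat big_map /= -sumrN; congr (_ + _).
  by apply: eq_bigr => c _; exact: (esym (mulNr _ _)).
- exists [seq (c.1 * d.1, c.2 * d.2) | c <- s, d <- r].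
  apply: fp_genericS (fp_generic_and ts ur) => p /= [tp up].
  rewrite !fctE tp up /fp_sum big_allpairs_dep mulr_suml; apply: eq_bigr => c _.
  rewrite mulr_sumr; apply: eq_bigr => d _; exact: mulrACA.
Qed.

Record pretensor := Pretensor { pretensor_fun :> S -> k; _ : pretensor_fun \in is_tensor }.
HB.instance Definition _ := [isSub for pretensor_fun].
HB.instance Definition _ := [Choice of pretensor by <:].
HB.instance Definition _ := GRing.SubChoice_isSubComPzRing.Build _ _ pretensor
  is_tensor_subring.

Fact pretensor_oner_neq0 : (1 : pretensor) != 0.
Proof.
have [p _] := fp_generic_ex (fp_genericT (P := setT) (fun _ => I)).
apply/eqP => /(congr1 (fun t : pretensor => t p)) /eqP.
by rewrite [X in X == _](_ : _ = 1 :> k) // oner_eq0.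
Qed.
HB.instance Definition _ := GRing.PzSemiRing_isNonZero.Build pretensor
  pretensor_oner_neq0.

Definition null_tensor (t : pretensor) : bool := `[< fp_generic [set p | t p = 0] >].

Fact null_tensor_ideal : idealr_closed null_tensor.
Proof.
split.
- by apply/asboolP; exact: fp_genericT.
- apply/asboolP => /fp_generic_ex[p /= /eqP].
  by rewrite [X in X == _](_ : _ = 1 :> k) // oner_eq0.
move=> a u v /asboolP u0 /asboolP v0; apply/asboolP.
apply: fp_genericS (fp_generic_and u0 v0) => p /= [up vp].
rewrite [LHS](_ : _ = (a : pretensor) p * (u : pretensor) p + (v : pretensor) p) //.
by rewrite up vp mulr0 addr0.
Qed.
Definition null_tensor_idealr : idealr pretensor :=
  HB.pack null_tensor (isIdealr.Build pretensor null_tensor null_tensor_ideal).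

Definition fp_tensor := {ideal_quot null_tensor_idealr}.
HB.instance Definition _ := GRing.ComNzRing.on fp_tensor.

Definition fp_class (t : pretensor) : fp_tensor := \pi t.

Fact fp_class_zmod : zmod_morphism fp_class.
Proof. exact: (rmorphB \pi_fp_tensor). Qed.
Fact fp_class_monoid : monoid_morphism fp_class.
Proof. by split; [exact: (rmorph1 \pi_fp_tensor)|exact: (rmorphM \pi_fp_tensor)]. Qed.
HB.instance Definition _ := GRing.isZmodMorphism.Build _ _ fp_class fp_class_zmod.
HB.instance Definition _ := GRing.isMonoidMorphism.Build _ _ fp_class fp_class_monoid.

Lemma fp_class_eqP (t u : pretensor) :
  fp_class t = fp_class u <-> fp_generic [set p | t p = u p].
Proof.
split=> [/eqP|tu].
  rewrite -Quotient.idealrBE => /asboolP; apply: fp_genericS => p h.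
  apply/eqP; rewrite -subr_eq0; apply/eqP; exact: h.
apply/eqP; rewrite -Quotient.idealrBE; apply/asboolP.
apply: fp_genericS tu => p tup; change (t p - u p = 0).
by rewrite [t p]tup subrr.
Qed.

Lemma fp_class_surj (u : fp_tensor) : exists t : pretensor, u = fp_class t.
Proof. by exists (repr u); rewrite /fp_class reprK. Qed.

Fact fp_tl_subproof (a : ratfun Y1) : (fun p : S => a (sval p).1) \in is_tensor.
Proof.
apply/asboolP; exists [:: (a, 1)]; apply: fp_genericT => p /=.
by rewrite /fp_sum big_seq1 /= [X in _ = _ * X](_ : _ = 1) ?mulr1.
Qed.
Fact fp_tr_subproof (a : ratfun Y2) : (fun p : S => a (sval p).2) \in is_tensor.
Proof.
apply/asboolP; exists [:: (1, a)]; apply: fp_genericT => p /=.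
by rewrite /fp_sum big_seq1 /= [X in _ = X * _](_ : _ = 1) ?mul1r.
Qed.
Definition fp_tl (a : ratfun Y1) : fp_tensor := fp_class (Pretensor (fp_tl_subproof a)).
Definition fp_tr (a : ratfun Y2) : fp_tensor := fp_class (Pretensor (fp_tr_subproof a)).

Fact fp_tl_zmod : zmod_morphism fp_tl.
Proof. by move=> a b; rewrite -rmorphB; congr fp_class; apply: val_inj. Qed.
Fact fp_tl_monoid : monoid_morphism fp_tl.
Proof.
split=> [|a b]; first by rewrite -(rmorph1 fp_class); congr fp_class; apply: val_inj.
by rewrite -rmorphM; congr fp_class; apply: val_inj.
Qed.
HB.instance Definition _ := GRing.isZmodMorphism.Build _ _ fp_tl fp_tl_zmod.
HB.instance Definition _ := GRing.isMonoidMorphism.Build _ _ fp_tl fp_tl_monoid.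
Fact fp_tr_zmod : zmod_morphism fp_tr.
Proof. by move=> a b; rewrite -rmorphB; congr fp_class; apply: val_inj. Qed.
Fact fp_tr_monoid : monoid_morphism fp_tr.
Proof.
split=> [|a b]; first by rewrite -(rmorph1 fp_class); congr fp_class; apply: val_inj.
by rewrite -rmorphM; congr fp_class; apply: val_inj.
Qed.
HB.instance Definition _ := GRing.isZmodMorphism.Build _ _ fp_tr fp_tr_zmod.
HB.instance Definition _ := GRing.isMonoidMorphism.Build _ _ fp_tr fp_tr_monoid.

Section Map.
Variable m : S -> S.
Hypotheses (mb : forall p, fp_base (m p) = fp_base p)
  (mt : forall t, t \in is_tensor -> t \o m \in is_tensor).

Definition pre_map (t : pretensor) : pretensor := Pretensor (mt (valP t)).
Definition fp_map (u : fp_tensor) : fp_tensor := fp_class (pre_map (repr u)).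

Lemma fp_mapE (t : pretensor) : fp_map (fp_class t) = fp_class (pre_map t).
Proof.
apply/fp_class_eqP; have /fp_class_eqP h := reprK (fp_class t).
exact: (fp_generic_map mb h).
Qed.

Fact fp_map_zmod : zmod_morphism fp_map.
Proof.
move=> u v; have [t ->] := fp_class_surj u; have [w ->] := fp_class_surj v.
by rewrite -rmorphB !fp_mapE -rmorphB; congr fp_class; apply: val_inj.
Qed.
Fact fp_map_monoid : monoid_morphism fp_map.
Proof.
split=> [|u v].
  by rewrite -(rmorph1 fp_class) fp_mapE; congr fp_class; apply: val_inj.
have [t ->] := fp_class_surj u; have [w ->] := fp_class_surj v.
by rewrite -rmorphM !fp_mapE -rmorphM; congr fp_class; apply: val_inj.
Qed.
Definition fp_map_morphism : {rmorphism fp_tensor -> fp_tensor} :=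
  HB.pack fp_map (GRing.isZmodMorphism.Build _ _ _ fp_map_zmod)
    (GRing.isMonoidMorphism.Build _ _ _ fp_map_monoid).

End Map.

Fact fp_act1_subproof g p : f1 (a1 g (sval p).1, (sval p).2).1 = f2 (a1 g (sval p).1, (sval p).2).2.
Proof. by rewrite /= (action_over gal1) (svalP p). Qed.
Definition fp_act1 g p : S := exist _ _ (fp_act1_subproof g p).
Fact fp_act2_subproof g p : f1 ((sval p).1, a2 g (sval p).2).1 = f2 ((sval p).1, a2 g (sval p).2).2.
Proof. by rewrite /= (action_over gal2) (svalP p). Qed.
Definition fp_act2 g p : S := exist _ _ (fp_act2_subproof g p).

Lemma fp_act1_base g p : fp_base (fp_act1 g p) = fp_base p.
Proof. exact: action_over gal1 _ _. Qed.
Lemma fp_act2_base g p : fp_base (fp_act2 g p) = fp_base p.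
Proof. by []. Qed.

Lemma fp_act1_tensor g t : t \in is_tensor -> t \o fp_act1 g \in is_tensor.
Proof.
move=> /asboolP[s ts]; apply/asboolP; exists [seq (ratfun_act a1 g c.1, c.2) | c <- s].
apply: fp_genericS (fp_generic_map (fp_act1_base g) ts) => p /= ->.
by rewrite /fp_sum big_map.
Qed.
Lemma fp_act2_tensor g t : t \in is_tensor -> t \o fp_act2 g \in is_tensor.
Proof.
move=> /asboolP[s ts]; apply/asboolP; exists [seq (c.1, ratfun_act a2 g c.2) | c <- s].
apply: fp_genericS (fp_generic_map (fp_act2_base g) ts) => p /= ->.
by rewrite /fp_sum big_map.
Qed.

Lemma tensor_ex : exists T : tensor gal1 gal2, True.
Proof.
pose gl g := fp_map_morphism (fp_act1_base g) (@fp_act1_tensor g).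
pose gr g := fp_map_morphism (fp_act2_base g) (@fp_act2_tensor g).
unshelve eexists (@Tensor _ _ _ _ _ _ _ _ gal1 _ _ gal2 fp_tensor fp_tl fp_tr gl gr
  _ _ _ _ _ _ _ _) => //.
- move=> a; rewrite -(rmorph0 fp_class) -(fp_generic1 [set y | a y = 0]).
  exact: fp_class_eqP.
- move=> a; rewrite -(rmorph0 fp_class) -(fp_generic2 [set y | a y = 0]).
  exact: fp_class_eqP.
- move=> c; apply/fp_class_eqP; apply: fp_genericT => p /=.
  by rewrite (svalP p).
- move=> u; have [t ->] := fp_class_surj u; have /asboolP[s ts] := valP t; exists s.
  pose w : pretensor := \sum_(c <- s) Pretensor (fp_tl_subproof c.1) * Pretensor (fp_tr_subproof c.2).
  have wE p : w p = fp_sum s p.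
    rewrite /w /fp_sum; elim: (s) => [|c r IHr]; first by rewrite !big_nil.
    by rewrite !big_cons -IHr.
  transitivity (fp_class w).
    by apply/fp_class_eqP; apply: fp_genericS ts => p /= ->; rewrite wE.
  by rewrite rmorph_sum; apply: eq_bigr => c _; rewrite rmorphM.
- move=> g a; rewrite /= fp_mapE; last exact: fp_act1_base.
  by congr fp_class; apply: val_inj.
- move=> g a; rewrite /= fp_mapE; last exact: fp_act1_base.
  by congr fp_class; apply: val_inj.
- move=> g a; rewrite /= fp_mapE; last exact: fp_act2_base.
  by congr fp_class; apply: val_inj.
- move=> g a; rewrite /= fp_mapE; last exact: fp_act2_base.
  by congr fp_class; apply: val_inj.
Qed.

End FibreProduct.

(** * Dual families and orbit polynomials for a finite group acting on a ring *)

Section GaloisSystem.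
Variables (A : comNzRingType) (G : finGroupType) (act : G -> {rmorphism A -> A}).
Hypothesis act_id : forall u, act 1%g u = u.

(* If b - g b has inverse w, the pairs (w, b) and (- w (g b), 1) satisfy
   sum x z = 1 and sum x (g z) = 0; multiply these over all g. *)
Lemma galois_system (P : A -> Prop) : P 1 -> (forall u v, P u -> P v -> P (u - v)) ->
    (forall u v, P u -> P v -> P (u * v)) -> (forall g u, P u -> P (act g u)) ->
    (forall g, g != 1%g -> exists b w, [/\ P b, P w & (b - act g b) * w = 1]) ->
  exists (I : finType) (u v : I -> A), [/\ forall i, P (u i), forall i, P (v i) &
    forall g, \sum_i u i * act g (v i) = (g == 1%g)%:R].
Proof.
move=> P1 PB PM Pact sep.
have P0 : P 0 by rewrite -(subrr 1); exact: PB.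
have pair g : exists x z : bool -> A, [/\ forall e, P (x e), forall e, P (z e),
    \sum_e x e * z e = 1 & g != 1%g -> \sum_e x e * act g (z e) = 0].
  have [->|g1] := eqVneq g 1%g.
    exists (fun e => e%:R), (fun e => e%:R); split=> [[]|[]||//] //.
    by rewrite big_bool /= mulr1 mulr0 addr0.
  have [b [w [Pb Pw bw]]] := sep g g1.
  exists (fun e => if e then w else - (w * act g b)), (fun e => if e then b else 1).
  have Pgb : P (w * act g b) by apply/PM/Pact.
  split=> [[]|[]||_] //; first by rewrite -sub0r; exact: PB.
    by rewrite big_bool /= mulr1 -mulrBr mulrC.
  by rewrite big_bool /= rmorph1 mulr1 subrr.
pose x g := sval (cid (pair g)); pose z g := sval (cid (svalP (cid (pair g)))).
have xz g : [/\ forall e, P (x g e), forall e, P (z g e),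
    \sum_e x g e * z g e = 1 & g != 1%g -> \sum_e x g e * act g (z g e) = 0].
  exact: (svalP (cid (svalP (cid (pair g))))).
have Pprod (F : G -> A) : (forall g, P (F g)) -> P (\prod_g F g).
  by move=> PF; apply: (@big_ind _ P) => //; exact: PF.
(* Expanding the product over [g] of two-term sums indexes the family by choice functions from [G]
   to [bool]; for [h] different from 1 the factor belonging to [h] vanishes. *)
exists {ffun G -> bool}, (fun i : {ffun G -> bool} => \prod_g x g (i g)),
  (fun i : {ffun G -> bool} => \prod_g z g (i g)).
split=> [i|i|h]; [by apply: Pprod => g; have [] := xz g|by apply: Pprod => g; have [] := xz g|].
under eq_bigr do rewrite rmorph_prod -big_split /=.
rewrite -(bigA_distr_bigA (fun g e => x g e * act h (z g e))) /=.
have [->|h1] := eqVneq h 1%g.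
  by apply: big1 => g _; have [_ _ e _] := xz g; rewrite -[RHS]e; apply: eq_bigr => c _; rewrite act_id.
by rewrite (bigD1 h) //=; have [_ _ _ ->] := xz h; rewrite ?mul0r.
Qed.

Hypothesis act_comp : forall g h u, act h (act g u) = act (g * h)%g u.

(** The orbit polynomial of [u]. Its coefficients are invariant, hence lie in a smaller function
    field, and inherit every property that is stable under ring operations and conjugation; this
    transfers integrality between [T] and the curves. *)
Definition norm_poly (u : A) : {poly A} := \prod_g ('X - (act g u)%:P).

Lemma norm_poly_monic u : norm_poly u \is monic.
Proof. by apply: monic_prod => g _; exact: monicXsubC. Qed.

Lemma norm_poly_root u : root (norm_poly u) u.
Proof.
rewrite /root /norm_poly horner_prod (bigD1 1%g) //= act_id.
by rewrite hornerXsubC subrr mul0r.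
Qed.

Lemma norm_poly_fixed u h i : act h (norm_poly u)`_i = (norm_poly u)`_i.
Proof.
rewrite -coef_map; congr (_`_i); rewrite /norm_poly rmorph_prod /=.
rewrite (reindex_inj (mulIg h^-1%g)) /=.
by under eq_bigr do rewrite rmorphB /= map_polyX map_polyC /= act_comp mulgKV.
Qed.

Lemma act_prod_fixed u h : act h (\prod_g act g u) = \prod_g act g u.
Proof.
rewrite rmorph_prod (reindex_inj (mulIg h^-1%g)) /=; apply: eq_bigr => g _.
by rewrite act_comp mulgKV.
Qed.

Lemma act_sum_fixed u h : act h (\sum_g act g u) = \sum_g act g u.
Proof.
rewrite rmorph_sum (reindex_inj (mulIg h^-1%g)) /=; apply: eq_bigr => g _.
by rewrite act_comp mulgKV.
Qed.

End GaloisSystem.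

Lemma coef_prodXsub (A : comNzRingType) (P : A -> Prop) (I : Type) (r : seq I) (u : I -> A) :
  P 1 -> (forall u v, P u -> P v -> P (u - v)) -> (forall u v, P u -> P v -> P (u * v)) ->
  (forall i, P (u i)) -> forall j, P (\prod_(i <- r) ('X - (u i)%:P))`_j.
Proof.
move=> P1 PB PM Pu; have P0 : P 0 by rewrite -(subrr 1); exact: PB.
elim: r => [|i r IHr] j; first by rewrite big_nil coef1; case: (j == 0%N).
rewrite big_cons mulrBl coefB coefXM coefCM; apply: PB; last exact: PM.
by case: ifP.
Qed.

Lemma monic_horner_coef (A : comNzRingType) (p : {poly A}) u : p \is monic ->
  p.[u] = u ^+ (size p).-1 + \sum_(i < (size p).-1) p`_i * u ^+ i.
Proof.
move=> mp; have p0 : (0 < size p)%N by rewrite size_poly_gt0 monic_neq0.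
rewrite horner_coef; have := monicP mp; rewrite lead_coefE.
case: (size p) p0 => // n _ /= pn.
by rewrite big_ord_recr /= addrC pn mul1r.
Qed.

(** * Units and poles at a point *)

Section GermRatfun.
Variables (k : closedFieldType) (Y : curve k) (y : Y).

Fact germ_ratfun_subproof (a : pregerm y) : (a : Y -> k) \in @is_rational k Y.
Proof. apply/asboolP; exact: regular_rational (pregerm_regular a). Qed.
Definition germ_ratfun (a : pregerm y) : ratfun Y := Ratfun (germ_ratfun_subproof a).
Fact germ_ratfun_zmod : zmod_morphism germ_ratfun.
Proof. by move=> a b; apply: val_inj. Qed.
Fact germ_ratfun_monoid : monoid_morphism germ_ratfun.
Proof. by split=> [|a b]; apply: val_inj. Qed.
HB.instance Definition _ := GRing.isZmodMorphism.Build _ _ germ_ratfun germ_ratfun_zmod.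
HB.instance Definition _ := GRing.isMonoidMorphism.Build _ _ germ_ratfun germ_ratfun_monoid.

Definition runit (f : Y -> k) : Prop :=
  exists g, [/\ regular_at y g, g y != 0 & generically [set z | f z = g z]].

Definition ratfun_inv (a : ratfun Y) : ratfun Y :=
  Ratfun (asboolT (rationalV (ratfun_rational a)) : (fun z => (a z)^-1) \in @is_rational k Y).

Lemma ratfun_cst_subproof (c : k) : cst c \in @is_rational k Y.
Proof. apply/asboolP; exact: rational_cst. Qed.
Definition ratfun_cst (c : k) : ratfun Y := Ratfun (ratfun_cst_subproof c).

Lemma rint_germ f : rint y f <-> exists a : pregerm y, generically [set z | f z = a z].
Proof.
split=> [[g /regular_stalk[a <-] fa]|[a fa]]; first by exists a.
by exists a => //; exact: pregerm_regular.
Qed.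

Lemma runit_inv (a : ratfun Y) : runit a -> runit (ratfun_inv a).
Proof.
move=> [g [rg gy ag]]; exists (fun z => (g z)^-1); split; [exact: regularV|by rewrite invr_eq0|].
by apply: filterS ag => z /= ->.
Qed.

Lemma runit_rint f : runit f -> rint y f.
Proof. by move=> [g [rg _ fg]]; exists g. Qed.

Lemma runit_neq0 f : runit f -> generically [set z | f z != 0].
Proof.
move=> [g [rg gy fg]]; apply: filterS2 fg (near_generically (regular_neq0 gy rg)).
by move=> z /= ->.
Qed.

Lemma runitM f g : runit f -> runit g -> runit (f * g).
Proof.
move=> [f' [rf fy ef]] [g' [rg gy eg]]; exists (f' * g'); split; first exact: regularM.
  exact: mulf_neq0.
by apply: filterS2 ef eg => z /= e1 e2; rewrite !fctE e1 e2.
Qed.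

(** [s] is a multiple of the uniformizer near [y], and [n] is the order of vanishing of a
    denominator of [c]. *)
Lemma rint_pole (s : Y -> k) c : rational c -> regular_at y s -> s y = 0 ->
  exists n, forall m, (n <= m)%N -> rint y ((fun z => s z ^+ m) * c).
Proof.
move=> rc /regular_stalk[s' <-] sy; have [t ut] := uniformizer_ex y.
have [w sw] : exists w : pregerm y, \forall z \near y, s' z = t z * w z.
  have [nt _ tP] := ut; have /tP[w] : nonunit (germ s') by exact/nonunit_stalkP.
  by rewrite -[w]germ_repr -germM => /germ_eqP; exists (repr w).
have [a [b [ra rb ab]]] := rational_frac y rc.
have [b0|[n [v [rv vy be]]]] := uniformizer_factor ut rb.
  have [z /= [[bz _] bz0]] := generically_ex0 (generically_and ab (near_generically b0)).
  by rewrite bz0 eqxx in bz.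
exists n => m nm.
have rX (u : pregerm y) i : regular_at y (fun z => u z ^+ i).
  by have [d _ dE] := germX u i; apply: regular_eq (pregerm_regular d); exact: nearW.
exists ((fun z => t z ^+ (m - n)) * ((fun z => w z ^+ m) * (a * (fun z => (v z)^-1)))).
  by do !apply: regularM => //; exact: regularV.
have h := generically_and (near_generically be) (near_generically sw).
have tn := punctured_generically (uniformizer_neq0 ut).
apply: filterS3 h ab (generically_and (near_generically (regular_neq0 vy rv)) tn).
move=> z /= [bz sz] [_ cb] [vz tz]; rewrite !fctE sz -cb bz exprMn -{1}(subnK nm) exprD.
by field; rewrite vz.
Qed.

End GermRatfun.

(** * Galois descent in the tensor product, and maps out of it *)

Section TensorTheory.
Variables (k : closedFieldType) (X Y1 Y2 : curve k) (G1 G2 : finGroupType).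
Variables (a1 : group_action G1 Y1) (f1 : mor Y1 X) (gal1 : galois_covering a1 f1).
Variables (a2 : group_action G2 Y2) (f2 : mor Y2 X) (gal2 : galois_covering a2 f2).
Variable T : tensor gal1 gal2.
Implicit Types (u v : T) (g h : G1).
Local Notation pull1 := (ratfun_pull (action_cover gal1)).
Local Notation pull2 := (ratfun_pull (action_cover gal2)).

Lemma tensor_ext (A : comNzRingType) (phi psi : {rmorphism T -> A}) :
  (forall a, phi (tl T a) = psi (tl T a)) -> (forall a, phi (tr T a) = psi (tr T a)) ->
  phi =1 psi.
Proof.
move=> hl hr u; have [s ->] := tensor_span u; rewrite !rmorph_sum.
by apply: eq_bigr => c _; rewrite !rmorphM hl hr.
Qed.

Lemma tl_eq a b : tl T a = tl T b <-> generically [set y | a y = b y].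
Proof.
have -> : (tl T a = tl T b) <-> tl T (a - b) = 0.
  by rewrite rmorphB; split=> [->|/eqP]; [rewrite subrr|rewrite subr_eq0 => /eqP].
rewrite tl_eq0; split; apply: filterS => y h.
  by apply/eqP; rewrite -subr_eq0; apply/eqP; exact: h.
by change (a y - b y = 0); rewrite [a y]h subrr.
Qed.

Lemma ratfun_act_comp (G : finGroupType) (Y : curve k) (a : group_action G Y) (g h : G) s :
  ratfun_act a h (ratfun_act a g s) = ratfun_act a (g * h)%g s.
Proof. by apply: val_inj; apply/funext => y /=; rewrite actM. Qed.

Lemma ratfun_act1 (G : finGroupType) (Y : curve k) (a : group_action G Y) s :
  ratfun_act a 1%g s = s.
Proof. by apply: val_inj; apply/funext => y /=; rewrite act1. Qed.

Lemma gl_comp g h u : gl T h (gl T g u) = gl T (g * h)%g u.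
Proof.
apply: (tensor_ext (phi := gl T h \o gl T g) (psi := gl T (g * h)%g)) => a /=.
  by rewrite !gl_tl ratfun_act_comp.
by rewrite !gl_tr.
Qed.

Lemma gl_id u : gl T 1%g u = u.
Proof.
apply: (tensor_ext (phi := gl T 1%g) (psi := idfun)) => a /=.
  by rewrite gl_tl ratfun_act1.
by rewrite gl_tr.
Qed.

Lemma gl_gr g (h : G2) u : gl T g (gr T h u) = gr T h (gl T g u).
Proof.
apply: (tensor_ext (phi := gl T g \o gr T h) (psi := gr T h \o gl T g)) => a /=.
  by rewrite gl_tl !gr_tl gl_tl.
by rewrite gl_tr !gr_tr gl_tr.
Qed.

Lemma pull_act1 g r : ratfun_act a1 g (pull1 r) = pull1 r.
Proof. by apply: val_inj; apply/funext => y /=; rewrite (action_over gal1). Qed.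

Lemma fixed_base a : (forall g, gl T g (tl T a) = tl T a) -> exists r, tl T a = tr T (pull2 r).
Proof.
move=> ha; have [|r rr e] := galois_descend gal1 (ratfun_rational a).
  by move=> g; have := ha g; rewrite gl_tl => /tl_eq.
have [r' rE] := rational_ratfun rr; exists r'; rewrite -tlr; apply/tl_eq.
by apply: filterS e => y /= ->; rewrite rE.
Qed.

Lemma trace_base a : exists r, \sum_g gl T g (tl T a) = tr T (pull2 r).
Proof.
have [r rE] : exists r, tl T (\sum_g ratfun_act a1 g a) = tr T (pull2 r).
  apply: fixed_base => h; rewrite rmorph_sum /=.
  under eq_bigr do rewrite -gl_tl.
  exact: (act_sum_fixed gl_comp).
by exists r; rewrite -rE rmorph_sum; apply: eq_bigr => g _; rewrite gl_tl.
Qed.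

Lemma ratfun_inv_mul (Y : curve k) (a : ratfun Y) : generically [set y | a y != 0] ->
  generically [set y | (a * ratfun_inv a) y = (1 : ratfun Y) y].
Proof. by apply: filterS => y ay; exact: mulfV. Qed.

Lemma tl_inv (a : ratfun Y1) : generically [set y | a y != 0] -> tl T a * tl T (ratfun_inv a) = 1.
Proof.
by move=> /ratfun_inv_mul a0; rewrite -rmorphM -(rmorph1 (tl T)); apply/tl_eq.
Qed.

(** In the image of [k(Y1)] every generically nonzero function is invertible, so the separation
    required by [galois_system] is provided by [galois_faithful]. No integrality is asked for at
    this stage. *)
Lemma generic_system : exists (I : finType) (u v : I -> ratfun Y1),
  forall g, \sum_i tl T (u i) * gl T g (tl T (v i)) = (g == 1%g)%:R.
Proof.
pose P u := exists a, u = tl T a.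
have [|u v [a ->] [b ->]|u v [a ->] [b ->]|g u [a ->]|g g1|I [u [v [Pu Pv e]]]] :=
  @galois_system T G1 (gl T) gl_id P.
- by exists 1; rewrite rmorph1.
- by exists (a - b); rewrite rmorphB.
- by exists (a * b); rewrite rmorphM.
- by exists (ratfun_act a1 g a); rewrite gl_tl.
- have [s rs sg] := galois_faithful gal1 g1; have [b bE] := rational_ratfun rs.
  exists (tl T b), (tl T (ratfun_inv (b - ratfun_act a1 g b))); split; [by exists b|by eexists|].
  rewrite gl_tl -rmorphB; apply: tl_inv; apply: filterS sg => y sy.
  by change (b y - b (a1 g y) != 0); rewrite bE subr_eq0 eq_sym.
pose u' i := sval (cid (Pu i)); pose v' i := sval (cid (Pv i)).
exists I, u', v' => g; rewrite -e; apply: eq_bigr => i _.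
by rewrite -(svalP (cid (Pu i))) -(svalP (cid (Pv i))).
Qed.

Lemma system_trace (I : finType) (u v : I -> T) :
  (forall g, \sum_i u i * gl T g (v i) = (g == 1%g)%:R) ->
  \sum_i u i * \sum_g gl T g (v i) = 1.
Proof.
move=> e; under eq_bigr do rewrite mulr_sumr.
rewrite exchange_big (bigD1 1%g) //= e eqxx big1 ?addr0 // => g /negPf g1.
by rewrite e g1.
Qed.

(** By [system_trace] some trace of a [v i] is nonzero; it lies in [k(X)], and dividing [v i] by it
    normalises the trace to 1. *)
Lemma generic_trace : exists c, \sum_g gl T g (tl T c) = 1.
Proof.
have [I [u [v e]]] := generic_system; have := system_trace e => e1.
pose r i := sval (cid (trace_base (v i))).
have rE i : \sum_g gl T g (tl T (v i)) = tr T (pull2 (r i)) by exact: svalP (cid (trace_base (v i))).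
have [i ri] : exists i, ~ generically [set x | r i x = 0].
  apply: contrapT => h; have /eqP := e1; rewrite big1 ?[0 == _]eq_sym ?oner_eq0 // => i _.
  rewrite rE (_ : tr T _ = 0) ?mulr0 //; apply/tr_eq0.
  have : generically [set x | r i x = 0] by apply: contrapT => hi; apply: h; exists i.
  by move=> /(cover_dominant (action_cover gal2)).
have /(ratfun_inv_mul (a := r i)) ri' := rational_neq0 (ratfun_rational (r i)) ri.
exists (v i * pull1 (ratfun_inv (r i))); transitivity (tr T (pull2 (r i)) * tr T (pull2 (ratfun_inv (r i)))).
  rewrite -rE mulr_suml; apply: eq_bigr => g _.
  by rewrite rmorphM rmorphM [gl T g (tl T (pull1 _))]gl_tl pull_act1 tlr.
rewrite -!rmorphM -(rmorph1 (tr T)) -(rmorph1 pull2) -!tlr; apply/tl_eq.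
by have := cover_dominant (action_cover gal1) ri'; apply: filterS => y h; exact: h.
Qed.

(** If [c] has trace 1, an invariant [u] is the trace of [c * u]. Expanding [u] in pure tensors
    leaves only traces of elements of [k(Y1)], and these lie in [k(X)]. *)
Lemma gl_fixed u : (forall g, gl T g u = u) -> exists b, u = tr T b.
Proof.
move=> hu; have [c tc] := generic_trace; have [s us] := tensor_span u.
pose r a := sval (cid (trace_base (c * a))).
have rE a : \sum_g gl T g (tl T (c * a)) = tr T (pull2 (r a)) by exact: svalP (cid (trace_base (c * a))).
exists (\sum_(d <- s) pull2 (r d.1) * d.2).
transitivity (\sum_g gl T g (tl T c * u)).
  by under eq_bigr do rewrite rmorphM hu; rewrite -mulr_suml tc mul1r.
have -> : tl T c * u = \sum_(d <- s) tl T (c * d.1) * tr T d.2.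
  by rewrite {1}us mulr_sumr; apply: eq_bigr => d _; rewrite rmorphM mulrA.
rewrite rmorph_sum (eq_bigr (fun g => \sum_(d <- s) gl T g (tl T (c * d.1)) * tr T d.2)).
  rewrite exchange_big; apply: eq_bigr => d _.
  by rewrite [in RHS]rmorphM -rE mulr_suml.
by move=> g _; rewrite rmorph_sum; apply: eq_bigr => d _; rewrite rmorphM gl_tr.
Qed.

(** The universal property is not a field of [tensor]; it is recovered from a dual family.
    Multiplying a relation by [v i] and taking traces gives relations with coefficients in [k(X)],
    which hold in [k(Y2)] and survive [j]. The expansion of [a] by the traces of the [v i * a]
    recombines them. *)
Lemma tensor_eval (F : fieldType) (th : {rmorphism ratfun Y1 -> F})
    (j : {rmorphism ratfun Y2 -> F}) :
  (forall a : ratfun Y1, generically [set y | a y = 0] -> th a = 0) ->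
  (forall b : ratfun Y2, generically [set y | b y = 0] -> j b = 0) ->
  (forall r, th (pull1 r) = j (pull2 r)) ->
  exists ev : {rmorphism T -> F}, (forall a, ev (tl T a) = th a) /\ (forall b, ev (tr T b) = j b).
Proof.
move=> th0 j0 thj; have [I [u [v e]]] := generic_system.
have the a b : tl T a = tl T b -> th a = th b.
  move=> ab; apply/eqP; rewrite -subr_eq0 -rmorphB; apply/eqP/th0/(tl_eq0 T).
  by rewrite rmorphB ab subrr.
pose val s := \sum_(c <- s) th c.1 * j c.2.
pose cls s := \sum_(c <- s) tl T c.1 * tr T c.2.
have val0 s : cls s = 0 -> val s = 0.
  move=> s0.
  have hi i : \sum_(c <- s) th (\sum_g ratfun_act a1 g (v i * c.1)) * j c.2 = 0.
    pose r a := sval (cid (trace_base (v i * a))).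
    have rE a : \sum_g gl T g (tl T (v i * a)) = tr T (pull2 (r a)).
      exact: svalP (cid (trace_base (v i * a))).
    have thr a : th (\sum_g ratfun_act a1 g (v i * a)) = j (pull2 (r a)).
      rewrite -thj; apply: the; rewrite tlr -rE rmorph_sum.
      by apply: eq_bigr => g _; rewrite gl_tl.
    under eq_bigr do rewrite thr -rmorphM.
    rewrite -rmorph_sum; apply/j0/(tr_eq0 T); rewrite rmorph_sum.
    have : \sum_g gl T g (tl T (v i) * cls s) = 0.
      by rewrite s0 mulr0 big1 // => g _; rewrite rmorph0.
    have -> : tl T (v i) * cls s = \sum_(d <- s) tl T (v i * d.1) * tr T d.2.
      by rewrite mulr_sumr; apply: eq_bigr => d _; rewrite rmorphM mulrA.
    move=> h; rewrite -[RHS]h.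
    rewrite [RHS](eq_bigr (fun g => \sum_(d <- s) gl T g (tl T (v i * d.1)) * tr T d.2)).
      rewrite [RHS]exchange_big; apply: eq_bigr => d _.
      by rewrite [in LHS]rmorphM -rE mulr_suml.
    by move=> g _; rewrite rmorph_sum; apply: eq_bigr => d _; rewrite rmorphM gl_tr.
  have exp a : th a = \sum_i th (u i) * th (\sum_g ratfun_act a1 g (v i * a)).
    under eq_bigr do rewrite -rmorphM.
    rewrite -rmorph_sum; apply: the; rewrite rmorph_sum.
    transitivity (\sum_g (g == 1%g)%:R * gl T g (tl T a)).
      by rewrite (bigD1 1%g) //= gl_id eqxx mul1r big1 ?addr0 // => g /negPf ->; rewrite mul0r.
    under eq_bigr do rewrite -e mulr_suml.
    rewrite exchange_big; apply: eq_bigr => i _; rewrite rmorphM rmorph_sum mulr_sumr.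
    by apply: eq_bigr => g _; rewrite -gl_tl !rmorphM mulrA.
  rewrite /val; under eq_bigr do rewrite exp mulr_suml.
  rewrite exchange_big big1 // => i _; have := congr1 ( *%R (th (u i))) (hi i).
  rewrite mulr0 mulr_sumr => h; rewrite -[RHS]h; apply: eq_bigr => c _; by rewrite mulrA.
have valE s s' : cls s = cls s' -> val s = val s'.
  move=> ss; apply/eqP; rewrite -subr_eq0; apply/eqP.
  have := val0 (s ++ [seq (- c.1, c.2) | c <- s']).
  rewrite /cls /val !big_cat !big_map /=.
  have -> : \sum_(c <- s') tl T (- c.1) * tr T c.2 = - cls s'.
    by rewrite -sumrN; apply: eq_bigr => c _; rewrite rmorphN mulNr.
  have -> : \sum_(c <- s') th (- c.1) * j c.2 = - val s'.
    by rewrite -sumrN; apply: eq_bigr => c _; rewrite rmorphN mulNr.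
  by apply; rewrite -/(cls s) ss subrr.
pose ev (w : T) := val (sval (cid (tensor_span w))).
have evE s : ev (cls s) = val s.
  by apply: valE; exact: esym (svalP (cid (tensor_span (cls s)))).
have ev_zmod : zmod_morphism ev.
  move=> w w'; have [s ->] := tensor_span w; have [s' ->] := tensor_span w'.
  rewrite -/(cls s) -/(cls s') !evE.
  have -> : cls s - cls s' = cls (s ++ [seq (- c.1, c.2) | c <- s']).
    rewrite /cls big_cat big_map -sumrN; congr (_ + _).
    by apply: eq_bigr => c _; rewrite rmorphN mulNr.
  rewrite evE /val big_cat big_map -sumrN; congr (_ + _).
  by apply: eq_bigr => c _; rewrite rmorphN mulNr.
have ev_monoid : monoid_morphism ev.
  split=> [|w w'].
    have -> : (1 : T) = cls [:: (1, 1)] by rewrite /cls big_seq1 /= !rmorph1 mulr1.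
    by rewrite evE /val big_seq1 /= !rmorph1 mulr1.
  have [s ->] := tensor_span w; have [s' ->] := tensor_span w'.
  rewrite -/(cls s) -/(cls s') !evE.
  have -> : cls s * cls s' = cls [seq (c.1 * d.1, c.2 * d.2) | c <- s, d <- s'].
    rewrite /cls big_allpairs_dep mulr_suml; apply: eq_bigr => c _.
    by rewrite mulr_sumr; apply: eq_bigr => d _; rewrite !rmorphM /= mulrACA.
  rewrite evE /val big_allpairs_dep mulr_suml; apply: eq_bigr => c _.
  by rewrite mulr_sumr; apply: eq_bigr => d _; rewrite !rmorphM /= mulrACA.
pose evm : {rmorphism T -> F} := HB.pack ev (GRing.isZmodMorphism.Build _ _ _ ev_zmod)
  (GRing.isMonoidMorphism.Build _ _ _ ev_monoid).
exists evm; split=> [a|b] /=.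
  have -> : tl T a = cls [:: (a, 1)] by rewrite /cls big_seq1 /= rmorph1 mulr1.
  by rewrite evE /val big_seq1 /= rmorph1 mulr1.
have -> : tr T b = cls [:: (1, b)] by rewrite /cls big_seq1 /= rmorph1 mul1r.
by rewrite evE /val big_seq1 /= rmorph1 mul1r.
Qed.

End TensorTheory.

(** Scaling the root by [d] multiplies every coefficient below the leading one by a positive power
    of [d]; this is what clears poles later. *)
Lemma monic_scale_root (A : comNzRingType) (p : {poly A}) (u d : A) : p \is monic -> root p u ->
  exists q : {poly A}, [/\ q \is monic, root q (d * u) & forall i, exists m,
    q`_i = d ^+ m.+1 * p`_i \/ q`_i = 1 \/ q`_i = 0].
Proof.
move=> mp /rootP; rewrite monic_horner_coef //; set n := (size p).-1 => e.
pose r := \poly_(i < n) (d ^+ (n - i) * p`_i).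
have sr : (size r < size ('X^n : {poly A}))%N by rewrite size_polyXn ltnS size_poly.
have mq : 'X^n + r \is monic by rewrite monicE lead_coefDl // lead_coefXn.
exists ('X^n + r); split=> // [|i].
  rewrite /root hornerD hornerXn horner_poly; apply/eqP.
  transitivity (d ^+ n * (u ^+ n + \sum_(i < n) p`_i * u ^+ i)); last by rewrite e mulr0.
  rewrite mulrDr exprMn mulr_sumr; congr (_ + _); apply: eq_bigr => i _.
  rewrite -[in d ^+ n](subnK (ltnW (ltn_ord i))) exprD exprMn; ring.
exists (n - i).-1; rewrite coefD coefXn coef_poly.
case: (ltngtP i n) => [lt|gt|->].
- by left; rewrite add0r prednK ?subn_gt0.
- by right; right; rewrite addr0.
- by right; left; rewrite addr0.
Qed.

Section RatfunAt.
Variables (k : closedFieldType) (Y : curve k) (y : Y).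
Definition ratfun_at (a : ratfun Y) : k := a y.
Fact ratfun_at_zmod : zmod_morphism ratfun_at. Proof. by []. Qed.
Fact ratfun_at_monoid : monoid_morphism ratfun_at. Proof. by []. Qed.
HB.instance Definition _ := GRing.isZmodMorphism.Build _ _ ratfun_at ratfun_at_zmod.
HB.instance Definition _ := GRing.isMonoidMorphism.Build _ _ ratfun_at ratfun_at_monoid.
End RatfunAt.

(** * Integral elements of the tensor product over local rings *)

Section Integrality.
Variables (k : closedFieldType) (X Y1 Y2 : curve k) (G1 G2 : finGroupType).
Variables (a1 : group_action G1 Y1) (f1 : mor Y1 X) (gal1 : galois_covering a1 f1).
Variables (a2 : group_action G2 Y2) (f2 : mor Y2 X) (gal2 : galois_covering a2 f2).
Variable T : tensor gal1 gal2.
Implicit Types (u v : T) (g h : G1) (x : X) (y : Y2) (b : ratfun Y2).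
Local Notation pull1 := (ratfun_pull (action_cover gal1)).
Local Notation pull2 := (ratfun_pull (action_cover gal2)).

Definition point_map y : {rmorphism pregerm y -> T} := tr T \o @germ_ratfun k Y2 y.
Definition base_map x : {rmorphism pregerm x -> T} := tr T \o (pull2 \o @germ_ratfun k X x).

(** [pint] tests one point of [Y2], whereas [bint] works over the local ring of the base point and
    thus involves its whole fibre. The latter is symmetric in the two curves, by [bint_swap]. *)
Definition pint y u : Prop := integralOver (point_map y) u.
Definition bint x u : Prop := integralOver (base_map x) u.

Lemma tr_eq b b' : tr T b = tr T b' <-> generically [set y | b y = b' y].
Proof. exact: (tl_eq (tensor_swap T)). Qed.

Lemma pint_tr y b : rint y b -> pint y (tr T b).
Proof.
move=> /rint_germ[a ba]; have -> : tr T b = point_map y a by apply/tr_eq.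
exact: integral_id.
Qed.

(** The equation lives in the image of [k(Y2)], hence holds generically on [Y2], where the local
    ring is integrally closed. *)
Lemma pint_tr_rint y b : pint y (tr T b) -> rint y b.
Proof.
move=> [p mp]; rewrite /root map_poly_comp horner_map => /eqP/tr_eq0.
set q := map_poly _ p => q0; have mq : q \is monic by exact: monic_map.
apply: (@rint_integral _ _ y b (size q).-1 (fun i => q`_i)); first exact: ratfun_rational.
  by move=> i; rewrite coef_map; apply: rint_regular; exact: pregerm_regular.
apply: filterS q0 => z; rewrite /= monic_horner_coef // -[LHS]/(ratfun_at z _).
rewrite rmorphD rmorphXn rmorph_sum => h; rewrite -[RHS]h; congr (_ + _).
by apply: eq_bigr => i _; rewrite rmorphM rmorphXn.
Qed.

Lemma integral_coef (R A : comNzRingType) (phi : {rmorphism R -> A}) (p : {poly A}) w :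
  p \is monic -> root p w -> (forall i, integralOver phi p`_i) -> integralOver phi w.
Proof.
move=> mp pw hp; apply: integral_root_monic mp pw _ => c /(nthP 0)[i _ <-]; exact: hp.
Qed.

Lemma pint_gl y g u : pint y u -> pint y (gl T g u).
Proof.
move=> [p mp pu]; exists p => //; have := rmorph_root (gl T g) pu.
rewrite -map_poly_comp; apply: etrans; congr root; apply: eq_map_poly => c /=.
by rewrite gl_tr.
Qed.

Lemma bint_gl x g u : bint x u -> bint x (gl T g u).
Proof.
move=> [p mp pu]; exists p => //; have := rmorph_root (gl T g) pu.
rewrite -map_poly_comp; apply: etrans; congr root; apply: eq_map_poly => c /=.
by rewrite gl_tr.
Qed.

Lemma bint_pint x y u : f2 y = x -> bint x u -> pint y u.
Proof.
move=> <- [p mp pu]; apply: integral_coef (monic_map _ mp) pu _ => i.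
rewrite coef_map; apply/pint_tr/(rint_pull (action_cover gal2) (y := y))/rint_regular.
exact: pregerm_regular.
Qed.

Lemma bint_base x r : rint x r -> forall r' : ratfun X, generically [set z | r' z = r z] ->
  bint x (tr T (pull2 r')).
Proof.
move=> /rint_germ[a ra] r' r'r.
have -> : tr T (pull2 r') = base_map x a.
  have e : generically [set z | r' z = a z] by apply: filterS2 r'r ra => z /= -> ->.
  by apply/tr_eq; have := cover_dominant (action_cover gal2) e.
exact: integral_id.
Qed.

(** The orbit polynomial under the second group has coefficients that are regular along the fibre
    and invariant. They come from [k(X)] and are regular at [x] by [rint_descend]. *)
Lemma bint_tr x b : (forall y, f2 y = x -> rint y b) -> bint x (tr T b).
Proof.
move=> hb; have gcomp := @gl_comp _ _ _ _ _ _ _ _ _ _ _ _ (tensor_swap T).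
have gid := @gl_id _ _ _ _ _ _ _ _ _ _ _ _ (tensor_swap T).
pose p := norm_poly (gr T) (tr T b).
apply: (@integral_coef _ _ _ p); [exact: norm_poly_monic|exact: norm_poly_root gid _|move=> i].
have [c [cE rc]] : exists c, p`_i = tr T c /\ forall y, f2 y = x -> rint y c.
  apply: (@coef_prodXsub T (fun w => exists c, w = tr T c /\ forall y, f2 y = x -> rint y c)).
  - by exists 1; rewrite rmorph1; split=> // y _; exact: rint_cst.
  - move=> _ _ [c [-> hc]] [d [-> hd]]; exists (c - d); rewrite rmorphB; split=> // y yx.
    by apply: rintB; [exact: hc|exact: hd].
  - move=> _ _ [c [-> hc]] [d [-> hd]]; exists (c * d); rewrite rmorphM; split=> // y yx.
    by apply: rintM; [exact: hc|exact: hd].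
  - move=> h; exists (ratfun_act a2 h b); rewrite gr_tr; split=> // y yx.
    by apply: rint_act; apply: hb; rewrite (action_over gal2).
rewrite cE; have [|r rE] := @fixed_base _ _ _ _ _ _ _ _ _ _ _ _ (tensor_swap T) c.
  move=> h; have := norm_poly_fixed gcomp (tr T b) h i; rewrite -/p cE; exact.
have {}rE : tr T c = tr T (pull2 r) by rewrite [LHS]rE; exact: tlr.
rewrite rE; have [y yx] := cover_surjective (action_cover gal2) x.
apply: (@bint_base _ r); last by apply: filterS (@filterT _ _ (generically_filter X)).
rewrite -yx; apply: (rint_descend (action_cover gal2)); first exact: ratfun_rational.
by move/tr_eq: rE => rE; apply: rint_ext rE _; exact: rc.
Qed.

End Integrality.

Section Integrality2.
Variables (k : closedFieldType) (X Y1 Y2 : curve k) (G1 G2 : finGroupType).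
Variables (a1 : group_action G1 Y1) (f1 : mor Y1 X) (gal1 : galois_covering a1 f1).
Variables (a2 : group_action G2 Y2) (f2 : mor Y2 X) (gal2 : galois_covering a2 f2).
Variable T : tensor gal1 gal2.
Implicit Types (u v : T) (g h : G1) (x : X) (y : Y2) (b : ratfun Y2).
Local Notation pull1 := (ratfun_pull (action_cover gal1)).
Local Notation pull2 := (ratfun_pull (action_cover gal2)).

Lemma bint_swap x u : @bint _ _ _ _ _ _ _ _ _ _ _ _ (tensor_swap T) x u <-> bint x u.
Proof.
have h (phi psi : {rmorphism pregerm x -> T}) : phi =1 psi -> integralOver phi u -> integralOver psi u.
  move=> e [p mp pu]; exists p => //; apply: etrans pu; congr root; exact: eq_map_poly.
by split; apply: h => c /=; rewrite tlr.
Qed.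

Lemma bint_tl x (a : ratfun Y1) : (forall z : Y1, f1 z = x -> rint z a) -> bint x (tl T a).
Proof. by move=> ha; apply/bint_swap; exact: (bint_tr (tensor_swap T)). Qed.

Lemma bint0 x : bint x (0 : T). Proof. exact: integral0. Qed.
Lemma bintD x u v : bint x u -> bint x v -> bint x (u + v).
Proof. exact: integral_add. Qed.
Lemma bintM x u v : bint x u -> bint x v -> bint x (u * v).
Proof. exact: integral_mul. Qed.
Lemma bint_sum x (I : Type) (r : seq I) (F : I -> T) :
  (forall i, bint x (F i)) -> bint x (\sum_(i <- r) F i).
Proof. by move=> hF; apply: big_ind => //; [exact: bint0|exact: bintD]. Qed.

(** Finitely many rational functions present [u], and over a generic point of [X] each of them is
    regular along the fibre. *)
Lemma bint_spread x u : \forall x' \near x, x' <> x -> bint x' u.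
Proof.
apply: generically_punctured; have [s ->] := tensor_span u.
elim: s => [|c s IHs].
  by apply: (@filterS _ (@generically X) _ setT) (@filterT _ (@generically X) _) => z _;
    rewrite big_nil; exact: bint0.
have g1 := cover_generic (action_cover gal1) (ratfun_rational c.1).
have g2 := cover_generic (action_cover gal2) (ratfun_rational c.2).
apply: filterS3 g1 g2 IHs => z h1 h2 hs; rewrite big_cons; apply: bintD => //.
by apply: bintM; [apply: bint_tl|apply: bint_tr] => y yz; apply: rint_regular;
  [exact: h1|exact: h2].
Qed.

Definition ratfun_of y (s : Y2 -> k) (rs : regular_at y s) : ratfun Y2 :=
  Ratfun (asboolT (regular_rational rs) : s \in @is_rational k Y2).

(** Integrality at [y] says nothing about the other points of the fibre. The multiplier is a power
    of a function equal to 1 at [y] and 0 at those points, high enough to cancel the poles there of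
    the coefficients of the orbit polynomial of [u]. *)
Lemma pint_local y u : pint y u -> exists q : ratfun Y2,
  [/\ runit y q, forall z, f2 z = f2 y -> rint z q & bint (f2 y) (tr T q * u)].
Proof.
move=> hu; have [m [p [s [ps rs sE]]]] := cover_separators (action_cover gal2) (f2 y).
have [i0 yi0] := (ps y).1 erefl.
pose K := norm_poly (gl T) u.
have Kfix i g : gl T g K`_i = K`_i by exact: norm_poly_fixed (@gl_comp _ _ _ _ _ _ _ _ _ _ _ _ T) _ _ _.
pose c i := sval (cid (gl_fixed (Kfix i))).
have cE i : K`_i = tr T (c i) by exact: svalP (cid (gl_fixed (Kfix i))).
have rc i : rint y (c i).
  apply: (@pint_tr_rint _ _ _ _ _ _ _ _ _ _ _ _ T); rewrite -cE.
  apply: (@coef_prodXsub T (pint y)) => [|v w|v w|g].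
  - exact: integral1.
  - exact: integral_sub.
  - exact: integral_mul.
  - exact: pint_gl.
have pole i j : exists n, forall n', (n <= n')%N -> i0 != j ->
    rint (p j) ((fun z => s i0 z ^+ n') * c i).
  have [->|ij] := eqVneq i0 j; first by exists 0%N.
  have [|n hn] := @rint_pole _ _ (p j) (s i0) (c i) (ratfun_rational _) (rs i0 j).
    by rewrite sE (negPf ij).
  by exists n => n' nn' _; exact: hn.
pose n i j := sval (cid (pole i j)).
have nP i j : forall n', (n i j <= n')%N -> i0 != j -> rint (p j) ((fun z => s i0 z ^+ n') * c i).
  exact: svalP (cid (pole i j)).
pose N := (\max_(i < size K) \max_(j < m) n i j)%N.
have Nn i j : (i < size K)%N -> (n i j <= N)%N.
  move=> iK; apply: leq_trans (leq_bigmax (Ordinal iK)); exact: (leq_bigmax j).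
pose q0 := ratfun_of (rs i0 i0); pose q := q0 ^+ N.
have qE z : q z = s i0 z ^+ N by rewrite -[LHS]/(ratfun_at z _) rmorphXn.
have qX e z : (q ^+ e.+1) z = s i0 z ^+ (N * e.+1)%N.
  by rewrite exprM -qE -[LHS]/(ratfun_at z _) rmorphXn.
have rq0 z : f2 z = f2 y -> rint z q0.
  by move=> /ps[j ->]; apply: rint_regular; exact: rs.
have rqX z e : f2 z = f2 y -> rint z (q0 ^+ e).
  move=> zy; elim: e => [|e IHe]; first exact: rint_cst.
  by rewrite exprS; apply: rintM => //; exact: rq0.
exists q; split=> [|z zy|]; last 1 first.
- have [P [mP Pu hP]] := monic_scale_root (tr T q) (norm_poly_monic (gl T) u)
    (norm_poly_root (@gl_id _ _ _ _ _ _ _ _ _ _ _ _ T) u).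
  apply: integral_coef mP Pu _ => i; have [e [->|[->|->]]] := hP i; last 2 first.
  + exact: integral1.
  + exact: integral0.
  rewrite -/K; have [iK|iK] := leqP (size K) i; first by rewrite nth_default // mulr0; exact: integral0.
  rewrite cE -rmorphXn -rmorphM; apply: bint_tr => z zy.
  have [j zj] := (ps z).1 zy; have [ij|ij] := eqVneq i0 j.
    rewrite zj -ij -yi0; apply: rintM; last exact: rc.
    by rewrite -exprM; exact: rqX.
  rewrite zj; apply: rint_ext (nP i j (N * e.+1)%N _ ij).
    by apply: filterS (@filterT _ _ (generically_filter Y2)) => w _;
      change (s i0 w ^+ (N * e.+1) * c i w = (q ^+ e.+1) w * c i w); rewrite qX.
  by apply: leq_trans (Nn i j iK) _; rewrite leq_pmulr.
- exists (fun z => s i0 z ^+ N); split; last by apply: filterS (@filterT _ _ (generically_filter Y2)) => w _ /=; rewrite qE.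
    have [a aE] := regular_stalk (rs i0 i0); have [d _ dE] := germX a N.
    rewrite yi0; apply: regular_eq (pregerm_regular d).
    by apply: nearW => z; rewrite dE aE.
  by rewrite yi0 sE eqxx expr1n oner_eq0.
- exact: rqX.
Qed.

End Integrality2.

(** * Dual families *)

Lemma uniq_seq_ex (k : closedFieldType) n : exists s : seq k, uniq s /\ size s = n.
Proof.
elim: n => [|n [s [us sn]]]; first by exists [::].
have : \prod_(c <- s) ('X - c%:P) != 0 by apply: monic_neq0; exact: monic_prod_XsubC.
move=> /closed_nonrootP[c]; rewrite root_prod_XsubC => cs.
by exists (c :: s); rewrite /= cs us sn.
Qed.

Lemma inj_to_field (k : closedFieldType) (I : finType) : exists c : I -> k, injective c.
Proof.
have [s [us sn]] := uniq_seq_ex k #|I|; exists (fun i => s`_(enum_rank i)) => i j /eqP.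
by rewrite nth_uniq ?sn ?ltn_ord // => /eqP/ord_inj/enum_rank_inj.
Qed.

(** * Dual families at one point, from an evaluation in a valued field *)

Section LocalSystem.
Variables (k : closedFieldType) (X Y1 Y2 : curve k) (G1 G2 : finGroupType).
Variables (a1 : group_action G1 Y1) (f1 : mor Y1 X) (gal1 : galois_covering a1 f1).
Variables (a2 : group_action G2 Y2) (f2 : mor Y2 X) (gal2 : galois_covering a2 f2).
Variable T : tensor gal1 gal2.
Implicit Types (u v : T) (g h : G1).
Variables (y : Y2) (F : fieldType) (ev : {rmorphism T -> F}) (O M : F -> Prop).
Hypotheses (O1 : O 1) (OB : forall a b, O a -> O b -> O (a - b))
  (OM : forall a b, O a -> O b -> O (a * b)).
Hypotheses (M0 : M 0) (MD : forall a b, M a -> M b -> M (a + b))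
  (OMM : forall a b, O a -> M b -> M (a * b)) (MO : forall a, M a -> O a).
Hypothesis ev_inj : forall a, ev (tl T a) = 0 -> generically [set z | a z = 0].
Hypothesis ev_cst : forall c : k, O (ev (tr T (ratfun_cst Y2 c))).
Hypothesis ev_dense : forall z (ws : seq F), exists b, forall w, w \in ws -> M (w * (ev (tr T b) - z)).
Hypothesis ev_int : forall b, O (ev (tr T b)) -> rint y b.
Hypothesis ev_unit : forall b c, c != 0 ->
  M (ev (tr T b) - ev (tr T (ratfun_cst Y2 c))) -> runit y b.
Local Notation kap c := (ev (tr T (ratfun_cst Y2 c))).

Lemma act_separated g h : g != h -> exists a, ev (gl T g (tl T a)) != ev (gl T h (tl T a)).
Proof.
move=> gh; have gh1 : (g * h^-1)%g != 1%g by rewrite -eq_mulgV1.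
have [s rs sg] := galois_faithful gal1 gh1; have [a aE] := rational_ratfun rs.
exists a; rewrite -subr_eq0 -!rmorphB !gl_tl -rmorphB; apply/eqP => /ev_inj e.
have [z /= [h1 h2]] := generically_ex0 (generically_and e (act_generic a1 h sg)).
move: h2; rewrite -actM mulgKV -aE; apply/negP; rewrite negbK -subr_eq0; apply/eqP; exact: h1.
Qed.

Let R (phi : G1 -> F) := exists s : seq (ratfun Y1 * F), forall g,
  phi g = \sum_(d <- s) ev (gl T g (tl T d.1)) * d.2.

Let R_cst c : R (fun=> c).
Proof. by exists [:: (1, c)] => g; rewrite big_seq1 !rmorph1 mul1r. Qed.

Let RD phi psi : R phi -> R psi -> R (fun g => phi g + psi g).
Proof. by move=> [s hs] [r hr]; exists (s ++ r) => g; rewrite big_cat hs hr. Qed.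

Let RM phi psi : R phi -> R psi -> R (fun g => phi g * psi g).
Proof.
move=> [s hs] [r hr]; exists [seq (c.1 * d.1, c.2 * d.2) | c <- s, d <- r] => g.
rewrite hs hr big_allpairs_dep mulr_suml; apply: eq_bigr => c _.
by rewrite mulr_sumr; apply: eq_bigr => d _; rewrite !rmorphM mulrACA.
Qed.

Let R_eq phi psi : phi =1 psi -> R phi -> R psi.
Proof. by move=> /funext ->. Qed.

Let R_prod (J : Type) (r : seq J) (P : pred J) (E : J -> G1 -> F) :
  (forall j, R (E j)) -> R (fun x => \prod_(j <- r | P j) E j x).
Proof.
move=> RE; elim: r => [|j r IHr].
  by apply: R_eq (R_cst 1) => x; rewrite big_nil.
have [Pj|Pj] := boolP (P j).
  by apply: R_eq (RM (RE j) IHr) => x; rewrite big_cons Pj.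
by apply: R_eq IHr => x; rewrite big_cons (negPf Pj).
Qed.

Let R_sum (J : Type) (r : seq J) (E : J -> G1 -> F) :
  (forall j, R (E j)) -> R (fun x => \sum_(j <- r) E j x).
Proof.
move=> RE; elim: r => [|j r IHr].
  by apply: R_eq (R_cst 0) => x; rewrite big_nil.
by apply: R_eq (RD (RE j) IHr) => x; rewrite big_cons.
Qed.

(** Linear independence of the conjugations in explicit form: any two of them are separated by an
    element of [k(Y1)], and Lagrange interpolation at these elements produces every function on the
    group. *)
Let R_all phi : R phi.
Proof.
have sep g h : exists a : ratfun Y1, g != h -> ev (gl T g (tl T a)) != ev (gl T h (tl T a)).
  have [->|gh] := eqVneq g h; first by exists 0.
  by have [a ha] := act_separated gh; exists a.
pose a g h := sval (cid (sep g h)).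
have aP g h : g != h -> ev (gl T g (tl T (a g h))) != ev (gl T h (tl T (a g h))).
  exact: svalP (cid (sep g h)).
pose del g x := \prod_(h | h != g) ((ev (gl T x (tl T (a g h))) - ev (gl T h (tl T (a g h)))) *
  (ev (gl T g (tl T (a g h))) - ev (gl T h (tl T (a g h))))^-1).
have Rdel g : R (del g).
  apply: R_prod => h; apply: RM; last exact: R_cst.
  apply: (@RD _ (fun=> _)); last exact: R_cst.
  by exists [:: (a g h, 1)] => x; rewrite big_seq1 mulr1.
have delE g x : del g x = (x == g)%:R.
  rewrite /del; have [->|xg] := eqVneq x g.
    by apply: big1 => h hg; rewrite mulfV // subr_eq0 aP // eq_sym.
  by rewrite (bigD1 x) //= subrr !mul0r.
have [s hs] : R (fun x => \sum_g phi g * del g x).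
  by apply: R_sum => g; apply: RM (R_cst _) (Rdel g).
exists s => g; rewrite -hs (bigD1 g) //= delE eqxx mulr1 big1 ?addr0 // => h hg.
by rewrite delE eq_sym (negPf hg) mulr0.
Qed.

Lemma kapM c d : kap (c * d) = kap c * kap d.
Proof. by rewrite -!rmorphM; congr (ev (tr T _)); apply: val_inj. Qed.
Lemma kapB c d : kap (c - d) = kap c - kap d.
Proof. by rewrite -!rmorphB; congr (ev (tr T _)); apply: val_inj. Qed.

Lemma MB a b : M a -> M b -> M (a - b).
Proof.
move=> ha hb; apply: MD => //; rewrite -mulN1r; apply: OMM => //.
by rewrite -sub0r; apply: OB => //; rewrite -(subrr 1); exact: OB.
Qed.

(* The g b approximate pairwise distinct constants: interpolate these constants by
   the conjugates of k(Y1) in F, then approximate the coefficients in k(Y2). *)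
Lemma primitive_ex : exists (b : T) (c : G1 -> k), injective c /\
  forall g, M (ev (gl T g b) - kap (c g)).
Proof.
have [c cI] := inj_to_field k G1; have [s hs] := R_all (fun g => kap (c g)).
pose ws (a : ratfun Y1) := [seq ev (gl T g (tl T a)) | g <- enum G1].
have app (d : ratfun Y1 * F) : exists b, forall g, M (ev (gl T g (tl T d.1)) * (ev (tr T b) - d.2)).
  have [b hb] := ev_dense d.2 (ws d.1); exists b => g; apply: hb.
  by apply/mapP; exists g => //; rewrite mem_enum.
pose b d := sval (cid (app d)).
have bP d g : M (ev (gl T g (tl T d.1)) * (ev (tr T (b d)) - d.2)).
  exact: (svalP (cid (app d)) g).
exists (\sum_(d <- s) tl T d.1 * tr T (b d)), c; split=> // g.
rewrite hs !rmorph_sum -sumrB; apply: (@big_ind _ M) => // d _.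
by rewrite !rmorphM gl_tr -mulrBr.
Qed.

(** The element [b] of [primitive_ex] has conjugates with distinct residues. Its orbit polynomial
    has coefficients in [k(Y2)] that evaluate into [O], so [b] is integral; the norm of [b - g b]
    has nonzero residue and is a unit at [y]. So [galois_system] applies to the integral
    elements. *)
Lemma local_system : exists (I : finType) (u v : I -> T) (c : T),
  [/\ forall i, pint y (u i), forall i, pint y (v i), pint y c,
      forall g, \sum_i u i * gl T g (v i) = (g == 1%g)%:R & \sum_g gl T g c = 1].
Proof.
have gcomp := @gl_comp _ _ _ _ _ _ _ _ _ _ _ _ T.
have gid := @gl_id _ _ _ _ _ _ _ _ _ _ _ _ T.
have [b [c [cI hb]]] := primitive_ex.
have O0 : O 0 by rewrite -(subrr 1); exact: OB.
have OD a d : O a -> O d -> O (a + d).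
  by move=> Oa Od; rewrite -[d]opprK; apply: OB => //; rewrite -sub0r; exact: OB.
have Ob g : O (ev (gl T g b)).
  by rewrite -[ev _](subrK (kap (c g))); apply: OD; [exact: MO|exact: ev_cst].
have fixed_int u : (forall g, gl T g u = u) -> O (ev u) -> pint y u.
  by move=> /gl_fixed[d ->] /ev_int; exact: pint_tr.
have pb : pint y b.
  apply: (@integral_coef _ _ _ (norm_poly (gl T) b)).
  - exact: norm_poly_monic.
  - exact: norm_poly_root gid _.
  move=> i; apply: fixed_int; first by move=> g; exact: norm_poly_fixed gcomp _ _ _.
  rewrite -coef_map /norm_poly rmorph_prod /=.
  under eq_bigr do rewrite rmorphB /= map_polyX map_polyC /=.
  have := @coef_prodXsub F O G1 (index_enum G1) (fun h => ev (gl T h b)) O1 OB OM Ob i; exact.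
have pint_prod (r : seq G1) (P : pred G1) (u : G1 -> T) : (forall g, pint y (u g)) -> pint y (\prod_(g <- r | P g) u g).
  by move=> hu; apply: (@big_ind _ (pint y)) => //; [exact: integral1|exact: integral_mul].
have sep g : g != 1%g -> exists b w, [/\ pint y b, pint y w & (b - gl T g b) * w = 1].
  move=> g1; set d := b - gl T g b; have pd : pint y d by apply: integral_sub => //; exact: pint_gl.
  have [n nE] := gl_fixed (act_prod_fixed gcomp d).
  have un : runit y n.
    (* Modulo [M] the conjugate of [b - g b] by [h] is [c h - c (g * h)], in the order of
       composition of [gl_comp]; it is nonzero by injectivity of [c]. *)
    apply: (@ev_unit _ (\prod_h (c h - c (g * h)%g))).
      apply/prodf_neq0 => h _; rewrite subr_eq0; apply/eqP => /cI e.
      by move/eqP: g1; apply; apply: (mulIg h); rewrite mul1g -e.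
    rewrite -nE rmorph_prod.
    have : forall r : seq G1, O (kap (\prod_(h <- r) (c h - c (g * h)%g))) /\
        M (\prod_(h <- r) ev (gl T h d) - kap (\prod_(h <- r) (c h - c (g * h)%g))).
      elim=> [|h r [IO IM]].
        rewrite !big_nil; split=> //; rewrite (_ : ratfun_cst Y2 1 = 1) ?rmorph1 ?subrr //.
        exact: val_inj.
      rewrite !big_cons kapM; split; first exact: OM.
      have Md : M (ev (gl T h d) - kap (c h - c (g * h)%g)).
        rewrite kapB /d !rmorphB gcomp (_ : forall p q r s : F, p - q - (r - s) = p - r - (q - s)).
          by apply: MB.
        by move=> *; ring.
      set x := ev _ in Md *; set q := kap (c h - _) in Md *.
      set P := \prod_(_ <- r) _ in IM *; set Q := kap (\prod_(_ <- r) _) in IO IM *.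
      have -> : x * P - q * Q = x * (P - Q) + Q * (x - q) by ring.
      by apply: MD; apply: OMM => //; rewrite /x /d !rmorphB gcomp; apply: OB.
    by move=> /(_ (index_enum _))[].
  have nn := runit_neq0 un.
  (* The inverse of [d] is the product of its other conjugates divided by its norm [n]. *)
  exists b, (tr T (ratfun_inv n) * \prod_(h | h != 1%g) gl T h d); split=> //.
    apply: integral_mul; first exact/pint_tr/runit_rint/runit_inv.
    by apply: pint_prod => h; exact: pint_gl.
  rewrite mulrCA; have := nE; rewrite (bigD1 1%g) //= gid -/d => ->.
  rewrite mulrC; exact: (tl_inv (tensor_swap T) nn).
have [||||I [u [v [pu pv e]]]] := galois_system gid (P := pint y) _ _ _ _ sep.
- exact: integral1.
- exact: integral_sub.
- exact: integral_mul.
- by move=> g w; exact: pint_gl.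
pose t i := \sum_g gl T g (v i).
have tfix i := gl_fixed (act_sum_fixed gcomp (v i)).
pose tau i := sval (cid (tfix i)).
have tauE i : t i = tr T (tau i) by exact: svalP (cid (tfix i)).
have rtau i : rint y (tau i).
  apply: (@pint_tr_rint _ _ _ _ _ _ _ _ _ _ _ _ T); rewrite -tauE.
  apply: (@big_ind _ (pint y)) => [||g _]; [exact: integral0|exact: integral_add|exact: pint_gl].
(* The traces of the v i generate the unit ideal, as sum u_i tr(v_i) = 1. *)
have [i ui] : exists i, runit y (tau i).
  apply: contrapT => nu; have [s us] := uniformizer_ex y.
  have div i : exists sig : ratfun Y2, rint y sig /\ tr T (tau i) = tr T (germ_ratfun s) * tr T sig.
    have [a ha] := (rint_germ y (tau i)).1 (rtau i).
    have a0 : a y = 0.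
      apply: contrapT => /eqP ay; apply: nu; exists i, a; split=> //; exact: pregerm_regular.
    have [nt _ tP] := us; have /tP[w] : nonunit (germ a) by exact/nonunit_stalkP.
    rewrite -[w]germ_repr -germM => /germ_eqP/near_generically aw.
    exists (germ_ratfun (repr w)); split; first exact: rint_regular (pregerm_regular _).
    rewrite -rmorphM; apply/tr_eq; apply: filterS2 ha aw => z /= -> ->; by [].
  (* If no trace is a unit, dividing all of them by the uniformizer [s] makes [om] an integral
     inverse of [s], against the vanishing of [s] at [y]. *)
  pose sig i := sval (cid (div i)); pose om := \sum_i u i * tr T (sig i).
  have pom : pint y om.
    apply: (@big_ind _ (pint y)) => [||i _]; [exact: integral0|exact: integral_add|].
    apply: integral_mul; [exact: pu|apply: pint_tr].
    by have [] := svalP (cid (div i)).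
  have som : tr T (germ_ratfun s) * om = 1.
    rewrite -(system_trace e) mulr_sumr; apply: eq_bigr => i _.
    rewrite -/(t i) tauE; have [_ ->] := svalP (cid (div i)); by rewrite mulrCA.
  have sn : generically [set z | germ_ratfun s z != 0].
    exact: punctured_generically (uniformizer_neq0 us).
  have omE : om = tr T (ratfun_inv (germ_ratfun s)).
    have si := tl_inv (tensor_swap T) sn; rewrite -[LHS]mulr1 -[X in _ * X = _]si.
    by rewrite mulrA [om * _]mulrC som mul1r.
  have [g rg gE] : rint y (ratfun_inv (germ_ratfun s)).
    by apply: (@pint_tr_rint _ _ _ _ _ _ _ _ _ _ _ _ T); rewrite -omE.
  have : \forall z \near y, ((s : Y2 -> k) * g) z = (cst 1 : Y2 -> k) z.
    apply: regular_generic_eq; [|exact: regular_cst|].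
      by apply: regularM => //; exact: pregerm_regular.
    by apply: filterS2 gE sn => z /= gz sz; rewrite !fctE -gz mulfV.
  move=> /nbhs_singleton; rewrite !fctE (uniformizer0 us) mul0r => /eqP.
  by rewrite eq_sym oner_eq0.
exists I, u, v, (v i * tr T (ratfun_inv (tau i))); split=> //.
  by apply: integral_mul; [exact: pv|apply: pint_tr; exact: runit_rint (runit_inv ui)].
under eq_bigr do rewrite rmorphM gl_tr.
rewrite -mulr_suml -/(t i) tauE; exact: (tl_inv (tensor_swap T) (runit_neq0 ui)).
Qed.

End LocalSystem.

(** * Integral and small elements of the completed local field *)

Section FractionLattice.
Variables (R : idomainType) (t : R).
Local Notation frac := (@FracField.tofrac R).
Definition frac_integral (z : {fraction R}) : Prop := exists r, z = frac r.
Definition frac_small (z : {fraction R}) : Prop := exists r, z = frac (t * r).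

Lemma frac_integral1 : frac_integral 1. Proof. by exists 1; rewrite rmorph1. Qed.
Lemma frac_integralB a b : frac_integral a -> frac_integral b -> frac_integral (a - b).
Proof. by move=> [r ->] [s ->]; exists (r - s); rewrite rmorphB. Qed.
Lemma frac_integralM a b : frac_integral a -> frac_integral b -> frac_integral (a * b).
Proof. by move=> [r ->] [s ->]; exists (r * s); rewrite rmorphM. Qed.
Lemma frac_small0 : frac_small 0. Proof. by exists 0; rewrite mulr0 rmorph0. Qed.
Lemma frac_smallD a b : frac_small a -> frac_small b -> frac_small (a + b).
Proof. by move=> [r ->] [s ->]; exists (r + s); rewrite mulrDr rmorphD. Qed.
Lemma frac_smallM a b : frac_integral a -> frac_small b -> frac_small (a * b).
Proof. by move=> [r ->] [s ->]; exists (r * s); rewrite -rmorphM mulrCA. Qed.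
Lemma frac_small_integral a : frac_small a -> frac_integral a.
Proof. by move=> [r ->]; exists (t * r). Qed.

Hypothesis t_fac : forall q, q != 0 -> exists j u v, u * v = 1 /\ q = t ^+ j * u.

Lemma frac_clear w : exists n, forall n', (n <= n')%N -> exists r, frac (t ^+ n') * w = frac r.
Proof.
have [p [q [q0 ->]]] := frac_div w; have [j [u [v [uv qE]]]] := t_fac q0.
exists j => n' jn; exists (t ^+ (n' - j) * p * v); rewrite mulrA -rmorphM.
apply: (canLR (mulfK _)); first by rewrite tofrac_eq0.
rewrite -rmorphM; congr frac; rewrite qE -{1}(subnK jn) exprD.
transitivity (t ^+ (n' - j) * t ^+ j * p * (u * v)); first by rewrite uv mulr1.
by ring.
Qed.

Lemma frac_small_seq (ws : seq {fraction R}) : exists n, forall r w, w \in ws ->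
  frac_small (w * frac (t ^+ n * r)).
Proof.
have [n hn] : exists n, forall n', (n <= n')%N -> forall w, w \in ws ->
    exists r, frac (t ^+ n') * w = frac r.
  elim: ws => [|w ws [n hn]]; first by exists 0%N.
  have [m hm] := frac_clear w; exists (maxn n m) => n'; rewrite geq_max => /andP[h1 h2] w'.
  by rewrite inE => /predU1P[->|/(hn _ h1)//]; exact: hm.
(* The exponent [n] clears the denominators; one more factor [t] makes the products small. *)
exists n.+1 => r w /(hn n (leqnn n))[s e]; exists (s * r).
transitivity (frac t * (frac (t ^+ n) * w) * frac r); last by rewrite e -!rmorphM mulrA.
rewrite exprS -mulrA (rmorphM frac) (rmorphM frac).
have h (K : comNzRingType) (x p q z : K) : x * (p * (q * z)) = p * (q * x) * z by ring.
exact: h.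
Qed.

End FractionLattice.

Section CompletedFactor.
Variables (k : closedFieldType) (Y : curve k) (y : Y) (t : pregerm y).
Hypothesis ut : uniformizer t.

Lemma completed_factor (q : completed_stalk y) : q != 0 ->
  exists j u v, u * v = 1 /\ q = germ_completion t ^+ j * u.
Proof.
have [nt t0 tP] := ut; move=> q0.
have [j [u [v [r [uv e]]]]] := completion_factor nt t0 tP (@curve_noetherian _ _ y) q0.
have [w hw] := completion_unit nt tP r uv.
exists j; eexists; exists w; split; first exact: hw.
by rewrite e rmorphXn.
Qed.

End CompletedFactor.

Section PointSystem.
Variables (k : closedFieldType) (XP : formal_orbifold k).
Variables (Y1 Y2 : curve k) (G1 G2 : finGroupType).
Variables (a1 : group_action G1 Y1) (f1 : mor Y1 XP) (gal1 : galois_covering a1 f1).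
Variables (a2 : group_action G2 Y2) (f2 : mor Y2 XP) (gal2 : galois_covering a2 f2).
Hypothesis et1 : @orbifold_etale k (trivial_orbifold Y1) XP f1.
Hypothesis et2 : @orbifold_etale k (trivial_orbifold Y2) XP f2.
Variable T : tensor gal1 gal2.

(** The field of [local_system] is the completed local field at [y], receiving [k(Y2)] by
    [local_map] and [k(Y1)] by [etale_embedding]. Both maps agree on [k(X)], so [tensor_eval] joins
    them. *)
Lemma point_system (y : Y2) : exists (I : finType) (u v : I -> T) (c : T),
  [/\ forall i, pint y (u i), forall i, pint y (v i), pint y c,
      forall g, \sum_i u i * gl T g (v i) = (g == 1%g)%:R & \sum_g gl T g c = 1].
Proof.
have [th [th0 thE]] := etale_embedding (action_cover gal1) (action_cover gal2) et1 et2 y.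
have [||ev [ev1 ev2]] := tensor_eval T _ _ thE.
- by move=> a /th0.
- by move=> b b0; exact: (local_map_eq0 y b).2 b0.
have [t ut] := uniformizer_ex y; pose ct := germ_completion t.
have fac := completed_factor ut.
have cst c : local_map y (ratfun_cst Y2 c) = FracField.tofrac (germ_completion (const_germ y c)).
  apply: local_map_regular; exact: (@filterS _ (@generically Y2) _ setT) (@filterT _ (@generically Y2) _).
apply: (@local_system _ _ _ _ _ _ _ _ gal1 _ _ gal2 T y _ ev (@frac_integral _) (@frac_small _ ct)).
- exact: frac_integral1.
- exact: frac_integralB.
- exact: frac_integralM.
- exact: frac_small0.
- exact: frac_smallD.
- exact: frac_smallM.
- exact: frac_small_integral.
- by move=> a; rewrite ev1 => /th0.
- by move=> c; rewrite ev2; have := cst c; rewrite /= => ->; exists (germ_completion (const_germ y c)).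
- move=> z ws; have [n hn] := frac_small_seq fac ws.
  have [b [r e]] := local_map_dense z n ut; exists b => w /(hn (- r)).
  by rewrite ev2 -[_ - z]opprB e mulrN rmorphN.
- by move=> b [r]; rewrite ev2 => /local_map_integral.
move=> b c c0 [r]; rewrite !ev2; have := cst c; rewrite /= => -> /eqP; rewrite subr_eq -rmorphD addrC => /eqP e.
have [g rg bg] := local_map_integral e; exists g; split=> //.
by rewrite (local_map_value ut rg bg e).
Qed.

End PointSystem.

Section VanishAt.
Variables (k : closedFieldType) (Y : curve k) (y : Y).
Implicit Types f h : Y -> k.

Definition rvanish f : Prop :=
  exists g, [/\ regular_at y g, g y = 0 & generically [set z | f z = g z]].

Lemma rvanish0 : rvanish 0.
Proof.
exists (cst 0); split=> //; first exact: regular_cst.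
exact: (@filterS _ (@generically Y) _ setT) (@filterT _ (@generically Y) _).
Qed.

Lemma rvanishD f h : rvanish f -> rvanish h -> rvanish (f + h).
Proof.
move=> [f' [rf fy ef]] [h' [rh hy eh]]; exists (f' + h'); split.
- by rewrite -[h']opprK -[- h']add0r; apply: regularB => //; apply: regularB => //; exact: regular_cst.
- by rewrite fctE fy hy addr0.
by apply: filterS2 ef eh => z /= e1 e2; rewrite !fctE e1 e2.
Qed.

Lemma rvanishM f h : rvanish f -> rint y h -> rvanish (f * h).
Proof.
move=> [f' [rf fy ef]] [h' rh eh]; exists (f' * h'); split; first exact: regularM.
  by rewrite fctE fy mul0r.
by apply: filterS2 ef eh => z /= e1 e2; rewrite !fctE e1 e2.
Qed.

Lemma runitD f h : runit y f -> rvanish h -> runit y (f + h).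
Proof.
move=> [f' [rf fy ef]] [h' [rh hy eh]]; exists (f' + h'); split.
- by rewrite -[h']opprK -[- h']add0r; apply: regularB => //; apply: regularB => //; exact: regular_cst.
- by rewrite fctE hy addr0.
by apply: filterS2 ef eh => z /= e1 e2; rewrite !fctE e1 e2.
Qed.

Lemma runit1 : runit y 1.
Proof.
exists (cst 1); split; [exact: regular_cst|exact: oner_neq0|].
exact: (@filterS _ (@generically Y) _ setT) (@filterT _ (@generically Y) _).
Qed.

End VanishAt.

(** * From the points of a fibre to the local ring of the base *)

Section BaseSystem.
Variables (k : closedFieldType) (X Y1 Y2 : curve k) (G1 G2 : finGroupType).
Variables (a1 : group_action G1 Y1) (f1 : mor Y1 X) (gal1 : galois_covering a1 f1).
Variables (a2 : group_action G2 Y2) (f2 : mor Y2 X) (gal2 : galois_covering a2 f2).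
Variable T : tensor gal1 gal2.
Hypothesis pts : forall y : Y2, exists (I : finType) (u v : I -> T) (c : T),
  [/\ forall i, pint y (u i), forall i, pint y (v i), pint y c,
      forall g, \sum_i u i * gl T g (v i) = (g == 1%g)%:R & \sum_g gl T g c = 1].

Lemma pint_local_seq y (s : seq T) : (forall w, w \in s -> pint y w) -> exists q : ratfun Y2,
  [/\ runit y q, forall z, f2 z = f2 y -> rint z q &
      forall w, w \in s -> bint (f2 y) (tr T q * w)].
Proof.
elim: s => [|w s IHs] hs.
  by exists 1; split=> // [|z _]; [exact: runit1|exact: rint_cst].
have [|q [uq rq hq]] := IHs; first by move=> v vs; apply: hs; rewrite inE vs orbT.
have [|p [up rp hp]] := @pint_local _ _ _ _ _ _ _ _ _ _ _ _ T y w; first by apply: hs; rewrite inE eqxx.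
exists (p * q); split=> [|z zy|v].
- exact: runitM.
- by apply: rintM; [exact: rp|exact: rq].
rewrite rmorphM inE => /predU1P[->|vs]; last by rewrite -mulrA; apply: bintM; [exact: bint_tr|exact: hq].
by rewrite mulrAC; apply: bintM; [|exact: bint_tr].
Qed.

(** The functions [w] for which dual families exist up to the factor [w] form an ideal over the
    functions integral at [x]. Local families put into it elements that are units at single points,
    and these combine to a unit along the fibre. *)
Let sys x (w : ratfun Y2) := exists (I : finType) (u v : I -> T) (c : T),
  [/\ forall i, bint x (u i), forall i, bint x (v i), bint x c,
      forall g, \sum_i u i * gl T g (v i) = tr T w * (g == 1%g)%:R & \sum_g gl T g c = tr T w].

Let sys0 x : sys x 0.
Proof.
exists void, (fun=> 0), (fun=> 0), 0; split=> //; first exact: bint0.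
  by move=> g; rewrite big1 => [|[]]; rewrite (rmorph0 (tr T)) mul0r.
by rewrite big1 => [|g _]; [rewrite (rmorph0 (tr T))|exact: rmorph0].
Qed.

Let sysD x w w' : sys x w -> sys x w' -> sys x (w + w').
Proof.
move=> [I [u [v [c [hu hv hc e ec]]]]] [I' [u' [v' [c' [hu' hv' hc' e' ec']]]]].
exists (I + I')%type, (fun i => match i with inl i => u i | inr i => u' i end),
  (fun i => match i with inl i => v i | inr i => v' i end), (c + c'); split.
- by case.
- by case.
- exact: bintD.
- by move=> g; rewrite rmorphD mulrDl -e -e' big_sumType.
rewrite rmorphD -ec -ec' -big_split; apply: eq_bigr => g _; exact: rmorphD.
Qed.

Let sysM x s w : bint x (tr T s) -> sys x w -> sys x (s * w).
Proof.
move=> hs [I [u [v [c [hu hv hc e ec]]]]].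
exists I, (fun i => tr T s * u i), v, (tr T s * c); split=> //.
- by move=> i; exact: bintM.
- exact: bintM.
- by move=> g; rewrite rmorphM -mulrA -e mulr_sumr; apply: eq_bigr => i _; rewrite mulrA.
by rewrite rmorphM -ec mulr_sumr; apply: eq_bigr => g _; rewrite rmorphM gl_tr.
Qed.

Lemma base_system x : exists (I : finType) (u v : I -> T) (c : T),
  [/\ forall i, bint x (u i), forall i, bint x (v i), bint x c,
      forall g, \sum_i u i * gl T g (v i) = (g == 1%g)%:R & \sum_g gl T g c = 1].
Proof.
have [m [p [s [ps rs sE]]]] := cover_separators (action_cover gal2) x.
have px j : f2 (p j) = x by apply/ps; exists j.
(* The square appears because the members of both families [u] and [v] are multiplied by [q] to
   become integral over the base. *)
have loc j : exists q : ratfun Y2, [/\ runit (p j) q, forall z, f2 z = x -> rint z q &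
    sys x (q * q)].
  have [I [u [v [c [hu hv hc e ec]]]]] := pts (p j).
  have [|q [uq rq hq]] := @pint_local_seq (p j) (c :: codom u ++ codom v).
    by move=> w; rewrite inE mem_cat => /predU1P[->//|/orP[] /codomP[i ->]].
  rewrite px in rq hq; exists q; split=> //.
  have hw w : w \in c :: codom u ++ codom v -> bint x (tr T q * w) by move=> /hq.
  exists I, (fun i => tr T q * u i), (fun i => tr T q * v i), (tr T q * (tr T q * c)); split.
  - by move=> i; apply: hw; rewrite inE mem_cat codom_f orbT.
  - by move=> i; apply: hw; rewrite inE mem_cat codom_f !orbT.
  - by apply: bintM; [exact: bint_tr|apply: hw; rewrite inE eqxx].
  - move=> g; rewrite -e mulr_sumr; apply: eq_bigr => i _.
    by rewrite !rmorphM gl_tr mulrACA.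
  rewrite -[RHS]mulr1 -ec mulr_sumr; apply: eq_bigr => g _.
  by rewrite !rmorphM gl_tr mulrA.
pose q j := sval (cid (loc j)).
have qP j : [/\ runit (p j) (q j), forall z, f2 z = x -> rint z (q j) & sys x (q j * q j)].
  exact: svalP (cid (loc j)).
pose sj j := ratfun_of (rs j j).
have bs j : bint x (tr T (sj j)).
  by apply: bint_tr => z /ps[i ->]; apply: rint_regular; exact: rs.
(* At [p i] the term of index [i] is a unit and the other terms vanish, so [U] is a unit along the
   whole fibre. *)
pose U := \sum_j sj j * (q j * q j).
have sU : sys x U.
  by apply: (@big_ind _ (sys x)) => // [|j _]; [exact: sysD|apply: sysM => //; have [] := qP j].
have uU i : runit (p i) U.
  rewrite /U (bigD1 i) //=; apply: runitD.
    have [h _ _] := qP i; apply: runitM; last exact: runitM.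
    exists (s i); split=> //; first by rewrite sE eqxx oner_neq0.
    exact: (@filterS _ (@generically Y2) _ setT) (@filterT _ (@generically Y2) _).
  apply: (@big_ind _ (fun f : ratfun Y2 => rvanish (p i) f)) => [|f h|j ji].
  - exact: rvanish0.
  - exact: rvanishD.
  apply: rvanishM; last by have [_ h _] := qP j; apply: rintM; exact: h.
  exists (s j); split=> //; first by rewrite sE (negPf ji).
  exact: (@filterS _ (@generically Y2) _ setT) (@filterT _ (@generically Y2) _).
have [y0 /ps[i0 _]] := cover_surjective (action_cover gal2) x.
have bV : bint x (tr T (ratfun_inv U)).
  by apply: bint_tr => z /ps[i ->]; exact: runit_rint (runit_inv (uU i)).
have e1 : tr T (ratfun_inv U * U) = 1.
  by rewrite rmorphM mulrC; exact: (tl_inv (tensor_swap T) (runit_neq0 (uU i0))).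
have [I [u [v [c [hu hv hc e ec]]]]] := sysM bV sU.
exists I, u, v, c; split=> // [g|]; last by rewrite ec.
by rewrite e e1 mul1r.
Qed.

End BaseSystem.

(** * Linear forms on vector bundles *)
Section OpenSets.
Variables (k : closedFieldType) (Y : curve k).
Implicit Types U W : opens Y.

Definition cap U W : opens Y := Opens (openI (open_setP U) (open_setP W)).

Lemma open_generic U : (U : set Y) !=set0 -> generically (U : set Y).
Proof. by apply: generically_open; exact: open_setP. Qed.

Lemma cap_neq0 U W : (U : set Y) !=set0 -> (W : set Y) !=set0 -> (cap U W : set Y) !=set0.
Proof. by move=> /open_generic hU /open_generic hW; exact: generically_ex0 (generically_and hU hW). Qed.

Lemma secrat_subproof U (s : structure_sheaf U) : ext0 s \in @is_rational k Y.
Proof.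
apply/asboolP; have [[y Uy]|nU] := pselect ((U : set Y) !=set0).
  exact: regular_rational (section_regular (open_setP U) s Uy).
rewrite (_ : ext0 s = cst 0); first exact: rational_cst.
by apply/funext => y; apply: ext0_out => Uy; apply: nU; exists y.
Qed.
(** Extension by zero puts sections over different open sets into one ring. *)
Definition secrat U (s : structure_sheaf U) : ratfun Y := Ratfun (secrat_subproof s).

Lemma secrat_out U (s : structure_sheaf U) y : ~ open_set U y -> secrat s y = 0.
Proof. exact: ext0_out. Qed.

Lemma secrat_in U (s : structure_sheaf U) y (Uy : open_set U y) : secrat s y = s (inU Uy).
Proof. exact: ext0_in. Qed.

Lemma secratD U (s s' : structure_sheaf U) : secrat (s + s') = secrat s + secrat s'.
Proof.
apply: val_inj; apply/funext => y; change (secrat (s + s') y = secrat s y + secrat s' y).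
have [Uy|nUy] := pselect (open_set U y); first by rewrite !(secrat_in _ Uy).
by rewrite !secrat_out ?addr0.
Qed.

Lemma secratM U (s s' : structure_sheaf U) : secrat (s * s') = secrat s * secrat s'.
Proof.
apply: val_inj; apply/funext => y; change (secrat (s * s') y = secrat s y * secrat s' y).
have [Uy|nUy] := pselect (open_set U y); first by rewrite !(secrat_in _ Uy).
by rewrite !secrat_out ?mulr0.
Qed.

Lemma secrat1 U y : open_set U y -> secrat (1 : structure_sheaf U) y = 1.
Proof. by move=> Uy; rewrite (secrat_in _ Uy). Qed.

Lemma secrat_res U W (sUW : U `<=` W) (s : structure_sheaf W) y : open_set U y ->
  secrat (sheaf_res sUW s) y = secrat s y.
Proof.
move=> Uy; rewrite (secrat_in _ Uy) (secrat_in _ (sUW _ Uy)) /=.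
by congr (s _); apply: val_inj.
Qed.

Lemma secrat_resM U W (sUW : U `<=` W) (s : structure_sheaf W) (c : structure_sheaf U) :
  secrat (sheaf_res sUW s * c) = secrat s * secrat c.
Proof.
rewrite secratM; apply: val_inj; apply/funext => y.
change (secrat (sheaf_res sUW s) y * secrat c y = secrat s y * secrat c y).
have [Uy|nUy] := pselect (open_set U y); first by rewrite secrat_res.
by rewrite [secrat c y]secrat_out // !mulr0.
Qed.

Lemma secrat_regular U (s : structure_sheaf U) y : open_set U y -> regular_at y (secrat s).
Proof. exact: section_regular (open_setP U) s _. Qed.

Lemma secrat_inj U (s s' : structure_sheaf U) :
  generically [set z | secrat s z = secrat s' z] -> s = s'.
Proof.
move=> e; apply: val_inj; apply/funext => u; have Uu := subset_val u.
have := nbhs_singleton (regular_generic_eq (secrat_regular s Uu) (secrat_regular s' Uu) e).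
by rewrite /= !(ext0_val (U := U)).
Qed.

(** Regular representatives chosen at different points agree near the points where both are regular,
    so the function taking at each point the value of its own representative is regular on [U]. *)
Lemma section_of U (c : ratfun Y) : (U : set Y) !=set0 -> (forall y, open_set U y -> rint y c) ->
  exists s : structure_sheaf U, generically [set z | secrat s z = c z].
Proof.
move=> [y Uy] hc; have hc' x : exists g : Y -> k, open_set U x -> regular_at x g /\ generically [set z | c z = g z].
  by have [/hc[g rg cg]|] := pselect (open_set U x); [exists g|exists 0].
pose g y := sval (cid (hc' y)).
have gP x : open_set U x -> regular_at x (g x) /\ generically [set z | c z = g x z].
  exact: svalP (cid (hc' x)).
pose s y := g y y.
have sg x : open_set U x -> \forall z \near x, s z = g x z.
  move=> Ux; have [rg cg] := gP x Ux.
  apply: filterS2 (regular_near rg) (open_nbhs_nbhs (conj (open_setP U) Ux)) => z rz Uz.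
  have [rgz cgz] := gP z Uz; apply: nbhs_singleton (regular_generic_eq rgz rz _).
  by apply: filterS2 cg cgz => w /= <- <-.
have rs x : open_set U x -> regular_at x s.
  move=> Ux; have [rg _] := gP x Ux; apply: regular_eq rg.
  by apply: filterS (sg x Ux) => z ->.
have [s' s'E] := regular_section rs; exists s'.
have [_ cg] := gP y Uy; have gU := @open_generic U (ex_intro _ y Uy).
apply: filterS3 (near_generically (sg y Uy)) cg gU => z /= sz cz Uz.
by rewrite (ext0_in s' Uz) s'E cz -sz.
Qed.

End OpenSets.
Section Forms.
Variables (k : closedFieldType) (Y : curve k) (V : module_sheaf Y).
Variables (A : comNzRingType) (tau : {rmorphism ratfun Y -> A}).
Implicit Types U W : opens Y.

(* A linear form on the generic stalk of V, with values in A. *)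
Record gform := Gform {
  gf :> forall U, V U -> A;
  gfD : forall U u v, @gf U (u + v) = @gf U u + @gf U v;
  gfZ : forall U (s : structure_sheaf U) v, @gf U (s *: v) = tau (secrat s) * @gf U v;
  gf_res : forall U W (sUW : U `<=` W) v, (U : set Y) !=set0 -> @gf U (res sUW v) = @gf W v
}.

Lemma gform_ext (f g : gform) : (forall U v, f U v = g U v) -> f = g.
Proof.
case: f g => f f1 f2 f3 [g g1 g2 g3] /= fg.
have e : f = g by apply: functional_extensionality_dep => U; exact/funext/fg.
by case: _ / e g1 g2 g3 => *; congr Gform; exact: Prop_irrelevance.
Qed.

HB.instance Definition _ := gen_eqMixin gform.
HB.instance Definition _ := gen_choiceMixin gform.

Definition gform0 : gform.
Proof.
by exists (fun U v => 0) => // [U u v|U s v]; rewrite ?addr0 ?mulr0.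
Defined.

Definition gform_opp (f : gform) : gform.
Proof.
exists (fun U v => - f U v) => [U u v|U s v|U W sUW v U0].
- by rewrite gfD opprD.
- by rewrite gfZ mulrN.
- by rewrite gf_res.
Defined.

Definition gform_add (f g : gform) : gform.
Proof.
exists (fun U v => f U v + g U v) => [U u v|U s v|U W sUW v U0].
- by rewrite !gfD addrACA.
- by rewrite !gfZ mulrDr.
- by rewrite !gf_res.
Defined.

Definition gform_scale (a : A) (f : gform) : gform.
Proof.
exists (fun U v => a * f U v) => [U u v|U s v|U W sUW v U0].
- by rewrite gfD mulrDr.
- by rewrite gfZ mulrCA.
- by rewrite gf_res.
Defined.

Fact gform_addA : associative gform_add.
Proof. by move=> f g h; apply: gform_ext => U v; exact: addrA. Qed.
Fact gform_addC : commutative gform_add.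
Proof. by move=> f g; apply: gform_ext => U v; exact: addrC. Qed.
Fact gform_add0 : left_id gform0 gform_add.
Proof. by move=> f; apply: gform_ext => U v; exact: add0r. Qed.
Fact gform_addN : left_inverse gform0 gform_opp gform_add.
Proof. by move=> f; apply: gform_ext => U v; exact: addNr. Qed.
HB.instance Definition _ := GRing.isZmodule.Build gform gform_addA gform_addC gform_add0 gform_addN.

Fact gform_scaleA a b f : gform_scale a (gform_scale b f) = gform_scale (a * b) f.
Proof. by apply: gform_ext => U v; exact: mulrA. Qed.
Fact gform_scale1 : left_id 1 gform_scale.
Proof. by move=> f; apply: gform_ext => U v; exact: mul1r. Qed.
Fact gform_scaleDr : right_distributive gform_scale +%R.
Proof. by move=> a f g; apply: gform_ext => U v; exact: mulrDr. Qed.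
Fact gform_scaleDl f : {morph gform_scale^~ f : a b / a + b}.
Proof. by move=> a b; apply: gform_ext => U v; exact: mulrDl. Qed.
HB.instance Definition _ := GRing.Zmodule_isLmodule.Build A gform gform_scaleA gform_scale1
  gform_scaleDr gform_scaleDl.

Lemma gfformD (f g : gform) U v : (f + g) U v = f U v + g U v. Proof. by []. Qed.
Lemma gfformZ a (f : gform) U v : (a *: f) U v = a * f U v. Proof. by []. Qed.
Lemma gfform_sum (I : Type) (r : seq I) (F : I -> gform) U v :
  (\sum_(i <- r) F i) U v = \sum_(i <- r) F i U v.
Proof. by elim: r => [|i r IHr]; rewrite ?big_nil // !big_cons -IHr. Qed.

Lemma gf0 (f : gform) U : f U 0 = 0.
Proof. by have := gfD f (0 : V U) 0; rewrite addr0 => /eqP; rewrite -subr_eq0 opprD addNKr oppr_eq0 => /eqP. Qed.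
Lemma gf_sum (f : gform) U (I : Type) (r : seq I) (F : I -> V U) :
  f U (\sum_(i <- r) F i) = \sum_(i <- r) f U (F i).
Proof. by elim: r => [|i r IHr]; rewrite ?big_nil ?gf0 // !big_cons gfD -IHr. Qed.

Lemma sec_empty U (u v : V U) : ~ ((U : set Y) !=set0) -> u = v.
Proof.
move=> U0; apply: (@sheaf_sep _ _ V U void (fun=> U) (fun=> @subset_refl _ _)) => [y Uy|[]].
by case: U0; exists y.
Qed.

Lemma res_sum U W (sUW : U `<=` W) (J : Type) (r : seq J) (F : J -> V W) :
  res sUW (\sum_(i <- r) F i) = \sum_(i <- r) res sUW (F i).
Proof.
elim: r => [|j r IHr]; last by rewrite !big_cons resD IHr.
rewrite !big_nil; have := resD sUW (0 : V W) 0; rewrite addr0.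
by move=> /eqP; rewrite -subr_eq0 opprD addNKr oppr_eq0 => /eqP.
Qed.

Lemma gf_empty (f : gform) U v : ~ ((U : set Y) !=set0) -> f U v = 0.
Proof. by move=> U0; rewrite (sec_empty v 0 U0) gf0. Qed.

End Forms.

(** * Local bases and coordinates of generic vectors *)

Section LocalBases.
Variables (k : closedFieldType) (Y : curve k) (V : vector_bundle Y).
Implicit Types U W : opens Y.

Lemma basis_ex (y : Y) : exists B : {U : opens Y & {r : nat & 'I_r -> V U}},
  open_set (tag B) y /\ forall W (sWU : W `<=` tag B) (v : V W),
    exists! c : 'I_(tag (tagged B)) -> structure_sheaf W,
      v = \sum_i c i *: res sWU (tagged (tagged B) i).
Proof. by have [U [r [e [Uy h]]]] := vb_free V y; exists (Tagged _ (Tagged _ e)). Qed.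

Definition bas_open y : opens Y := tag (sval (cid (basis_ex y))).
Definition bas_rank y : nat := tag (tagged (sval (cid (basis_ex y)))).
Definition bas y : 'I_(bas_rank y) -> V (bas_open y) := tagged (tagged (sval (cid (basis_ex y)))).

Lemma bas_openP y : open_set (bas_open y) y.
Proof. by have [] := svalP (cid (basis_ex y)). Qed.

Lemma bas_unique y W (sWU : W `<=` bas_open y) (v : V W) :
  exists! c : 'I_(bas_rank y) -> structure_sheaf W, v = \sum_i c i *: res sWU (bas i).
Proof. by have [_] := svalP (cid (basis_ex y)); exact. Qed.

Definition bcoord y W (sWU : W `<=` bas_open y) (v : V W) : 'I_(bas_rank y) -> structure_sheaf W :=
  sval (cid (bas_unique sWU v)).

Lemma bcoordE y W (sWU : W `<=` bas_open y) (v : V W) :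
  v = \sum_i bcoord sWU v i *: res sWU (bas i).
Proof. by have [] := svalP (cid (bas_unique sWU v)). Qed.

Lemma bcoord_uniq y W (sWU : W `<=` bas_open y) (v : V W) c :
  v = \sum_i c i *: res sWU (bas i) -> bcoord sWU v = c.
Proof. by have [_] := svalP (cid (bas_unique sWU v)); exact. Qed.

Lemma capl U W : cap U W `<=` U. Proof. by move=> y []. Qed.
Lemma capr U W : cap U W `<=` W. Proof. by move=> y []. Qed.

(** [U] need not contain [y]: the section is restricted to the intersection with the domain of the
    basis at [y], and its coordinates there are kept as rational functions. *)
Definition ncoord y (l : 'I_(bas_rank y)) U (v : V U) : ratfun Y :=
  secrat (bcoord (@capr U (bas_open y)) (res (@capl U (bas_open y)) v) l).

Lemma bas_open0 y : (bas_open y : set Y) !=set0.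
Proof. by exists y; exact: bas_openP. Qed.

(** Membership of the generic vector defined by [v] in the stalk at [y], even when [y] lies outside
    [U]. *)
Definition vreg y U (v : V U) : Prop := forall l : 'I_(bas_rank y), rint y (ncoord l v).

Lemma vreg_in y U (v : V U) : open_set U y -> vreg y v.
Proof.
move=> Uy l; apply/rint_regular/secrat_regular.
by split=> //; exact: bas_openP.
Qed.

Lemma ncoordD y (l : 'I_(bas_rank y)) U (u v : V U) : ncoord l (u + v) = ncoord l u + ncoord l v.
Proof.
rewrite -secratD; congr secrat; rewrite resD.
set a := res _ u; set b := res _ v; set s := @capr _ _.
rewrite (@bcoord_uniq _ _ s (a + b) (fun i => bcoord s a i + bcoord s b i)) //.
rewrite {1}(bcoordE s a) {1}(bcoordE s b) -big_split.
by apply: eq_bigr => i _; rewrite scalerDl.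
Qed.

Lemma ncoordZ y (l : 'I_(bas_rank y)) U (c : structure_sheaf U) (v : V U) :
  ncoord l (c *: v) = secrat c * ncoord l v.
Proof.
rewrite /ncoord -(secrat_resM (@capl _ _)); congr secrat; rewrite resZ.
set a := res _ v; set s := @capr _ _; set d := sheaf_res _ c.
rewrite (@bcoord_uniq _ _ s (d *: a) (fun i => d * bcoord s a i)) //.
rewrite {1}(bcoordE s a) scaler_sumr.
by apply: eq_bigr => i _; rewrite scalerA.
Qed.

Lemma ncoord_res y (l : 'I_(bas_rank y)) U W (sUW : U `<=` W) (v : V W) :
  (U : set Y) !=set0 -> generically [set z | ncoord l (res sUW v) z = ncoord l v z].
Proof.
move=> U0; have := open_generic (cap_neq0 U0 (bas_open0 y)); apply: filterS => z Uz.
have sub : cap U (bas_open y) `<=` cap W (bas_open y) by move=> w [/sUW].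
change (ncoord l (res sUW v) z = ncoord l v z).
rewrite /ncoord [RHS](_ : _ = secrat (sheaf_res sub (bcoord (@capr _ _) (res (@capl W (bas_open y)) v) l)) z).
  congr (secrat _ z); have sUW' := subset_trans (@capl U (bas_open y)) sUW.
  rewrite (res_comp _ _ sUW') -(res_comp sub (@capl W (bas_open y)) sUW').
  set a := res _ v; set s := @capr _ _; set s' := @capr _ _.
  rewrite (@bcoord_uniq _ _ s (res sub a) (fun i => sheaf_res sub (bcoord s' a i))) //.
  rewrite {1}(bcoordE s' a).
  rewrite res_sum.
  by apply: eq_bigr => i _; rewrite resZ (res_comp _ _ s).
by rewrite secrat_res.
Qed.

End LocalBases.
Lemma nbhs_opens (T : topologicalType) (y : T) (P : set T) : nbhs y P ->
  exists N : opens T, open_set N y /\ N `<=` P.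
Proof. by rewrite nbhsE => -[N [oN Ny] h]; exists (Opens oN). Qed.

Lemma secratX (k : closedFieldType) (Y : curve k) (U : opens Y) (s : structure_sheaf U) n y :
  open_set U y -> secrat (s ^+ n) y = (secrat s ^+ n) y.
Proof.
move=> Uy; elim: n => [|n IHn]; first exact: secrat1.
by rewrite !exprS secratM; change (secrat s y * secrat (s ^+ n) y = secrat s y * (secrat s ^+ n) y);
  rewrite IHn.
Qed.

Section CoordinateForms.
Variables (k : closedFieldType) (Y : curve k) (V : vector_bundle Y).
Variables (A : comNzRingType) (tau : {rmorphism ratfun Y -> A}).
Hypothesis tau_eq : forall a b, tau a = tau b <-> generically [set z | a z = b z].
Implicit Types U W : opens Y.
Local Notation form := (gform V tau).

Definition nu y (l : 'I_(bas_rank V y)) : form.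
Proof.
exists (fun U (v : V U) => tau (ncoord l v)) => [U u v|U s v|U W sUW v U0].
- by rewrite ncoordD rmorphD.
- by rewrite ncoordZ rmorphM.
- by apply/tau_eq; exact: ncoord_res.
Defined.

Lemma nuE y (l : 'I_(bas_rank V y)) U (v : V U) : nu l U v = tau (ncoord l v). Proof. by []. Qed.

Lemma form_expand (y : Y) (f : form) U (v : V U) : f U v = \sum_(l < bas_rank V y) nu l U v * f _ (bas l).
Proof.
have [U0|U0] := pselect ((U : set Y) !=set0); last first.
  by rewrite gf_empty // big1 // => l _; rewrite gf_empty // mul0r.
have C0 := cap_neq0 U0 (bas_open0 V y).
rewrite -(gf_res f (@capl _ _ U (bas_open V y)) v C0) [in LHS](bcoordE (@capr _ _ U (bas_open V y)) (res _ v)).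
rewrite gf_sum; apply: eq_bigr => l _.
by rewrite gfZ (gf_res f (@capr _ _ U (bas_open V y)) (bas l) C0).
Qed.

Lemma form_sep y U (u v : V U) : (forall l : 'I_(bas_rank V y), nu l U u = nu l U v) -> u = v.
Proof.
move=> h; have {h} h (f : form) : f U u = f U v.
  by rewrite (form_expand y f u) (form_expand y f v); apply: eq_bigr => l _; rewrite h.
apply: (@sheaf_sep _ _ V U Y (fun z => cap U (bas_open V z)) (fun z => @capl _ _ _ _)) => z.
  by move=> Uz; exists z => //; split=> //; exact: bas_openP.
rewrite (bcoordE (@capr _ _ U (bas_open V z)) (res _ u)) [RHS](bcoordE (@capr _ _ U (bas_open V z)) (res _ v)).
apply: eq_bigr => l _; congr (_ *: _); apply: secrat_inj; apply/tau_eq; exact: h (nu l).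
Qed.

Lemma vreg_eq y U W (u : V U) (v : V W) : (forall f : form, f U u = f W v) -> vreg y u -> vreg y v.
Proof. by move=> h hu l; apply: rint_ext (hu l); apply/tau_eq; exact: (h (nu l)). Qed.

Lemma vreg_extend y W (w : V W) (U : opens Y) : vreg y w -> open_set U y ->
  exists (N : opens Y) (u : V N), [/\ open_set N y, N `<=` U & forall f : form, f N u = f W w].
Proof.
move=> hw Uy; pose c (l : 'I_(bas_rank V y)) := ncoord l w.
have gP l : exists g : Y -> k, regular_at y g /\ generically [set z | c l z = g z].
  by have [g] := hw l; exists g.
pose g l := sval (cid (gP l)).
have rg l : regular_at y (g l) by have [] := svalP (cid (gP l)).
have cg l : generically [set z | c l z = g l z] by have [] := svalP (cid (gP l)).
have : \forall z \near y, open_set (cap U (bas_open V y)) z /\ forall l, regular_at z (g l).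
  have h1 : \forall z \near y, open_set (cap U (bas_open V y)) z.
    apply: open_nbhs_nbhs; split; first exact: open_setP.
    by split=> //; exact: bas_openP.
  have h2 : \forall z \near y, forall l, regular_at z (g l).
    by apply: filter_forall => l; exact: regular_near (rg l).
  by apply: filterS2 h1 h2.
move=> /nbhs_opens[N' [Ny hN]].
have sN : N' `<=` bas_open V y by move=> z /hN[[]].
have sl l : exists s : structure_sheaf N', forall z, s z = g l (val z).
  by apply: regular_section => z /hN[_]; exact.
pose s l := sval (cid (sl l)).
have sE l z : s l z = g l (val z) by exact: (svalP (cid (sl l)) z).
have N0 : (N' : set Y) !=set0 by exists y.
exists N', (\sum_l s l *: res sN (bas l)); split=> // [z /hN[[]]//|f].
rewrite gf_sum (form_expand y f w); apply: eq_bigr => l _.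
rewrite gfZ (gf_res f sN (bas l) N0); congr (_ * _); rewrite nuE; apply/tau_eq.
apply: filterS2 (cg l) (open_generic N0) => z cz Nz.
by change (secrat (s l) z = ncoord l w z); rewrite (secrat_in _ Nz) sE; exact: esym cz.
Qed.

Lemma vreg_near y W (w : V W) : vreg y w -> \forall z \near y, vreg z w.
Proof.
have Ty : open_set (Opens (@openT Y)) y by [].
move=> /vreg_extend/(_ Ty)[N [u [Ny _ e]]].
have := open_nbhs_nbhs (conj (open_setP N) Ny); apply: filterS => z Nz.
by apply: vreg_eq e _; exact: vreg_in.
Qed.

(** The local extensions of [vreg_extend] have the same image under all forms, and the coordinate
    forms of one local basis already separate sections, so the extensions agree on overlaps and
    glue. *)
Lemma section_extend W (w : V W) (U : opens Y) : (W : set Y) !=set0 ->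
  (forall y, open_set U y -> vreg y w) -> (U : set Y) !=set0 ->
  exists u : V U, forall f : form, f U u = f W w.
Proof.
move=> W0 hw [y0 Uy0].
have loc (p : {y | open_set U y}) : exists (N : {N : opens Y & V N}),
    [/\ open_set (tag N) (sval p), tag N `<=` U & forall f : form, f _ (tagged N) = f W w].
  case: p => y Uy; have [N [u [Ny NU e]]] := vreg_extend (hw y Uy) Uy.
  by exists (existT (fun N : opens Y => V N) N u).
pose N p := sval (cid (loc p)).
have NP p : [/\ open_set (tag (N p)) (sval p), tag (N p) `<=` U &
    forall f : form, f _ (tagged (N p)) = f W w] by exact: svalP (cid (loc p)).
have NU p : tag (N p) `<=` U by have [] := NP p.
have NE p : forall f : form, f _ (tagged (N p)) = f W w by have [] := NP p.
have [||u hu] := @sheaf_glue _ _ V U _ (fun p => tag (N p)) NU _ (fun p => tagged (N p)).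
- by move=> y Uy; exists (exist _ y Uy) => //; have [] := NP (exist _ y Uy).
- move=> p q D sp sq; have [D0|D0] := pselect ((D : set Y) !=set0); last exact: sec_empty.
  by apply: (form_sep (y := y0)) => l; rewrite !gf_res // !NE.
exists u => f; pose p0 : {y | open_set U y} := exist _ y0 Uy0.
rewrite -(NE p0) -hu gf_res //.
by have [h _ _] := NP p0; exists y0.
Qed.

(** * Dual bases along a fibre *)

Section ProjectiveCoordinates.
Variables (X : curve k) (f : mor Y X) (hf : covering f).

Lemma rint_powM y (a b : ratfun Y) n : rint y a -> rint y b -> rint y (a ^+ n * b).
Proof.
move=> ha hb; elim: n => [|n IHn]; first by rewrite mul1r.
by rewrite exprS -mulrA; exact: rintM.
Qed.

(** With [S j] equal to 1 at [p j] and 0 at the other points of the fibre, both the local basis at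
    [p j] and its coordinate forms are multiplied by a high power of [S j]. The sum [D] of the
    squares of these powers is a unit along the fibre, and dividing by it gives a dual basis. *)
Lemma projective_coordinates x : exists (U0 : opens Y) (I : finType) (v : I -> V U0) (n : I -> form),
  [/\ forall y, f y = x -> open_set U0 y,
      forall (l : form) U (w : V U), l U w = \sum_i n i U w * l _ (v i) &
      forall i U (w : V U), exists a, n i U w = tau a /\ forall y, f y = x -> vreg y w -> rint y a].
Proof.
have [m [p [s [ps rs sE]]]] := cover_separators hf x.
have px j : f (p j) = x by apply/ps; exists j.
pose S j := ratfun_of (rs j j).
have rS j i : rint (p i) (S j) by apply: rint_regular; exact: rs.
pose J := {j : 'I_m & 'I_(bas_rank V (p j))}.
pose e (t : J) : V (bas_open V (p (tag t))) := bas (tagged t).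
have SX j n z : (S j ^+ n) z = s j z ^+ n by rewrite -[LHS]/(ratfun_at z _) rmorphXn.
(* Two kinds of poles are cancelled at another point of the fibre: those of the basis vector, and
   those of the coordinate form on the basis there. *)
have pole (t t' : J) : exists n, forall n', (n <= n')%N ->
    tag t != tag t' -> rint (p (tag t')) (S (tag t) ^+ n' * ncoord (tagged t') (e t)) /\
    rint (p (tag t')) (S (tag t) ^+ n' * ncoord (tagged t) (e t')).
  have [tt|tt] := eqVneq (tag t) (tag t'); first by exists 0%N.
  have s0 : s (tag t) (p (tag t')) = 0 by rewrite sE (negPf tt).
  have [n hn] := rint_pole (ratfun_rational (ncoord (tagged t') (e t))) (rs _ _) s0.
  have [n1 hn1] := rint_pole (ratfun_rational (ncoord (tagged t) (e t'))) (rs _ _) s0.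
  exists (maxn n n1) => n'; rewrite geq_max => /andP[h1 h2] _.
  by split; [apply: rint_ext (hn _ h1)|apply: rint_ext (hn1 _ h2)];
    apply: (@filterS _ (@generically Y) _ setT) (@filterT _ (@generically Y) _) => z _;
    rewrite /= !fctE -SX.
pose n0 t t' := sval (cid (pole t t')).
(* The exponent is at least 1, so that [S j ^+ N] vanishes at the other points even if there are no
   poles to cancel. *)
pose N := (\max_t \max_t' n0 t t').+1%N.
have NP (t t' : J) : tag t != tag t' -> rint (p (tag t')) (S (tag t) ^+ N * ncoord (tagged t') (e t)) /\
    rint (p (tag t')) (S (tag t) ^+ N * ncoord (tagged t) (e t')).
  apply: (svalP (cid (pole t t'))).
  by apply: leqW; apply: leq_trans (leq_bigmax t); exact: (leq_bigmax t').
have opn j : exists W : opens Y, [/\ open_set W (p j), W `<=` bas_open V (p j) &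
    forall y, open_set W y -> regular_at y (s j)].
  have h1 := open_nbhs_nbhs (conj (open_setP (bas_open V (p j))) (bas_openP V (p j))).
  have [W [Wp h]] := nbhs_opens (filterI h1 (regular_near (rs j j))).
  by exists W; split=> // y /h[].
pose W j := sval (cid (opn j)).
have WP j : [/\ open_set (W j) (p j), W j `<=` bas_open V (p j) &
    forall y, open_set (W j) y -> regular_at y (s j)] by exact: svalP (cid (opn j)).
have sW j : W j `<=` bas_open V (p j) by have [] := WP j.
have W0 j : (W j : set Y) !=set0 by exists (p j); have [] := WP j.
have secj j : exists c : structure_sheaf (W j), forall z, c z = s j (val z).
  by apply: regular_section => y; have [_ _ h] := WP j; exact: h.
pose c j := sval (cid (secj j)).
have cE j : tau (secrat (c j)) = tau (S j).
  apply/tau_eq; apply: filterS (open_generic (W0 j)) => z Wz; change (secrat (c j) z = s j z).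
  by rewrite (secrat_in _ Wz); exact: (svalP (cid (secj j))).
pose v0 (t : J) : V (W (tag t)) := (c (tag t) ^+ N) *: res (sW (tag t)) (e t).
have v0E (l : form) t : l _ (v0 t) = tau (S (tag t) ^+ N) * l _ (e t).
  rewrite gfZ gf_res // rmorphXn -cE -rmorphXn; congr (_ * _); apply/tau_eq.
  by apply: filterS (open_generic (W0 (tag t))) => z Wz; exact: secratX.
have v0reg t y : f y = x -> vreg y (v0 t).
  move=> /ps[i ->]; move=> l; have [ti|ti] := eqVneq (tag t) i.
    by move: l; rewrite -ti => l; apply: vreg_in; have [] := WP (tag t).
  have [h _] := NP t (Tagged (fun j => 'I_(bas_rank V (p j))) l) ti.
  by apply: rint_ext h; apply/tau_eq; rewrite rmorphM; exact: (esym (v0E (nu l) t)).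
pose U0 := Opens (@open_interior Y [set y | forall t, vreg y (v0 t)]).
have U0p y : f y = x -> open_set U0 y.
  by move=> yx; apply: filter_forall => t; exact: vreg_near (v0reg t y yx).
have [i0 _] : exists i, p i = p i by have [y /ps[i _]] := cover_surjective hf x; exists i.
have U00 : (U0 : set Y) !=set0 by exists (p i0); exact: U0p.
have vex t : exists v : V U0, forall l : form, l U0 v = l _ (v0 t).
  by apply: section_extend => // y /interior_subset.
pose v t := sval (cid (vex t)).
have vE t (l : form) : l U0 (v t) = l _ (v0 t) by exact: (svalP (cid (vex t)) l).
pose D := \sum_j S j ^+ N * S j ^+ N.
have uD i : runit (p i) D.
  rewrite /D (bigD1 i) //=; apply: runitD.
    have h : runit (p i) (S i).
      exists (s i); split=> //; first by rewrite sE eqxx oner_neq0.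
      exact: (@filterS _ (@generically Y) _ setT) (@filterT _ (@generically Y) _).
    have hX n : runit (p i) (S i ^+ n).
      by elim: n => [|n IHn]; [exact: runit1|rewrite exprS; exact: runitM].
    exact: runitM.
  apply: (@big_ind _ (fun f : ratfun Y => rvanish (p i) f)) => [|a b|j ji].
  - exact: rvanish0.
  - exact: rvanishD.
  have hS : rvanish (p i) (S j).
    exists (s j); split=> //; first by rewrite sE (negPf ji).
    exact: (@filterS _ (@generically Y) _ setT) (@filterT _ (@generically Y) _).
  rewrite {1}/N exprS -mulrA; apply: rvanishM => //.
  have rX n : rint (p i) (S j ^+ n).
    by rewrite -[S j ^+ n]mulr1; apply: rint_powM; [exact: rS|exact: rint_cst].
  by rewrite -exprS; exact: (rintM (rX _) (rX _)).
have D1 : tau (ratfun_inv D) * tau D = 1.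
  rewrite -rmorphM -(rmorph1 tau); apply/tau_eq; apply: filterS (runit_neq0 (uD i0)) => z Dz.
  exact: mulVf.
exists U0, J, v, (fun t => tau (ratfun_inv D * S (tag t) ^+ N) *: nu (tagged t)); split=> //.
- move=> l U w; transitivity (tau (ratfun_inv D) * tau D * l U w); first by rewrite D1 mul1r.
  rewrite rmorph_sum mulr_sumr mulr_suml.
  have := @sig_big_dep A 0 +%R _ _ xpredT (fun=> xpredT) (fun j (i : 'I_(bas_rank V (p j))) =>
    (tau (ratfun_inv D * S j ^+ N) *: nu i) U w * l U0 (v (Tagged (fun j => 'I_(bas_rank V (p j))) i))).
  move=> h; transitivity (\sum_j \sum_(i < bas_rank V (p j)) (tau (ratfun_inv D * S j ^+ N) *: nu i) U w *
    l U0 (v (Tagged (fun j => 'I_(bas_rank V (p j))) i))); last first.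
    by apply: (etrans h); apply: eq_bigr => -[j i].
  apply: eq_bigr => j _; rewrite (form_expand (p j) l w) mulr_sumr; apply: eq_bigr => i _.
  rewrite vE v0E !rmorphM; set q := tau (S j ^+ N).
  by rewrite /= -!mulrA; congr (_ * _); rewrite mulrCA; congr (_ * _); rewrite mulrCA.
move=> t U w; exists (ratfun_inv D * S (tag t) ^+ N * ncoord (tagged t) w); split=> [|y /ps[i ->] hw].
  by rewrite [RHS]rmorphM.
rewrite -mulrA; apply: rintM; first exact: runit_rint (runit_inv (uD i)).
have [ti|ti] := eqVneq (tag t) i.
  by apply: rint_powM => //; move: hw; rewrite -ti; exact.
(* A vector in the stalk at [p i] is first expanded in the basis at [p i], where the values of the
   scaled form are regular by the choice of [N]. *)
have e1 : tau (S (tag t) ^+ N * ncoord (tagged t) w) =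
    tau (\sum_(l < bas_rank V (p i)) ncoord l w * (S (tag t) ^+ N * ncoord (tagged t) (bas l))).
  rewrite rmorphM -nuE (form_expand (p i)) rmorph_sum mulr_sumr; apply: eq_bigr => l _.
  by rewrite !rmorphM mulrCA.
apply: (rint_ext (f := \sum_(l < bas_rank V (p i)) ncoord l w * (S (tag t) ^+ N * ncoord (tagged t) (bas l)))).
  exact/tau_eq/esym.
apply: (@big_ind _ (fun f : ratfun Y => rint (p i) f)) => [|a b ha hb|l _].
- exact: rint_cst.
- by rewrite -[b]opprK; apply: rintB => //; rewrite -sub0r; apply: rintB => //; exact: rint_cst.
apply: rintM; first exact: hw.
by have [_ h] := NP t (Tagged (fun j => 'I_(bas_rank V (p j))) l) ti.
Qed.

End ProjectiveCoordinates.
End CoordinateForms.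

(** * Equivariant forms *)
Section ConjugateForms.
Variables (k : closedFieldType) (X Y1 Y2 : curve k) (G1 G2 : finGroupType).
Variables (a1 : group_action G1 Y1) (f1 : mor Y1 X) (gal1 : galois_covering a1 f1).
Variables (a2 : group_action G2 Y2) (f2 : mor Y2 X) (gal2 : galois_covering a2 f2).
Variable T : tensor gal1 gal2.
Variable V : equivariant_bundle a1.
Implicit Types (U W : opens Y1) (g h : G1) (x : X) (y : Y2).
Local Notation form := (gform V (tl T)).
Local Notation tr_g := (translate a1).
Local Notation lamV := (@lam k G1 Y1 a1 V).
Let gcomp := @gl_comp _ _ _ _ _ _ _ _ _ _ _ _ T.
Let gid := @gl_id _ _ _ _ _ _ _ _ _ _ _ _ T.
Let teq := @tl_eq _ _ _ _ _ _ _ _ _ _ _ _ T.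

Lemma translateKV g U : tr_g g (tr_g g^-1%g U) `<=` U.
Proof. by move=> z; rewrite /= -actM invgK mulgV act1. Qed.

Lemma translate_neq0 g U : (U : set Y1) !=set0 -> (tr_g g U : set Y1) !=set0.
Proof. by move=> [z Uz]; exists (a1 g z); rewrite /= -actM mulVg act1. Qed.

(** The semilinear action of [g] on generic vectors. The translate of the translate of [U] is [U]
    only up to an inclusion, which accounts for the restriction. *)
Definition pullv g U (v : V U) : V (tr_g g^-1%g U) := lamV (res (@translateKV g U) v).

Lemma lam_form (f : form) g U W W' (s : tr_g g W `<=` U) (s' : tr_g g W' `<=` U) (v : V U) :
  W' `<=` W -> (W' : set Y1) !=set0 -> f _ (lamV (res s' v)) = f _ (lamV (res s v)).
Proof.
move=> sW W0; rewrite -[RHS](gf_res f sW _ W0) -lam_res.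
by rewrite (res_comp _ _ s').
Qed.

Lemma pullv_res (f : form) g U W (sUW : U `<=` W) (v : V W) : (U : set Y1) !=set0 ->
  f _ (pullv g (res sUW v)) = f _ (pullv g v).
Proof.
move=> U0; rewrite /pullv (res_comp _ _ (subset_trans (@translateKV g U) sUW)).
by apply: lam_form; [move=> z; exact: sUW|exact: translate_neq0].
Qed.

Lemma secrat_pull g U (s : structure_sheaf U) :
  secrat (translate_fun (sheaf_res (@translateKV g U) s)) = ratfun_act a1 g (secrat s).
Proof.
apply: val_inj; apply/funext => z.
change (secrat (translate_fun (sheaf_res (@translateKV g U) s)) z = secrat s (a1 g z)).
have [Wz|nWz] := pselect (open_set (tr_g g^-1%g U) z).
  have Uz : open_set U (a1 g z) by move: Wz; rewrite /= invgK.
  rewrite (secrat_in _ Wz) (secrat_in _ Uz) /=.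
  by congr (s _); apply: val_inj.
by rewrite !secrat_out // => Uz; apply: nWz; rewrite /= invgK.
Qed.

(** Transport of structure by the actions on vectors and on values; by [ginv_lam] its fixed points
    are the equivariant forms. *)
Definition conjf g (f : form) : form.
Proof.
exists (fun U (v : V U) => gl T g^-1%g (f _ (pullv g v))) => [U u v|U s v|U W sUW v U0].
- by rewrite /pullv resD lamD gfD rmorphD.
- by rewrite /pullv resZ lamZ gfZ rmorphM secrat_pull -gl_tl gcomp mulgV gid.
- by rewrite pullv_res.
Defined.

Lemma conjfE g f U (v : V U) : conjf g f U v = gl T g^-1%g (f _ (pullv g v)). Proof. by []. Qed.

Lemma pullv_comp (f : form) g h U (v : V U) : f _ (pullv g (pullv h v)) = f _ (pullv (h * g)%g v).
Proof.
have [U0|U0] := pselect ((U : set Y1) !=set0); last first.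
  by rewrite !gf_empty // => -[z Uz]; apply: U0; eexists; exact: Uz.
pose W := tr_g g^-1%g (tr_g h^-1%g U).
have s : tr_g (h * g)%g W `<=` U.
  by move=> z; rewrite /= !invgK -!actM ?mulgA mulgV act1.
have s' : tr_g h (tr_g g W) `<=` U.
  by move=> z; rewrite /= !invgK -!actM ?mulgA mulgK mulgV act1.
have -> : f _ (pullv g (pullv h v)) = f W (lamV (res s v)).
  congr (f W _); rewrite lamM /pullv -lam_res; congr (lamV (lamV _)).
  by rewrite !(res_comp _ _ s').
apply: lam_form; last by do 2 apply: translate_neq0.
by move=> z; rewrite /= !invgK -actM.
Qed.

Lemma lam_inj g U : injective (fun v : V (tr_g g U) => lamV v).
Proof. exact: bij_inj (lam_bij V g U). Qed.

Lemma pullv_inj g U W (u : V U) (v : V W) : (U : set Y1) !=set0 -> (W : set Y1) !=set0 ->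
  (forall f : form, f _ (pullv g u) = f _ (pullv g v)) -> forall f : form, f _ u = f _ v.
Proof.
move=> U0 W0 h f; pose C := cap U W; have C0 : (C : set Y1) !=set0 := cap_neq0 U0 W0.
rewrite -(gf_res f (@capl _ _ U W) u C0) -(gf_res f (@capr _ _ U W) v C0).
have : pullv g (res (@capl _ _ U W) u) = pullv g (res (@capr _ _ U W) v).
  have [y0 _] := C0; apply: (@form_sep _ _ V _ _ teq y0) => l.
  by rewrite !pullv_res.
move=> /lam_inj e.
have D0 : (tr_g g (tr_g g^-1%g C) : set Y1) !=set0 by do 2 apply: translate_neq0.
rewrite -[LHS](gf_res f (@translateKV g C) _ D0) -[RHS](gf_res f (@translateKV g C) _ D0).
exact: congr1 e.
Qed.

(** The cocycle condition gives only that the action of 1 is idempotent; injectivity, in the form of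
    [pullv_inj], makes it the identity. *)
Lemma conjf1 f : conjf 1%g f = f.
Proof.
have g1 (u : T) : gl T 1^-1%g u = u by rewrite invg1 gid.
apply: gform_ext => U v; rewrite conjfE g1.
have [U0|U0] := pselect ((U : set Y1) !=set0); last first.
  by rewrite !gf_empty // => -[z Uz]; apply: U0; eexists; exact: Uz.
apply: (pullv_inj (g := 1%g)) => //; first exact: translate_neq0.
by move=> l; rewrite pullv_comp mulg1.
Qed.

Lemma conjf_comp g h f : conjf h (conjf g f) = conjf (h * g)%g f.
Proof. by apply: gform_ext => U v; rewrite !conjfE gcomp pullv_comp -invMg. Qed.

Lemma conjfD g f f' : conjf g (f + f') = conjf g f + conjf g f'.
Proof. by apply: gform_ext => U v; rewrite !gfformD !conjfE rmorphD. Qed.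

Lemma conjfZ g u f : conjf g (u *: f) = gl T g^-1%g u *: conjf g f.
Proof. by apply: gform_ext => U v; rewrite gfformZ !conjfE rmorphM. Qed.

Lemma conjf0 g : conjf g 0 = 0.
Proof. by apply: gform_ext => U v; rewrite conjfE rmorph0. Qed.

Lemma conjf_sum g (I : Type) (r : seq I) (F : I -> form) :
  conjf g (\sum_(i <- r) F i) = \sum_(i <- r) conjf g (F i).
Proof. by elim: r => [|i r IHr]; rewrite ?big_nil ?conjf0 // !big_cons conjfD IHr. Qed.

Definition ginv (f : form) := forall g, conjf g f = f.

Lemma ginv_lam f : ginv f -> forall g U (v : V (tr_g g U)), f U (lamV v) = gl T g (f _ v).
Proof.
move=> hf g U v; rewrite -{2}(hf g) conjfE gcomp mulVg gid.
have [U0|U0] := pselect ((U : set Y1) !=set0); last first.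
  by rewrite !gf_empty // => -[z Uz]; apply: U0; eexists; exact: Uz.
have s : tr_g g U `<=` tr_g g U by [].
rewrite -{1}(res_id s v); apply: lam_form => //.
by move=> z; rewrite /= invgK -actM mulVg act1.
Qed.

Definition tracef (f : form) : form := \sum_g conjf g f.

Lemma tracef_inv f : ginv (tracef f).
Proof.
move=> h; rewrite conjf_sum (reindex_inj (mulgI h^-1%g)) /=.
by apply: eq_bigr => g _; rewrite conjf_comp mulKVg.
Qed.

Lemma tracef_sum (I : Type) (r : seq I) (F : I -> form) :
  tracef (\sum_(i <- r) F i) = \sum_(i <- r) tracef (F i).
Proof. by rewrite /tracef exchange_big; apply: eq_bigr => g _; exact: conjf_sum. Qed.

Lemma tracefZ u f : ginv f -> tracef (u *: f) = (\sum_g gl T g u) *: f.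
Proof.
move=> hf; rewrite /tracef scaler_suml (reindex_inj invg_inj) /=.
by apply: eq_bigr => g _; rewrite conjfZ invgK hf.
Qed.

Section TraceSystem.
Variables (J : finType) (u w : J -> T).
Hypothesis sys : forall g, \sum_j u j * gl T g (w j) = (g == 1%g)%:R.

Lemma system_sum (z : G1 -> T) : \sum_j u j * \sum_g gl T g (w j) * z g = z 1%g.
Proof.
under eq_bigr do rewrite mulr_sumr.
rewrite exchange_big (bigD1 1%g) //=.
under eq_bigr do rewrite mulrA.
rewrite -mulr_suml sys eqxx mul1r big1 ?addr0 // => g g1.
under eq_bigr do rewrite mulrA.
by rewrite -mulr_suml sys (negPf g1) mul0r.
Qed.

(** By [system_sum] each conjugate of [z] is a combination of conjugates of the [u j] with traces as
    coefficients. Traces are invariant, so the traces of all multiples of [f] lie in the span over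
    [k(Y2)] of finitely many of them. *)
Lemma trace_expand z f :
  \sum_j (\sum_g gl T g (w j * z)) *: tracef (u j *: f) = tracef (z *: f).
Proof.
rewrite /tracef; under eq_bigr do rewrite scaler_sumr.
rewrite exchange_big; apply: eq_bigr => h _; rewrite conjfZ.
under eq_bigr do rewrite conjfZ scalerA.
rewrite -scaler_suml; congr (_ *: _).
rewrite -[in RHS](gid z) -(system_sum (fun g => gl T g z)) rmorph_sum; apply: eq_bigr => j _.
rewrite rmorphM mulrC; congr (_ * _).
rewrite -[LHS](act_sum_fixed gcomp _ h^-1%g); congr (gl T _ _).
by apply: eq_bigr => g _; rewrite rmorphM.
Qed.

(** Descent in explicit form: the equivariant forms span all forms over [T]. *)
Lemma trace_recover f U (v : V U) : \sum_j u j * tracef (w j *: f) U v = f U v.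
Proof.
have := system_sum (fun g => conjf g^-1%g f U v); rewrite invg1 conjf1 => <-.
apply: eq_bigr => j _; congr (_ * _); rewrite gfform_sum (reindex_inj invg_inj).
by apply: eq_bigr => g _; rewrite conjfZ invgK gfformZ.
Qed.

End TraceSystem.

(** Only sections defined along the whole fibre are tested, which amounts to testing the stalk at
    [x] of the direct image of [V]. *)
Definition fbint x (f : form) := forall U (v : V U), (forall z, f1 z = x -> open_set U z) ->
  bint x (f U v).

Lemma fbint_tracef x f : fbint x f -> fbint x (tracef f).
Proof.
move=> hf U v hU; rewrite gfform_sum; apply: bint_sum => g; rewrite conjfE.
apply/bint_gl/hf => z zx /=; rewrite invgK; apply: hU.
by rewrite (action_over gal1).
Qed.

Lemma fbintZ x u f : bint x u -> fbint x f -> fbint x (u *: f).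
Proof. by move=> hu hf U v hU; apply: bintM => //; exact: hf. Qed.

Lemma bint_generic (u : T) : generically [set x | bint x u].
Proof. by have [x0 _] := curve_neq0 X; exact: punctured_generically (bint_spread x0 u). Qed.

Lemma generically_all (Z : curve k) (I : finType) (P : I -> set Z) :
  (forall i, generically (P i)) -> generically [set z | forall i, P i z].
Proof. by move=> h; exact: (@filter_forall Z I P _ (generically_filter Z) h). Qed.

Lemma fbint_generic f : generically [set x | fbint x f].
Proof.
have [y0 _] := curve_neq0 Y1.
have h1 := cover_generic (action_cover gal1) (open_generic (bas_open0 V y0)).
have h2 := generically_all (fun l : 'I_(bas_rank V y0) => bint_generic (f _ (bas l))).
apply: filterS2 h1 h2 => x hB hl U v hU.
rewrite (@form_expand _ _ V _ _ teq y0); apply: bint_sum => l; apply: bintM; last exact: hl.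
apply: bint_tl => z zx; apply/rint_regular/secrat_regular.
by split; [exact: hU|exact: hB].
Qed.

Lemma pint_all_bint x (u : T) : (forall y, f2 y = x -> pint y u) -> bint x u.
Proof.
move=> hu; apply: integral_coef (norm_poly_monic (gl T) u) (norm_poly_root gid u) _ => i.
have Kfix g : gl T g (norm_poly (gl T) u)`_i = (norm_poly (gl T) u)`_i by exact: norm_poly_fixed gcomp _ _ _.
have [c cE] := gl_fixed Kfix; rewrite cE; apply: bint_tr => y yx.
apply: (@pint_tr_rint _ _ _ _ _ _ _ _ _ _ _ _ T); rewrite -cE.
apply: (@coef_prodXsub T (pint y)) => [|p q|p q|g].
- exact: integral1.
- exact: integral_sub.
- exact: integral_mul.
- by apply: pint_gl; exact: hu.
Qed.

End ConjugateForms.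

(** * The dual bundle *)
Section ValuationBasis.
Variables (k : closedFieldType) (Y : curve k) (y : Y).
Variables (A : comNzRingType) (tau : {rmorphism ratfun Y -> A}).
Hypothesis tau_eq : forall a b, tau a = tau b <-> generically [set z | a z = b z].
Local Notation divides a b := (exists e : ratfun Y, rint y e /\ tau b = tau e * tau a).

Lemma tau_neq0 a : tau a <> 0 -> generically [set z | a z != 0].
Proof.
move=> a0; apply: rational_neq0; first exact: ratfun_rational.
by move=> h; apply: a0; rewrite -(rmorph0 tau); apply/tau_eq.
Qed.

Lemma tau_inv a : tau a <> 0 -> tau a * tau (ratfun_inv a) = 1.
Proof. by move=> /tau_neq0/ratfun_inv_mul h; rewrite -rmorphM -(rmorph1 tau); apply/tau_eq. Qed.

Lemma divides_or (a b : ratfun Y) : divides a b \/ divides b a.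
Proof.
have [a0|a0] := pselect (tau a = 0).
  by right; exists 0; split; [exact: rint_cst|rewrite a0 (rmorph0 tau) mul0r].
have [h|[g [rg gy h]]] := rint_or y (ratfun_rational (b * ratfun_inv a)).
  left; exists (b * ratfun_inv a); split=> //.
  by rewrite rmorphM -mulrA [tau (ratfun_inv a) * _]mulrC tau_inv // mulr1.
right; exists (ratfun_of rg); split; first exact: rint_regular.
have e : tau (b * ratfun_inv a) * tau (ratfun_of rg) = 1.
  by rewrite -rmorphM -(rmorph1 tau); apply/tau_eq; exact: h.
transitivity (tau a * (tau (b * ratfun_inv a) * tau (ratfun_of rg))); first by rewrite e mulr1.
have := tau_inv a0; rewrite rmorphM; move: (tau a) (tau b) (tau (ratfun_inv a)) (tau (ratfun_of rg)) => p q r s pr.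
by transitivity (p * r * (s * q)); [ring|rewrite pr mul1r].
Qed.

Lemma divides_trans a b c : divides a b -> divides b c -> divides a c.
Proof.
move=> [e [re he]] [d [rd hd]]; exists (d * e); split; first exact: rintM.
by rewrite rmorphM hd he mulrA.
Qed.

Lemma divides_min n (d : 'I_n.+1 -> ratfun Y) : exists i, forall j, divides (d i) (d j).
Proof.
elim: n d => [|n IHn] d.
  exists ord0 => j; exists 1; split; first exact: rint_cst.
  by rewrite rmorph1 mul1r (ord1 j).
have [i hi] := IHn (fun j => d (lift ord0 j)).
have refl l : divides (d l) (d l).
  by exists 1; split; [exact: rint_cst|rewrite rmorph1 mul1r].
have [h|h] := divides_or (d (lift ord0 i)) (d ord0).
  exists (lift ord0 i) => j; case: (unliftP ord0 j) => [l ->|->//]; exact: hi.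
exists ord0 => j; case: (unliftP ord0 j) => [l ->|->//].
exact: divides_trans h (hi l).
Qed.

(** In a nontrivial relation one coefficient divides all the others. Dividing by it expresses one
    member through the rest with coefficients regular at [y], so members are discarded until the
    remaining ones are independent. *)
Lemma valuation_basis (M : lmodType A) (I : finType) (P : I -> M) :
  exists (r : nat) (b : 'I_r -> I) (c : I -> 'I_r -> ratfun Y),
  [/\ forall i j, rint y (c i j), forall i, P i = \sum_j tau (c i j) *: P (b j) &
      forall d : 'I_r -> ratfun Y, \sum_j tau (d j) *: P (b j) = 0 -> forall j, tau (d j) = 0].
Proof.
have gen : exists (r : nat) (b : 'I_r -> I) (c : I -> 'I_r -> ratfun Y),
    (forall i j, rint y (c i j)) /\ forall i, P i = \sum_j tau (c i j) *: P (b j).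
  exists #|I|, enum_val, (fun i j => (enum_val j == i)%:R); split=> i.
    by move=> j; case: (_ == _); exact: rint_cst.
  rewrite (bigD1 (enum_rank i)) //= enum_rankK eqxx rmorph1 scale1r big1 ?addr0 // => j ji.
  rewrite (_ : (enum_val j == i) = false) ?(rmorph0 tau) ?scale0r //.
  by apply: contraNF ji => /eqP <-; rewrite enum_valK.
case: gen => r; elim: r => [|r IHr] [b [c [rc ec]]].
  by exists 0%N, b, c; split=> // d _ [].
have [h|h] := pselect (forall d : 'I_r.+1 -> ratfun Y,
  \sum_j tau (d j) *: P (b j) = 0 -> forall j, tau (d j) = 0); first by exists r.+1, b, c.
have [d [ed [j0 dj0]]] : exists d : 'I_r.+1 -> ratfun Y,
    \sum_j tau (d j) *: P (b j) = 0 /\ exists j, tau (d j) <> 0.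
  apply: contrapT => n; apply: h => d ed j; apply: contrapT => dj; apply: n.
  by exists d; split=> //; exists j.
have [i hi] := divides_min d.
have di : tau (d i) <> 0 by move=> di; apply: dj0; have [e [_ ->]] := hi j0; rewrite di mulr0.
pose e j := sval (cid (hi j)).
have eP j : rint y (e j) /\ tau (d j) = tau (e j) * tau (d i) by exact: svalP (cid (hi j)).
have Pi : P (b i) = \sum_j tau (- e (lift i j)) *: P (b (lift i j)).
  have : \sum_j tau (e j) *: P (b j) = 0.
    transitivity (tau (ratfun_inv (d i)) *: \sum_j tau (d j) *: P (b j)); last by rewrite ed scaler0.
    rewrite scaler_sumr; apply: eq_bigr => j _; have [_ ->] := eP j.
    by rewrite scalerA mulrCA [_ * tau (d i)]mulrC tau_inv // mulr1.
  have ei : tau (e i) = 1.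
    have [_] := eP i => h1; rewrite -(tau_inv di) {1}h1 -mulrA tau_inv // mulr1 //.
  rewrite (bigD1_ord i) //= ei scale1r => /eqP; rewrite addr_eq0 => /eqP ->.
  by rewrite -sumrN; apply: eq_bigr => j _; rewrite rmorphN scaleNr.
apply: IHr; exists (fun j => b (lift i j)), (fun l j => c l (lift i j) - c l i * e (lift i j)).
split=> [l j|l].
  by apply: rintB; [exact: rc|apply: rintM; [exact: rc|have [] := eP (lift i j)]].
rewrite (ec l) (bigD1_ord i) //= Pi scaler_sumr -big_split; apply: eq_bigr => j _ /=.
by rewrite scalerA -scalerDl -rmorphM -rmorphD mulrN addrC.
Qed.

End ValuationBasis.

(** * The sheaf of invariant integral forms *)

Section DualForms.
Variables (k : closedFieldType) (X Y1 Y2 : curve k) (G1 G2 : finGroupType).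
Variables (a1 : group_action G1 Y1) (f1 : mor Y1 X) (gal1 : galois_covering a1 f1).
Variables (a2 : group_action G2 Y2) (f2 : mor Y2 X) (gal2 : galois_covering a2 f2).
Variable T : tensor gal1 gal2.

Lemma pint_gr (y : Y2) h (u : T) : pint (a2 h y) u -> pint y (gr T h u).
Proof.
move=> [p mp pu]; have := rmorph_root (gr T h) pu; rewrite -map_poly_comp.
set phi := (_ \o _) => pu'; have mphi : map_poly phi p \is monic by exact: monic_map.
apply: (integral_coef mphi pu') => i; rewrite coef_map /phi /= gr_tr; apply: pint_tr.
by apply: rint_act; apply: rint_regular; exact: pregerm_regular.
Qed.

Variable V : equivariant_bundle a1.
Implicit Types (U W : opens Y2) (h : G2).
Local Notation form := (gform V (tl T)).

Definition fint (f : form) (y : Y2) := forall (U : opens Y1) (v : V U), (forall z, f1 z = f2 y -> open_set U z) ->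
  pint y (f U v).

Lemma fbint_fint f y : fbint (f2 y) f -> fint f y.
Proof. by move=> hf U v hU; apply: bint_pint (erefl _) _; exact: hf. Qed.

Definition grf h (f : form) : form.
Proof.
exists (fun (U : opens Y1) (v : V U) => gr T h (f U v)) => [U u v|U s v|U W sUW v U0].
- by rewrite gfD rmorphD.
- by rewrite gfZ rmorphM gr_tl.
- by rewrite gf_res.
Defined.

Lemma grfE h f (U : opens Y1) (v : V U) : grf h f U v = gr T h (f U v). Proof. by []. Qed.

Lemma conjf_grf g h f : conjf g (grf h f) = grf h (conjf g f).
Proof. by apply: gform_ext => U v; rewrite conjfE !grfE conjfE gl_gr. Qed.

Lemma grf_fint h f y : fint f (a2 h y) -> fint (grf h f) y.
Proof.
move=> hf U v hU; rewrite grfE; apply/pint_gr/hf => z zy; apply: hU.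
by rewrite zy (action_over gal2).
Qed.

(* Without the second clause the sections over the empty set would not be zero. *)
Definition dualP U (f : form) : Prop := [/\ ginv f, ~ ((U : set Y2) !=set0) -> f = 0 &
  forall y, open_set U y -> fint f y].
Definition is_dual U : pred form := [pred f | `[< dualP U f >]].

Fact is_dual_zmod U : zmod_closed (is_dual U).
Proof.
split=> [|f f' /asboolP[h1 h2 h3] /asboolP[h1' h2' h3']]; apply/asboolP.
  split=> // [g|y _ W v _]; first exact: conjf0.
  exact: integral0.
split=> [g|U0|y Uy W v hW].
- rewrite -[- f']scaleN1r conjfD conjfZ h1 h1' rmorphN rmorph1 //.
- by rewrite h2 // h2' // subrr.
have -> : (f - f') W v = f W v - f' W v by [].
by apply: integral_sub; [exact: h3|exact: h3'].
Qed.

Record dual_sections U := DualSection { dual_form : form; _ : dual_form \in is_dual U }.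
HB.instance Definition _ U := [isSub for @dual_form U].
HB.instance Definition _ U := [Choice of dual_sections U by <:].
HB.instance Definition _ U := GRing.SubChoice_isSubZmodule.Build _ _ (dual_sections U) (is_dual_zmod U).

Lemma dual_sectionP U (f : dual_sections U) : dualP U (dual_form f).
Proof. exact/asboolP/(valP f). Qed.

Lemma dual_empty U (f f' : dual_sections U) : ~ ((U : set Y2) !=set0) -> f = f'.
Proof.
move=> U0; apply: val_inj; have [_ h _] := dual_sectionP f; have [_ h' _] := dual_sectionP f'.
by rewrite /= h // h'.
Qed.

Fact dual_scale_subproof U (s : structure_sheaf U) (f : dual_sections U) :
  tr T (secrat s) *: dual_form f \in is_dual U.
Proof.
have [h1 h2 h3] := dual_sectionP f; apply/asboolP; split=> [g|U0|y Uy W v hW].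
- by rewrite conjfZ gl_tr h1.
- by rewrite h2 // scaler0.
apply: integral_mul; last exact: h3.
by apply: pint_tr; apply/rint_regular/secrat_regular.
Qed.
Definition dual_scale U (s : structure_sheaf U) (f : dual_sections U) : dual_sections U :=
  DualSection (dual_scale_subproof s f).

Lemma tr_secrat1 U : (U : set Y2) !=set0 -> tr T (secrat (1 : structure_sheaf U)) = 1.
Proof.
move=> U0; rewrite -(rmorph1 (tr T)); apply/tr_eq; apply: filterS (open_generic U0) => z Uz.
exact: secrat1.
Qed.

Fact dual_scaleA U (s s' : structure_sheaf U) f : dual_scale s (dual_scale s' f) = dual_scale (s * s') f.
Proof. by apply: val_inj; rewrite /= scalerA secratM rmorphM. Qed.
Fact dual_scale1 U : left_id (1 : structure_sheaf U) (@dual_scale U).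
Proof.
move=> f; have [U0|U0] := pselect ((U : set Y2) !=set0); last exact: dual_empty.
by apply: val_inj; rewrite /= tr_secrat1 // scale1r.
Qed.
Fact dual_scaleDr U : right_distributive (@dual_scale U) +%R.
Proof. by move=> s f f'; apply: val_inj; exact: scalerDr. Qed.
Fact dual_scaleDl U (f : dual_sections U) : {morph (@dual_scale U)^~ f : a b / a + b}.
Proof. by move=> s s'; apply: val_inj; rewrite /= secratD rmorphD scalerDl. Qed.
HB.instance Definition _ U := GRing.Zmodule_isLmodule.Build (structure_sheaf U) (dual_sections U)
  (@dual_scaleA U) (@dual_scale1 U) (@dual_scaleDr U) (@dual_scaleDl U).

Lemma dual_formD U (f f' : dual_sections U) : dual_form (f + f') = dual_form f + dual_form f'.
Proof. by []. Qed.
Lemma dual_formZ U (s : structure_sheaf U) f : dual_form (s *: f) = tr T (secrat s) *: dual_form f.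
Proof. by []. Qed.
Lemma dual_form_sum U (I : Type) (r : seq I) (F : I -> dual_sections U) :
  dual_form (\sum_(i <- r) F i) = \sum_(i <- r) dual_form (F i).
Proof. by elim: r => [|i r IHr]; rewrite ?big_nil // !big_cons -IHr. Qed.

(** Restriction keeps the form, except that over the empty set the only section is 0. *)
Definition dual_res_form U (f : form) : form := if pselect ((U : set Y2) !=set0) then f else 0.

Fact dual_res_subproof U W (sUW : U `<=` W) (f : dual_sections W) :
  dual_res_form U (dual_form f) \in is_dual U.
Proof.
have [h1 h2 h3] := dual_sectionP f; apply/asboolP; rewrite /dual_res_form.
case: pselect => U0; split=> //; [by move=> y /sUW; exact: h3|move=> g; exact: conjf0|].
move=> y _ W' v _; exact: integral0.
Qed.
Definition dual_res U W (sUW : U `<=` W) (f : dual_sections W) : dual_sections U :=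
  DualSection (dual_res_subproof sUW f).

Lemma dual_resE U W (sUW : U `<=` W) f : (U : set Y2) !=set0 -> dual_form (dual_res sUW f) = dual_form f.
Proof. by rewrite /= /dual_res_form; case: pselect. Qed.

Lemma tr_secrat_res U W (sUW : U `<=` W) (s : structure_sheaf W) : (U : set Y2) !=set0 ->
  tr T (secrat (sheaf_res sUW s)) = tr T (secrat s).
Proof.
by move=> U0; apply/tr_eq; apply: filterS (open_generic U0) => z Uz; exact: secrat_res.
Qed.

Definition dual_sheaf : module_sheaf Y2.
Proof.
refine (@ModuleSheaf k Y2 (fun U => dual_sections U : lmodType (structure_sheaf U)) dual_res
  _ _ _ _ _ _).
- move=> U W sUW f f'; have [U0|U0] := pselect ((U : set Y2) !=set0); last exact: dual_empty.
  by apply: val_inj; rewrite /= -/(dual_res_form U _) /dual_res_form; case: pselect.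
- move=> U W sUW s f; have [U0|U0] := pselect ((U : set Y2) !=set0); last exact: dual_empty.
  apply: val_inj; transitivity (dual_form (s *: f)); first exact: dual_resE.
  rewrite dual_formZ; transitivity (tr T (secrat (sheaf_res sUW s)) *: dual_form (dual_res sUW f)) => //.
  by rewrite dual_resE // tr_secrat_res.
- move=> U sUU f; have [U0|U0] := pselect ((U : set Y2) !=set0); last exact: dual_empty.
  by apply: val_inj; exact: dual_resE.
- move=> U W Z sUW sWZ sUZ f; have [U0|U0] := pselect ((U : set Y2) !=set0); last exact: dual_empty.
  have W0 : (W : set Y2) !=set0 by have [y /sUW Wy] := U0; exists y.
  apply: val_inj; transitivity (dual_form (dual_res sWZ f)); first exact: dual_resE.
  by rewrite dual_resE //; symmetry; exact: dual_resE.
- move=> U I C sCU cU f f' e; have [U0|U0] := pselect ((U : set Y2) !=set0); last exact: dual_empty.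
  have [y Uy] := U0; have [i _ Cy] := cU y Uy; have C0 : (C i : set Y2) !=set0 by exists y.
  by apply: val_inj; rewrite /= -(dual_resE (sCU i) f C0) e dual_resE.
move=> U I C sCU cU f ef; have [U0|U0] := pselect ((U : set Y2) !=set0); last first.
  exists 0 => i; apply: dual_empty => -[y Cy]; apply: U0; exists y; exact: sCU Cy.
have [y Uy] := U0; have [i0 _ Cy] := cU y Uy; have C0 : (C i0 : set Y2) !=set0 by exists y.
have same i : (C i : set Y2) !=set0 -> dual_form (f i) = dual_form (f i0).
  move=> Ci; have CC := cap_neq0 Ci C0.
  have := congr1 (@dual_form _) (ef i i0 (cap (C i) (C i0)) (@capl _ _ _ _) (@capr _ _ _ _)).
  by rewrite !dual_resE.
have fP : dual_form (f i0) \in is_dual U.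
  have [h1 h2 h3] := dual_sectionP (f i0); apply/asboolP; split=> // z Uz.
  have [i _ Cz] := cU z Uz; rewrite -(same i); last by exists z.
  by have [_ _] := dual_sectionP (f i); exact.
exists (DualSection fP) => i; have [Ci|Ci] := pselect ((C i : set Y2) !=set0); last exact: dual_empty.
apply: val_inj; transitivity (dual_form (f i0)); last exact: esym (same i Ci).
exact: (dual_resE (sCU i) (DualSection fP) Ci).
Defined.

End DualForms.

(** * Local freeness and functoriality of the dual *)

Section DualBundle.
Variables (k : closedFieldType) (X Y1 Y2 : curve k) (G1 G2 : finGroupType).
Variables (a1 : group_action G1 Y1) (f1 : mor Y1 X) (gal1 : galois_covering a1 f1).
Variables (a2 : group_action G2 Y2) (f2 : mor Y2 X) (gal2 : galois_covering a2 f2).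
Variable T : tensor gal1 gal2.

(* The trace c and the dual families u, w make T finite Galois, and etale, over k(Y2)
   at the points above x. *)
Definition system_at (x : X) : Prop := exists (I : finType) (u w : I -> T) (c : T),
  [/\ forall i, bint x (u i), forall i, bint x (w i), bint x c,
      forall g, \sum_i u i * gl T g (w i) = (g == 1%g)%:R & \sum_g gl T g c = 1].
Hypothesis systems : forall x, system_at x.
Let teq := @tl_eq _ _ _ _ _ _ _ _ _ _ _ _ T.
Let gcomp := @gl_comp _ _ _ _ _ _ _ _ _ _ _ _ T.
Let rcomp := @gl_comp _ _ _ _ _ _ _ _ _ _ _ _ (tensor_swap T).
Let rid := @gl_id _ _ _ _ _ _ _ _ _ _ _ _ (tensor_swap T).

Section FixedBundle.
Variable V : equivariant_bundle a1.
Local Notation form := (gform V (tl T)).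
Local Notation dual := (@dual_sheaf _ _ _ _ _ _ _ _ gal1 _ _ gal2 T V).
Local Notation dsec := (@dual_sections _ _ _ _ _ _ _ _ gal1 _ _ gal2 T V).

Lemma integral_coordinates x : exists (U0 : opens Y1) (I : finType) (v : I -> V U0) (n : I -> form),
  [/\ forall z, f1 z = x -> open_set U0 z, forall f : form, f = \sum_i f _ (v i) *: n i,
      forall i, fbint x (n i) &
      forall i U (w : V U), exists a, n i U w = tl T a /\ forall z, f1 z = x -> vreg z w -> rint z a].
Proof.
have [U0 [I [v [n [hU hn rn]]]]] := @projective_coordinates _ _ V _ _ teq _ _ (action_cover gal1) x.
exists U0, I, v, n; split=> // [f|i U w hw].
  apply: gform_ext => U w; rewrite gfform_sum hn; apply: eq_bigr => i _.
  by rewrite gfformZ mulrC.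
have [a [-> ha]] := rn i U w; apply: bint_tl => z zx; apply: ha => //.
by apply: vreg_in; exact: hw.
Qed.

(** Since [c] has trace 1, an equivariant [f] is the trace of [c *: f]. Inserting the dual basis
    [v], [n] and then [trace_expand] gives the formula, in which [f] enters only through traces. *)
Lemma dual_expand (U0 : opens Y1) (I J : finType) (v : I -> V U0) (n : I -> form) (u w : J -> T) c :
  (forall f : form, f = \sum_i f _ (v i) *: n i) ->
  (forall g, \sum_j u j * gl T g (w j) = (g == 1%g)%:R) -> \sum_g gl T g c = 1 ->
  forall f, ginv f -> f = \sum_(p : I * J) (\sum_g gl T g (w p.2 * (c * f _ (v p.1)))) *: tracef (u p.2 *: n p.1).
Proof.
move=> hn sys hc f hf; rewrite -[LHS]scale1r -hc -tracefZ // [in LHS](hn f) scaler_sumr tracef_sum.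
rewrite (eq_bigr (fun p => (fun i j => (\sum_g gl T g (w j * (c * f _ (v i)))) *:
  tracef (u j *: n i)) p.1 p.2)) //.
rewrite -(pair_bigA _ (fun i j => (\sum_g gl T g (w j * (c * f _ (v i)))) *: tracef (u j *: n i))) /=.
by apply: eq_bigr => i _; rewrite scalerA (trace_expand sys).
Qed.

(** By [dual_expand] finitely many trace forms generate the dual at [y2], and [valuation_basis]
    extracts an independent generating subfamily. Both expansions keep regular coefficients near
    [y2], so this is a basis over an open set. *)
Lemma dual_free : locally_free dual.
Proof.
move=> y2; set x := f2 y2.
have [U0 [I [v [n [hU hn bn _]]]]] := integral_coordinates x.
have [J [u [w [c [bu bw bc sys hc]]]]] := systems x.
pose Phi (p : I * J) := tracef (u p.2 *: n p.1).
have bPhi p : fbint x (Phi p) by apply: fbint_tracef; exact: fbintZ.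
have treq := @tr_eq _ _ _ _ _ _ _ _ _ _ _ _ T.
have [r [b [d [rd ed indep]]]] := valuation_basis y2 treq Phi.
(* These conditions make the coefficients of both expansions regular at [y]. They hold at [y2] and
   generically, hence on a neighbourhood of [y2]. *)
pose good y := [/\ forall p, fint (Phi p) y, forall j, pint y (w j), pint y c,
  forall z, f1 z = f2 y -> open_set U0 z & forall p l, rint y (d p l)].
have good2 : good y2.
  split=> // [p|j|]; [exact: fbint_fint|exact: bint_pint (erefl _) _|exact: bint_pint (erefl _) _].
have gen : generically good.
  have [z0 z0x] := cover_surjective (action_cover gal1) x.
  have dom (P : set X) : generically P -> generically [set y | P (f2 y)].
    by move=> h; have := cover_dominant (action_cover gal2) h.
  have h1 := dom _ (generically_all (fun p => fbint_generic (Phi p))).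
  have h2 := dom _ (generically_all (fun j => bint_generic (w j))).
  have h3 := dom _ (bint_generic c).
  have h4 := dom _ (cover_generic (action_cover gal1) (open_generic (ex_intro _ z0 (hU z0 z0x)))).
  have h5 : generically [set y | forall q : I * J * 'I_r, rint y (d q.1 q.2)].
    apply: generically_all => q; apply: filterS (ratfun_rational (d q.1 q.2)) => y.
    exact: rint_regular.
  apply: filterS3 (generically_and h1 h2) (generically_and h3 h4) h5 => y [g1 g2] [g3 g4] g5.
  split=> // [p|j||p l].
  - exact/fbint_fint/g1.
  - exact: bint_pint (erefl _) (g2 j).
  - exact: bint_pint (erefl _) g3.
  - exact: (g5 (p, l)).
have [U2 [U2y hU2]] : exists U2 : opens Y2, open_set U2 y2 /\ U2 `<=` good.
  apply: nbhs_opens; apply: filterS (generically_punctured y2 gen) => y hy.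
  by have [->|] := pselect (y = y2).
have U20 : (U2 : set Y2) !=set0 by exists y2.
have eP l : Phi (b l) \in is_dual U2.
  by apply/asboolP; split=> // [|y /hU2[]//]; exact: tracef_inv.
exists U2, r, (fun l => DualSection (eP l) : dual U2); split=> // W sWU f.
have [W0|W0] := pselect ((W : set Y2) !=set0); last first.
  exists (fun=> 0); split; first exact: dual_empty.
  move=> s' _; apply/funext => l; apply: secrat_inj.
  have [y0 _] := curve_neq0 Y2.
  apply: (@filterS _ (@generically Y2) _ setT) (@filterT _ (@generically Y2) _) => z _.
  change (secrat (0 : structure_sheaf W) z = secrat (s' l) z).
  by rewrite !secrat_out // => Wz; apply: W0; exists z.
have [hf _ fi] := dual_sectionP f.
have tfix p := gl_fixed (act_sum_fixed gcomp (w p.2 * (c * dual_form f _ (v p.1)))).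
pose s (p : I * J) := sval (cid (tfix p)).
have sE p : \sum_g gl T g (w p.2 * (c * dual_form f _ (v p.1))) = tr T (s p).
  exact: svalP (cid (tfix p)).
pose e l := \sum_p s p * d p l.
have fE : dual_form f = \sum_l tr T (e l) *: Phi (b l).
  rewrite [LHS](dual_expand hn sys hc hf).
  transitivity (\sum_p \sum_l (tr T (s p * d p l)) *: Phi (b l)).
    apply: eq_bigr => p _; rewrite sE -/(Phi p) ed scaler_sumr.
    by apply: eq_bigr => l _; rewrite scalerA rmorphM.
  rewrite exchange_big; apply: eq_bigr => l _.
  by rewrite -scaler_suml -rmorph_sum.
have re l y : open_set W y -> rint y (e l).
  move=> Wy; have [_ pw pc yU rdy] := hU2 y (sWU y Wy).
  apply: (@big_ind _ (fun h : ratfun Y2 => rint y h)) => [|h h' r1 r2|p _].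
  - exact: rint_cst.
  - by rewrite -[h']opprK; apply: rintB => //; rewrite -sub0r; apply: rintB => //; exact: rint_cst.
  apply: rintM; last exact: rdy.
  apply: (@pint_tr_rint _ _ _ _ _ _ _ _ _ _ _ _ T); rewrite -sE.
  apply: (@big_ind _ (pint y)) => [|h h'|g _]; [exact: integral0|exact: integral_add|].
  apply/pint_gl/integral_mul; first exact: pw.
  by apply: integral_mul => //; apply: fi.
have sec l : exists sg : structure_sheaf W, tr T (secrat sg) = tr T (e l).
  by have [sg h] := section_of W0 (re l); exists sg; apply/tr_eq.
pose sg l := sval (cid (sec l)).
have sgE l : tr T (secrat (sg l)) = tr T (e l) by exact: svalP (cid (sec l)).
have combE (h : 'I_r -> structure_sheaf W) :
    dual_form (\sum_l h l *: res sWU (DualSection (eP l) : dual U2) : dual W) = \sum_l tr T (secrat (h l)) *: Phi (b l).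
  by rewrite dual_form_sum; apply: eq_bigr => l _; rewrite dual_formZ dual_resE.
exists sg; split.
  apply: val_inj; change (dual_form f = dual_form (\sum_l sg l *: res sWU (DualSection (eP l) : dual U2) : dual W)).
  by rewrite combE fE; apply: eq_bigr => l _; rewrite sgE.
move=> s' fs'; apply/funext => l; apply: secrat_inj; apply/treq.
have e2 : \sum_l tr T (secrat (s' l)) *: Phi (b l) = \sum_l tr T (e l) *: Phi (b l).
  by rewrite -combE -fs' fE.
apply/eqP; rewrite -subr_eq0 -rmorphB; apply/eqP; apply: (indep (fun l => secrat (sg l) - secrat (s' l))).
under eq_bigr do rewrite rmorphB scalerBl sgE.
by rewrite sumrB e2 subrr.
Qed.

Lemma grf_dual (h : G2) (U W : opens Y2) (f : form) : f \in is_dual W ->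
  ((W : set Y2) !=set0 -> (U : set Y2) !=set0) -> (forall y, open_set U y -> open_set W (a2 h y)) ->
  grf h f \in is_dual U.
Proof.
move=> /asboolP[h1 h2 h3] UW sUW; apply/asboolP; split=> [g|U0|y Uy].
- by rewrite conjf_grf h1.
- by rewrite h2 => [|/UW//]; apply: gform_ext => Z v; exact: rmorph0.
by apply: grf_fint; exact/h3/sUW.
Qed.

Lemma translate_neq0V h (U : opens Y2) : (translate a2 h U : set Y2) !=set0 -> (U : set Y2) !=set0.
Proof. by move=> [y Uy]; exists (a2 h^-1%g y). Qed.

Fact dual_lam_subproof h (U : opens Y2) (f : dsec (translate a2 h U)) :
  grf h (dual_form f) \in is_dual U.
Proof.
apply: (grf_dual (W := translate a2 h U)) (valP f) _ _; first exact: translate_neq0V.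
by move=> y Uy; rewrite /= -actM mulVg act1.
Qed.
Definition dual_lam h U (f : dsec (translate a2 h U)) : dsec U := DualSection (dual_lam_subproof f).

Fact dual_lamV_subproof h (U : opens Y2) (f : dsec U) :
  grf h^-1%g (dual_form f) \in is_dual (translate a2 h U).
Proof. by apply: (grf_dual (W := U)) (valP f) _ _; first exact: translate_neq0. Qed.

Lemma secrat_translate h (U : opens Y2) (s : structure_sheaf (translate a2 h U)) :
  secrat (translate_fun s) = ratfun_act a2 h (secrat s).
Proof.
apply: val_inj; apply/funext => z; change (secrat (translate_fun s) z = secrat s (a2 h z)).
have [Uz|nUz] := pselect (open_set U z).
  have Wz : open_set (translate a2 h U) (a2 h z) by rewrite /= -actM mulVg act1.
  by rewrite (secrat_in _ Uz) (secrat_in _ Wz) /=; congr (s _); apply: val_inj.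
by rewrite !secrat_out //= -actM mulVg act1.
Qed.

Definition dual_bundle : equivariant_bundle a2.
Proof.
refine (@EquivariantBundle k G2 Y2 a2 (VectorBundle dual_free) dual_lam _ _ _ _ _).
- move=> h U f f'; apply: val_inj; apply: gform_ext => W v; exact: rmorphD.
- move=> h U s f; apply: val_inj; apply: gform_ext => W v.
  change (gr T h (tr T (secrat s) * dual_form f W v) = tr T (secrat (translate_fun s)) * gr T h (dual_form f W v)).
  by rewrite rmorphM gr_tr secrat_translate.
- move=> h U W sUW f; have [U0|U0] := pselect ((U : set Y2) !=set0); last exact: dual_empty.
  apply: val_inj; change (grf h (dual_form (dual_res (translateS (g := h) sUW) f)) =
    dual_form (dual_res sUW (dual_lam f))).
  by rewrite !dual_resE //; exact: translate_neq0.
- move=> h U; exists (fun f => DualSection (dual_lamV_subproof h f)) => f; apply: val_inj;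
    apply: gform_ext => W v.
    change (gr T h^-1%g (gr T h (dual_form f W v)) = dual_form f W v).
    by have := rcomp h h^-1%g; rewrite /= => ->; rewrite mulgV; exact: rid.
  change (gr T h (gr T h^-1%g (dual_form f W v)) = dual_form f W v).
  by have := rcomp h^-1%g h; rewrite /= => ->; rewrite mulVg; exact: rid.
move=> g h U f; have [U0|U0] := pselect ((U : set Y2) !=set0); last exact: dual_empty.
apply: val_inj; apply: gform_ext => W v.
change (gr T (g * h)%g (dual_form f W v) =
  gr T h (gr T g (dual_form (dual_res (translateM (a := a2) (g := g) (h := h) (U := U)) f) W v))).
rewrite dual_resE; last by do 2 apply: translate_neq0.
by symmetry; exact: rcomp.
Defined.

End FixedBundle.

Section DualMap.
Variables (V V' : equivariant_bundle a1) (phi : equivariant_hom V V').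

Definition compf (f : gform V' (tl T)) : gform V (tl T).
Proof.
exists (fun U (v : V U) => f U (phi U v)) => [U u v|U s v|U W sUW v U0].
- by rewrite ehD gfD.
- by rewrite ehZ gfZ.
- by rewrite eh_res gf_res.
Defined.

Fact dual_map_subproof U (f : dual_bundle V' U) : compf (dual_form f) \in is_dual U.
Proof.
have [h1 h2 h3] := dual_sectionP f; apply/asboolP; split=> [g|U0|y Uy W v hW].
- apply: gform_ext => W v; rewrite conjfE -[RHS]/(dual_form f W (phi W v)) -{2}(h1 g) conjfE.
  by congr (gl T _ _); rewrite /= /pullv eh_lam eh_res.
- by rewrite h2 //; apply: gform_ext.
exact: h3.
Qed.

Definition dual_map : equivariant_hom (dual_bundle V') (dual_bundle V).
Proof.
refine (@EquivariantHom k G2 Y2 a2 (dual_bundle V') (dual_bundle V)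
  (fun U f => DualSection (dual_map_subproof f)) _ _ _ _).
- by move=> U f f'; apply: val_inj; apply: gform_ext.
- by move=> U s f; apply: val_inj; apply: gform_ext.
- move=> U W sUW f; have [U0|U0] := pselect ((U : set Y2) !=set0); last exact: dual_empty.
  apply: val_inj; change (compf (dual_form (dual_res sUW f)) =
    dual_form (dual_res sUW (DualSection (dual_map_subproof f)))).
  by rewrite !dual_resE.
by move=> h U f; apply: val_inj; apply: gform_ext.
Defined.

End DualMap.
End DualBundle.

(** * Biduality *)
Section Biduality.
Variables (k : closedFieldType) (X Y1 Y2 : curve k) (G1 G2 : finGroupType).
Variables (a1 : group_action G1 Y1) (f1 : mor Y1 X) (gal1 : galois_covering a1 f1).
Variables (a2 : group_action G2 Y2) (f2 : mor Y2 X) (gal2 : galois_covering a2 f2).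
Variable T : tensor gal1 gal2.
Hypothesis systems : forall x, system_at T x.
Hypothesis systems' : forall x, system_at (tensor_swap T) x.
Let teq := @tl_eq _ _ _ _ _ _ _ _ _ _ _ _ T.
Let gcomp := @gl_comp _ _ _ _ _ _ _ _ _ _ _ _ T.
Let gid := @gl_id _ _ _ _ _ _ _ _ _ _ _ _ T.
Let rcomp : forall (g h : G2) (u : T), gr T h (gr T g u) = gr T (g * h)%g u :=
  @gl_comp _ _ _ _ _ _ _ _ _ _ _ _ (tensor_swap T).
Let rid : forall u : T, gr T 1%g u = u := @gl_id _ _ _ _ _ _ _ _ _ _ _ _ (tensor_swap T).
Variable V : equivariant_bundle a1.
Local Notation form := (gform V (tl T)).
Local Notation E := (dual_bundle systems V).
Local Notation EE := (dual_bundle systems' E).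
Local Notation pint' y u := (@pint _ _ _ _ _ _ _ _ _ _ _ _ (tensor_swap T) y u).
Implicit Types (f : form).

Lemma bint_pint' x (y : Y1) (u : T) : f1 y = x -> bint x u -> pint' y u.
Proof. by move=> yx /bint_swap; exact: bint_pint. Qed.

Lemma pint'_tl (y : Y1) (a : ratfun Y1) : rint y a -> pint' y (tl T a).
Proof. exact: (pint_tr (tensor_swap T)). Qed.

Lemma pint'_rint (y : Y1) (a : ratfun Y1) : pint' y (tl T a) -> rint y a.
Proof. exact: (@pint_tr_rint _ _ _ _ _ _ _ _ _ _ _ _ (tensor_swap T)). Qed.

Definition ev_form U (v : V U) : gform E (tl (tensor_swap T)).
Proof.
exists (fun U2 (phi : E U2) => dual_form phi U v) => // U2 W2 s phi U20.
by change (dual_form (dual_res s phi) U v = dual_form phi U v); rewrite dual_resE.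
Defined.

Lemma ev_dual U (v : V U) : ev_form v \in is_dual U.
Proof.
apply/asboolP; split=> [h|U0|y Uy].
- apply: gform_ext => U2 phi; have [U20|U20] := pselect ((U2 : set Y2) !=set0); last by rewrite !gf_empty.
  change (gr T h^-1%g (gr T h (dual_form (dual_res (@translateKV _ _ _ a2 h U2) phi) U v)) = dual_form phi U v).
  rewrite rcomp mulgV rid dual_resE //.
  by do 2 apply: translate_neq0.
- by apply: gform_ext => U2 phi; exact: (gf_empty (dual_form phi) v U0).
move=> U2 phi hU2; change (pint' y (dual_form phi U v)).
(* Integrality of [phi] concerns sections along the whole fibre, and [U] may miss part of it. A dual
   basis replaces [v] by such sections, with coefficients in [k(Y1)] that are regular at [y]. *)
have [U0 [I [w [n [hU hn bn hs]]]]] := integral_coordinates T V (f1 y).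
have [_ _ hphi] := dual_sectionP phi.
rewrite (hn (dual_form phi)) gfform_sum; apply: (@big_ind _ (fun u => pint' y u)) => [|u u'|i _].
- exact: integral0.
- exact: integral_add.
rewrite gfformZ; apply: integral_mul.
  apply: (bint_pint' (erefl (f1 y))); apply: pint_all_bint => z zy.
  by apply: hphi; [exact: hU2|move=> t; rewrite zy; exact: hU].
have [a [-> ra]] := hs i U v; apply: pint'_tl; apply: ra => //.
exact: vreg_in.
Qed.

Definition bidual_fun U (v : V U) : EE U := DualSection (ev_dual v).

Definition bidual : equivariant_hom V EE.
Proof.
refine (@EquivariantHom k G1 Y1 a1 V EE bidual_fun _ _ _ _).
- move=> U u v; apply: val_inj; apply: gform_ext => U2 phi; exact: gfD.
- move=> U s v; apply: val_inj; apply: gform_ext => U2 phi; exact: gfZ.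
- move=> U W s v; have [U0|U0] := pselect ((U : set Y1) !=set0); last exact: dual_empty.
  apply: val_inj; change (ev_form (res s v) = dual_form (dual_res s (bidual_fun v))).
  rewrite dual_resE //; apply: gform_ext => U2 phi; exact: gf_res.
move=> g U v; apply: val_inj; apply: gform_ext => U2 phi.
by have [h _ _] := dual_sectionP phi; exact: (ginv_lam h).
Defined.

Lemma fint_near f y : fint f y -> \forall z \near y, fint f z.
Proof.
move=> hf; have h := cover_dominant (action_cover gal2) (fbint_generic f).
apply: filterS (generically_punctured y h) => z hz.
by have [->|/hz/fbint_fint] := pselect (z = y).
Qed.

Lemma dual_ex x f : ginv f -> fbint x f -> exists U2 (phi : E U2),
  [/\ forall z, f2 z = x -> open_set U2 z, (U2 : set Y2) !=set0 & dual_form phi = f].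
Proof.
move=> hf bf; pose U2 := Opens (@open_interior Y2 [set y | fint f y]).
have hU z : f2 z = x -> open_set U2 z.
  by move=> zx; apply: fint_near; apply: fbint_fint; rewrite zx.
have [z zx] := cover_surjective (action_cover gal2) x.
have U20 : (U2 : set Y2) !=set0 by exists z; exact: hU.
have fP : f \in is_dual U2.
  by apply/asboolP; split=> // y /interior_subset.
by exists U2, (DualSection fP).
Qed.

Lemma dual_ex0 f : ginv f -> exists U2 (phi : E U2), (U2 : set Y2) !=set0 /\ dual_form phi = f.
Proof.
move=> hf; have [x bx] := generically_ex0 (fbint_generic f).
by have [U2 [phi [_ h1 h2]]] := dual_ex hf bx; exists U2, phi.
Qed.

(** By [trace_recover] each coordinate form is a combination of equivariant forms over [T], and an
    equivariant form is a section of the dual over some nonempty open set. *)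
Lemma bidual_inj U : injective (bidual U).
Proof.
move=> u v e; have [x0 _] := curve_neq0 X; have [J [p [w [c [_ _ _ sys _]]]]] := systems x0.
have [y0 _] := curve_neq0 Y1; apply: (@form_sep _ _ V _ _ teq y0) => l.
rewrite -(trace_recover sys _ u) -(trace_recover sys _ v); apply: eq_bigr => j _; congr (_ * _).
have [U2 [phi [_ <-]]] := dual_ex0 (tracef_inv (w j *: nu teq l)).
by have := congr1 (fun s : EE U => dual_form s U2 phi) e.
Qed.

(** * Surjectivity of the evaluation map *)

Section Surjectivity.
Variables (U : opens Y1) (psi : EE U).

Lemma psi_indep U2 W2 (phi : E U2) (phi' : E W2) : (U2 : set Y2) !=set0 -> (W2 : set Y2) !=set0 ->
  dual_form phi = dual_form phi' -> dual_form psi U2 phi = dual_form psi W2 phi'.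
Proof.
move=> U20 W20 e; have C0 := cap_neq0 U20 W20.
rewrite -(gf_res (dual_form psi) (@capl _ _ U2 W2) phi C0).
rewrite -(gf_res (dual_form psi) (@capr _ _ U2 W2) phi' C0); congr (dual_form psi _ _).
apply: val_inj; change (dual_form (dual_res (@capl _ _ U2 W2) phi) = dual_form (dual_res (@capr _ _ U2 W2) phi')).
by rewrite !dual_resE.
Qed.

(* The value of psi on an equivariant form, regarded as a section of E over some open set. *)
Definition psih (f : form) : T :=
  if pselect (exists t : T, exists U2 (phi : E U2),
    [/\ (U2 : set Y2) !=set0, dual_form phi = f & dual_form psi U2 phi = t]) is left e
  then sval (cid e) else 0.

Lemma psihE U2 (phi : E U2) : (U2 : set Y2) !=set0 -> psih (dual_form phi) = dual_form psi U2 phi.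
Proof.
move=> U20; rewrite /psih; case: pselect => [e|[]].
  by have [W2 [phi' [W20 e1 <-]]] := svalP (cid e); exact: psi_indep.
by exists (dual_form psi U2 phi), U2, phi.
Qed.

Lemma psihD f f' : ginv f -> ginv f' -> psih (f + f') = psih f + psih f'.
Proof.
move=> /dual_ex0[U2 [phi [U20 <-]]] /dual_ex0[W2 [phi' [W20 <-]]].
have C0 := cap_neq0 U20 W20; pose p : E _ := res (@capl _ _ U2 W2) phi; pose p' : E _ := res (@capr _ _ U2 W2) phi'.
have e : dual_form p = dual_form phi by exact: dual_resE.
have e' : dual_form p' = dual_form phi' by exact: dual_resE.
by rewrite -e -e' -dual_formD !psihE //; exact: gfD.
Qed.

Lemma psihZ d f : ginv f -> psih (tr T d *: f) = tr T d * psih f.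
Proof.
move=> /dual_ex0[U2 [phi [U20 <-]]].
have [z /nbhs_opens[N [Nz hN]]] := generically_ex0 (generically_near (ratfun_rational d)).
have C0 : (cap U2 N : set Y2) !=set0 by apply: cap_neq0 => //; exists z.
have [s sE] : exists s : structure_sheaf (cap U2 N), generically [set z | secrat s z = d z].
  by apply: section_of => // y [_ /hN]; exact: rint_regular.
have {}sE : tr T (secrat s) = tr T d by apply/tr_eq.
pose p : E _ := res (@capl _ _ U2 N) phi.
have e : dual_form p = dual_form phi by exact: dual_resE.
rewrite -e -sE -dual_formZ !psihE //; exact: gfZ.
Qed.

Lemma psih_sum (I : Type) (r : seq I) (F : I -> form) : (forall i, ginv (F i)) ->
  psih (\sum_(i <- r) F i) = \sum_(i <- r) psih (F i).
Proof.
move=> hF; have h0 : psih 0 = 0.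
  by rewrite -(scale0r (0 : form)) -(rmorph0 (tr T)) psihZ ?rmorph0 ?mul0r // => g; exact: conjf0.
suff [] : psih (\sum_(i <- r) F i) = \sum_(i <- r) psih (F i) /\ ginv (\sum_(i <- r) F i) by [].
elim: r => [|i r [IH1 IH2]]; first by rewrite !big_nil; split=> // g; exact: conjf0.
rewrite !big_cons psihD // IH1; split=> // g.
by rewrite conjfD hF IH2.
Qed.

Lemma psih_grf h f : ginv f -> psih (grf h f) = gr T h (psih f).
Proof.
move=> /dual_ex0[U2 [phi [U20 <-]]]; pose W := translate a2 h^-1%g U2.
have W0 : (W : set Y2) !=set0 by exact: translate_neq0.
have hW0 : (translate a2 h W : set Y2) !=set0 by exact: translate_neq0.
pose p : E (translate a2 h W) := res (@translateKV _ _ _ a2 h U2) phi.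
have e : dual_form p = dual_form phi by exact: dual_resE.
have -> : grf h (dual_form phi) = dual_form (dual_lam p) by rewrite -e.
rewrite psihE // -e psihE //.
by have [hp _ _] := dual_sectionP psi; exact: (ginv_lam hp).
Qed.

Lemma system_swap (J : finType) (u w : J -> T) :
  (forall g, \sum_j u j * gl T g (w j) = (g == 1%g)%:R) ->
  forall g, \sum_j w j * gl T g (u j) = (g == 1%g)%:R.
Proof.
move=> sys g; transitivity (gl T g (\sum_j u j * gl T g^-1%g (w j))).
  by rewrite rmorph_sum; apply: eq_bigr => j _; rewrite rmorphM gcomp mulVg gid mulrC.
by rewrite sys eq_invg1 rmorph_nat.
Qed.

(* The T-linear extension of psi to forms that need not be equivariant. *)
Definition Psi (J : finType) (u w : J -> T) f : T := \sum_j u j * psih (tracef (w j *: f)).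

(** Linearity over [T] and independence of the dual family are proved together: [trace_expand]
    rewrites the traces for one family through those for the other, and [system_sum] collapses the
    double sum. *)
Lemma Psi_system (J J' : finType) (u w : J -> T) (u' w' : J' -> T) z f :
  (forall g, \sum_j u j * gl T g (w j) = (g == 1%g)%:R) ->
  (forall g, \sum_j u' j * gl T g (w' j) = (g == 1%g)%:R) ->
  Psi u' w' (z *: f) = z * Psi u w f.
Proof.
move=> sys sys'; rewrite /Psi.
pose b j m := sval (cid (gl_fixed (act_sum_fixed gcomp (u m * (w' j * z))))).
have bE j m : \sum_g gl T g (u m * (w' j * z)) = tr T (b j m).
  exact: svalP (cid (gl_fixed (act_sum_fixed gcomp (u m * (w' j * z))))).
have e j : psih (tracef (w' j *: (z *: f))) = \sum_m tr T (b j m) * psih (tracef (w m *: f)).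
  rewrite scalerA -(trace_expand (system_swap sys)) psih_sum => [|m g].
    by apply: eq_bigr => m _; rewrite bE psihZ //; exact: tracef_inv.
  by rewrite bE conjfZ gl_tr tracef_inv.
under eq_bigr do rewrite e mulr_sumr.
rewrite exchange_big mulr_sumr; apply: eq_bigr => m _.
under eq_bigr do rewrite mulrA.
rewrite -mulr_suml mulrA; congr (_ * _).
rewrite -[RHS]mulrC -[in RHS](gid (u m * z)) -(system_sum sys' (fun g => gl T g (u m * z))).
apply: eq_bigr => j _; rewrite -bE; congr (_ * _); apply: eq_bigr => g _.
by rewrite -rmorphM mulrCA mulrA mulrAC -mulrA.
Qed.

Section FixedSystem.
Variables (J : finType) (u w : J -> T).
Hypothesis sys : forall g, \sum_j u j * gl T g (w j) = (g == 1%g)%:R.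

Lemma Psi_ginv f : ginv f -> Psi u w f = psih f.
Proof.
move=> hf; rewrite -[RHS]mul1r -(system_trace sys) mulr_suml; apply: eq_bigr => j _.
rewrite tracefZ // -mulrA; congr (_ * _).
by have [b ->] := gl_fixed (act_sum_fixed gcomp (w j)); exact: psihZ.
Qed.

Lemma PsiZ z f : Psi u w (z *: f) = z * Psi u w f.
Proof. exact: Psi_system. Qed.

Lemma Psi_sum (I : Type) (r : seq I) (F : I -> form) :
  Psi u w (\sum_(i <- r) F i) = \sum_(i <- r) Psi u w (F i).
Proof.
rewrite /Psi exchange_big; apply: eq_bigr => j _.
by rewrite scaler_sumr tracef_sum psih_sum ?mulr_sumr // => i; exact: tracef_inv.
Qed.

(** A form with values in [k(Y1)] is fixed by the second group, which carries a dual family to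
    another one. Independence of the family makes the value invariant, and the invariants are
    [k(Y1)]. *)
Lemma Psi_scalar f : (forall W (v : V W), exists a, f W v = tl T a) -> exists d, Psi u w f = tl T d.
Proof.
move=> hf; apply: (@gl_fixed _ _ _ _ _ _ _ _ _ _ _ _ (tensor_swap T)) => h.
change (gr T h (Psi u w f) = Psi u w f).
have fE : grf h f = f.
  by apply: gform_ext => W v; rewrite grfE; have [a ->] := hf W v; rewrite gr_tl.
have sys' g : \sum_j gr T h (u j) * gl T g (gr T h (w j)) = (g == 1%g)%:R.
  transitivity (gr T h (\sum_j u j * gl T g (w j))); last by rewrite sys rmorph_nat.
  by rewrite rmorph_sum; apply: eq_bigr => j _; rewrite rmorphM gl_gr.
have := Psi_system 1 f sys sys'; rewrite scale1r mul1r => e; rewrite -[RHS]e.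
rewrite /Psi rmorph_sum; apply: eq_bigr => j _; rewrite rmorphM -psih_grf; last exact: tracef_inv.
congr (_ * psih _); apply: gform_ext => W v; rewrite grfE !gfform_sum rmorph_sum.
apply: eq_bigr => g _; rewrite !conjfZ !gfformZ rmorphM gl_gr; congr (_ * _).
by rewrite -grfE -conjf_grf fE.
Qed.

End FixedSystem.

(** The vector with coefficients [Psi (n i)] on a dual basis represents [Psi], which extends [psi].
    That it lies in the stalk at each [y] of [U] is checked with a dual basis and a dual family
    integral over [f1 y], where the integrality of [psi] applies. *)
Lemma bidual_surj : (U : set Y1) !=set0 -> exists v, bidual U v = psi.
Proof.
move=> U0; have [x0 _] := curve_neq0 X; have [J [u [w [c0 [_ _ _ sys _]]]]] := systems x0.
have [U1 [I [v [n [hU1 hn _ sn]]]]] := integral_coordinates T V x0.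
have U10 : (U1 : set Y1) !=set0.
  by have [z zx] := cover_surjective (action_cover gal1) x0; exists z; exact: hU1.
have dex i : exists d, Psi u w (n i) = tl T d.
  by apply: (Psi_scalar sys) => W t; have [a [-> _]] := sn i W t; exists a.
pose d i := sval (cid (dex i)).
have dE i : Psi u w (n i) = tl T (d i) by exact: svalP (cid (dex i)).
have gd := generically_all (fun i => ratfun_rational (d i)).
have [z /nbhs_opens[N [Nz hN]]] := generically_ex0 (generically_near gd).
have C0 : (cap U1 N : set Y1) !=set0 by apply: cap_neq0 => //; exists z.
have sex i : exists s : structure_sheaf (cap U1 N), tl T (secrat s) = tl T (d i).
  have [|s sE] := section_of (c := d i) C0; last by exists s; apply/teq.
  by move=> y [_ /hN/(_ i)]; exact: rint_regular.
pose s i := sval (cid (sex i)).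
have sE i : tl T (secrat (s i)) = tl T (d i) by exact: svalP (cid (sex i)).
pose w0 : V (cap U1 N) := \sum_i s i *: res (@capl _ _ U1 N) (v i).
have w0E f : f _ w0 = Psi u w f.
  rewrite gf_sum [in RHS](hn f) Psi_sum; apply: eq_bigr => i _.
  by rewrite gfZ gf_res // sE -dE (PsiZ sys) mulrC.
have reg y : open_set U y -> vreg y w0.
  move=> Uy l; apply: pint'_rint; change (pint' y (nu teq l _ w0)).
  have [Ux [Ix [vx [nx [hUx hnx bnx snx]]]]] := integral_coordinates T V (f1 y).
  have [Jx [ux [wx [cx [bux bwx _ sysx _]]]]] := systems (f1 y).
  rewrite (hnx (nu teq l)) gfform_sum; apply: (@big_ind _ (fun t => pint' y t)) => [|t t'|i _].
  - exact: integral0.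
  - exact: integral_add.
  rewrite gfformZ; apply: integral_mul.
    by apply: pint'_tl; apply: vreg_in; exact: hUx.
  (* With scalar 1, [Psi_system] exchanges the fixed dual family for one that is integral over
     [f1 y]. *)
  rewrite w0E; have := Psi_system 1 (nx i) sysx sys; rewrite scale1r mul1r => ->.
  apply: (@big_ind _ (fun t => pint' y t)) => [|t t'|j _].
  - exact: integral0.
  - exact: integral_add.
  apply: integral_mul; first exact: bint_pint' (erefl _) (bux j).
  have bt : fbint (f1 y) (tracef (wx j *: nx i)) by apply: fbint_tracef; exact: fbintZ.
  have [U2 [phi [hU2 U20 <-]]] := dual_ex (tracef_inv _) bt.
  by rewrite psihE //; have [_ _ h] := dual_sectionP psi; exact: h.
have [v1 v1E] := section_extend teq C0 reg U0.
exists v1; apply: val_inj; apply: gform_ext => U2 phi.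
change (dual_form phi U v1 = dual_form psi U2 phi).
have [U20|U20] := pselect ((U2 : set Y2) !=set0); last first.
  by rewrite (dual_empty phi 0 U20) (gf0 (dual_form psi)).
have [hp _ _] := dual_sectionP phi.
by rewrite v1E w0E (Psi_ginv sys hp) psihE.
Qed.

End Surjectivity.

Lemma bidual_bij U : bijective (bidual U).
Proof.
have [U0|U0] := pselect ((U : set Y1) !=set0); last first.
  by exists (fun=> 0) => s; [exact: sec_empty|exact: dual_empty].
pose inv psi := sval (cid (bidual_surj psi U0)).
have invK psi : bidual U (inv psi) = psi by exact: svalP (cid (bidual_surj psi U0)).
by exists inv => // v; apply: bidual_inj; exact: invK.
Qed.

End Biduality.

(** * Equivalences from dualities *)
Section Contravariant.

Record contra (C D : category) := Contra {
  cobj :> C -> D;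
  cmap : forall x y, Defs.hom x y -> Defs.hom (cobj y) (cobj x);
  cmap_id : forall x, cmap (idc x) = idc (cobj x);
  cmap_comp : forall x y z (f : Defs.hom y z) (g : Defs.hom x y), cmap (Defs.comp f g) = Defs.comp (cmap g) (cmap f)
}.

Definition contra_comp (C D E : category) (F : contra D E) (G : contra C D) : functor C E.
Proof.
exists (fun x => F (G x)) (fun x y f => cmap F (cmap G f)) => [x|x y z f g].
  by rewrite !cmap_id.
by rewrite !cmap_comp.
Defined.

(** The inner pair [N], [M] is cancelled first. Its isomorphism is carried through the contravariant
    [B], which reverses it, so [w] and not [w'] appears in the map to the identity. *)
Lemma contra_iso_cancel (C D E : category) (A : contra C D) (B : contra D C) (M : contra D E) (N : contra E D) :
  nat_iso (functor_id C) (contra_comp B A) -> nat_iso (functor_id D) (contra_comp N M) ->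
  nat_iso (functor_comp (contra_comp B N) (contra_comp M A)) (functor_id C).
Proof.
move=> [u [u' [uK u'K nu]]] [w [w' [wK w'K nw]]].
exists (fun x => Defs.comp (u' x) (cmap B (w (A x)))), (fun x => Defs.comp (cmap B (w' (A x))) (u x)).
split=> [x|x|x y f].
- rewrite -Defs.compA (Defs.compA (u x)) u'K comp_idl -cmap_comp.
  by have /= -> := w'K (A x); exact: cmap_id.
- rewrite -Defs.compA (Defs.compA (cmap B (w _))) -cmap_comp.
  by have /= -> := wK (A x); rewrite cmap_id comp_idl uK.
have nu' : Defs.comp (u' y) (cmap B (cmap A f)) = Defs.comp f (u' x).
  rewrite -[LHS]comp_idr; have /= <- := u'K x.
  have /= e := nu x y f; rewrite -Defs.compA (Defs.compA (cmap B _)) -e !Defs.compA.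
  by have /= -> := uK y; rewrite comp_idl.
change (Defs.comp (Defs.comp (u' y) (cmap B (w (A y)))) (cmap B (cmap N (cmap M (cmap A f)))) =
  Defs.comp f (Defs.comp (u' x) (cmap B (w (A x))))).
rewrite -Defs.compA -cmap_comp; have /= <- := nw _ _ (cmap A f).
by rewrite cmap_comp Defs.compA nu' Defs.compA.
Qed.

(** Composing with the self-duality of [D] given by [M] and [N] restores the variance. *)
Lemma contra_equivalent (C D : category) (A : contra C D) (B : contra D C) (M N : contra D D) :
  nat_iso (functor_id C) (contra_comp B A) -> nat_iso (functor_id D) (contra_comp A B) ->
  nat_iso (functor_id D) (contra_comp N M) -> nat_iso (functor_id D) (contra_comp M N) ->
  equivalent C D.
Proof.
move=> BA AB NM MN; exists (contra_comp M A), (contra_comp B N).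
by split; exact: contra_iso_cancel.
Qed.

End Contravariant.

Lemma equivariant_hom_inverse (k : closedFieldType) (G : finGroupType) (Y : curve k)
    (a : group_action G Y) (V W : equivariant_bundle a) (phi : equivariant_hom V W) :
  (forall U, bijective (phi U)) -> exists psi : equivariant_hom W V,
    equivariant_comp psi phi = equivariant_id V /\ equivariant_comp phi psi = equivariant_id W.
Proof.
move=> hb; have inv U : exists psi : W U -> V U, cancel (phi U) psi /\ cancel psi (phi U).
  by have [psi h1 h2] := hb U; exists psi.
pose psi U := sval (cid (inv U)).
have [phiK psiK] : (forall U, cancel (phi U) (psi U)) /\ (forall U, cancel (psi U) (phi U)).
  by split=> U; have [] := svalP (cid (inv U)).
have inj U : injective (phi U) := can_inj (phiK U).
have psiD U u v : psi U (u + v) = psi U u + psi U v by apply: inj; rewrite ehD !psiK.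
have psiZ U (s : structure_sheaf U) v : psi U (s *: v) = s *: psi U v by apply: inj; rewrite ehZ !psiK.
have psir (U W' : opens Y) (s : U `<=` W') (v : W W') : psi U (res s v) = res s (psi W' v) by apply: inj; rewrite eh_res !psiK.
have psil g U (v : W (translate a g U)) : psi U (@lam _ _ _ _ W g U v) = @lam _ _ _ _ V g U (psi _ v) by apply: inj; rewrite eh_lam !psiK.
exists (EquivariantHom psiD psiZ psir psil); split; apply: equivariant_hom_ext => U v /=.
  exact: phiK.
exact: psiK.
Qed.

Lemma tensor_swapK (k : closedFieldType) (X Y1 Y2 : curve k) (G1 G2 : finGroupType)
    (a1 : group_action G1 Y1) (f1 : mor Y1 X) (gal1 : galois_covering a1 f1)
    (a2 : group_action G2 Y2) (f2 : mor Y2 X) (gal2 : galois_covering a2 f2)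
    (T : tensor gal1 gal2) : tensor_swap (tensor_swap T) = T.
Proof. by case: T => *; congr Tensor; exact: Prop_irrelevance. Qed.

Section DualFunctor.
Variables (k : closedFieldType) (X Y1 Y2 : curve k) (G1 G2 : finGroupType).
Variables (a1 : group_action G1 Y1) (f1 : mor Y1 X) (gal1 : galois_covering a1 f1).
Variables (a2 : group_action G2 Y2) (f2 : mor Y2 X) (gal2 : galois_covering a2 f2).

Definition dual_functor (T : tensor gal1 gal2) (s : forall x, system_at T x) :
  contra (equivariant_bundles a1) (equivariant_bundles a2).
Proof.
exists (fun V => dual_bundle s V : equivariant_bundles a2) (fun V W phi => dual_map s phi) => [V|V W Z phi psi];
  by apply: equivariant_hom_ext => U f; apply: val_inj; apply: gform_ext.
Defined.

End DualFunctor.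

Section DualEquivalence.
Variables (k : closedFieldType) (X Y1 Y2 : curve k) (G1 G2 : finGroupType).
Variables (a1 : group_action G1 Y1) (f1 : mor Y1 X) (gal1 : galois_covering a1 f1).
Variables (a2 : group_action G2 Y2) (f2 : mor Y2 X) (gal2 : galois_covering a2 f2).

Lemma bidual_iso (T : tensor gal1 gal2) s s' :
  nat_iso (functor_id _) (contra_comp (@dual_functor _ _ _ _ _ _ _ _ _ _ _ _ (tensor_swap T) s')
    (@dual_functor _ _ _ _ _ _ _ _ _ _ _ _ T s)).
Proof.
pose inv V := cid (equivariant_hom_inverse (bidual_bij s s' V)).
exists (fun V => bidual s s' V), (fun V => sval (inv V)); split=> [V|V|V W phi].
- by have [] := svalP (inv V).
- by have [] := svalP (inv V).
by apply: equivariant_hom_ext => U v; apply: val_inj; apply: gform_ext.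
Qed.

End DualEquivalence.

Section FinalSteps.
Variables (k : closedFieldType) (X Y1 Y2 : curve k) (G1 G2 : finGroupType).
Variables (a1 : group_action G1 Y1) (f1 : mor Y1 X) (gal1 : galois_covering a1 f1).
Variables (a2 : group_action G2 Y2) (f2 : mor Y2 X) (gal2 : galois_covering a2 f2).

(** This is biduality for the exchanged tensor; exchanging the factors twice gives back [T], not
    merely an isomorphic ring, so the functors match. *)
Lemma bidual_iso_swap (T : tensor gal1 gal2) s s' :
  nat_iso (functor_id _) (contra_comp (@dual_functor _ _ _ _ _ _ _ _ _ _ _ _ T s)
    (@dual_functor _ _ _ _ _ _ _ _ _ _ _ _ (tensor_swap T) s')).
Proof. by move: s; rewrite -{1 2}(tensor_swapK T) => s; exact: bidual_iso. Qed.

End FinalSteps.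

Theorem proposition3p6 (k : closedFieldType) (XP : formal_orbifold k)
    (geomXP : geometric XP)
    (Y1 Y2 : curve k) (Gamma1 Gamma2 : finGroupType)
    (a1 : group_action Gamma1 Y1) (a2 : group_action Gamma2 Y2)
    (f1 : mor Y1 XP) (f2 : mor Y2 XP)
    (cover1 : etale_galois_cover a1 f1) (cover2 : etale_galois_cover a2 f2) :
  equivalent (equivariant_bundles a1) (equivariant_bundles a2).
Proof.
have [[gal1 et1] [gal2 et2]] := (cover1, cover2).
have [T _] := tensor_ex gal1 gal2; have [S _] := tensor_ex gal2 gal2.
have sT := base_system (point_system et1 et2 T).
have sT' := base_system (point_system et2 et1 (tensor_swap T)).
have sS := base_system (point_system et2 et2 S).
have sS' := base_system (point_system et2 et2 (tensor_swap S)).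
exact: (contra_equivalent (bidual_iso sT sT') (bidual_iso_swap sT sT')
  (bidual_iso sS sS') (bidual_iso_swap sS sS')).
Qed.
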